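(* Let $\mathbb B=\{w\in\mathbb O:|w|<1\}$, let $\xi\in\partial\mathbb B$ and let $f$ be an octonion-valued slice regular function on $\mathbb B\cup\mathbb S_\xi$ such that $f(\mathbb B)\subseteq\mathbb B$ and $f(\xi)\in\partial\mathbb B$. Then: (i) $$\frac{\partial |f|}{\partial \xi}(\xi)=\overline{\xi}\Big(f(\xi)\overline{f'(\xi)}+\big[\bar{\xi}, f(\xi)\overline{R_{\bar{\xi}}R_{\xi}f(\xi)}\,\big]+2\big[\xi, f(\xi), R_{\bar{\xi}}R_{\xi}f(\xi)\big]\Big)\ \geq\ \frac{\big|1-\langle f(0), f(\xi)\rangle\big|^2}{1-|f(0)|^2},$$ where $\frac{\partial |f|}{\partial \xi}(\xi)$ is the directional derivative of $|f|$ along the direction $\xi$ at the boundary point $\xi$. (ii) If moreover $f(0)=0$ and $f(\xi)=\xi$, then $$\frac{\partial |f|}{\partial \xi}(\xi)= f'(\xi)-\big[\xi, R_{\bar{\xi}}R_{\xi}f(\xi)\big]\ \geq\ \frac{2}{1+\mathrm{Re}\, f'(0)}.$$ Moreover, equality holds in this last inequality if and only if $f$ is of the form $$f(w)=w\big(1-wa\bar{\xi}\,\big)^{-\ast}\ast\big(w\bar{\xi}-a\big)$$ for some constant $a\in[-1,1)$.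
   Context: $\mathbb O$ is the (non-commutative, non-associative, alternative) real division algebra of octonions, with conjugation $\bar w$, real part $\mathrm{Re}$, imaginary part $\mathrm{Im}$, norm $|w|^2=w\bar w$ and Euclidean inner product $\langle z,w\rangle=\mathrm{Re}(z\bar w)$. $\mathbb S=\{w\in\mathbb O:w^2=-1\}$; for $I\in\mathbb S$, $\mathbb C_I=\mathbb R\oplus I\mathbb R$ and $\Omega_I=\Omega\cap\mathbb C_I$. For $\xi=x+yI$ with $x,y\in\mathbb R$, $I\in\mathbb S$: $\mathbb S_\xi=x+y\mathbb S$. Lie bracket: $[u,v]=uv-vu$; associator: $[u,v,w]=(uv)w-u(vw)$. Slice regularity: $f:\Omega\to\mathbb O$ on a domain $\Omega\subseteq\mathbb O$ is slice regular if for every $I\in\mathbb S$ its restriction $f_I$ to $\Omega_I$ has continuous partial derivatives and $\frac12(\frac{\partial}{\partial x}+I\frac{\partial}{\partial y})f_I(x+yI)=0$ on $\Omega_I$. The slice derivative is $f'(x+yI)=\frac12(\frac{\partial}{\partial x}-I\frac{\partial}{\partial y})f_I(x+yI)$. A symmetric slice domain is a domain $\Omega$ meeting $\mathbb R$, with each $\Omega_I$ a domain in $\mathbb C_I$, and such that $x+yI\in\Omega$ implies $x+y\mathbb S\subseteq\Omega$. ''Slice regular on $\mathbb B\cup\mathbb S_\xi$'' means slice regular on some symmetric slice domain containing $\mathbb B\cup\mathbb S_\xi$. Regular product: a slice regular $f$ on a symmetric slice domain can be written $f(x+yI)=\alpha(x,y)+I\beta(x,y)$ for all $I\in\mathbb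 S$, with $\alpha,\beta$ octonion-valued, $\alpha$ even and $\beta$ odd in $y$. If also $g(x+yI)=\gamma+I\delta$, then $(f\ast g)(x+yI)=(\alpha\gamma-\beta\delta)+I(\alpha\delta+\beta\gamma)$; the regular conjugate is $f^c(x+yI)=\bar\alpha+I\bar\beta$, the symmetrization is $f^s=f\ast f^c=f^c\ast f$, and the regular reciprocal is $f^{-\ast}(w)=f^s(w)^{-1}f^c(w)$ off the zero set of $f^s$. On balls centred at $0$, $(\sum w^na_n)\ast(\sum w^nb_n)=\sum_n w^n\big(\sum_{k=0}^n a_kb_{n-k}\big)$. $R_\xi f$ is the unique slice regular function with $f(w)-f(\xi)=(w-\xi)\ast R_\xi f(w)$, and $R_{\bar\xi}R_\xi f$ is obtained by applying the same construction to $R_\xi f$ at the point $\bar\xi$: $R_\xi f(w)-R_\xi f(\bar\xi)=(w-\bar\xi)\ast R_{\bar\xi}R_\xi f(w)$. $R_{\bar\xi}R_\xi f(\xi)$ is the value of this function at $\xi$. An inequality between an octonion expression and a real number includes the assertion that the expression is real. *)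

(* Defs.v *)
From HB Require Import structures.
From mathcomp Require Import all_boot all_order all_algebra.
From mathcomp Require Import all_classical all_reals all_analysis.
From mathcomp Require Import ring lra.
Set Implicit Arguments.
Unset Strict Implicit.
Unset Printing Implicit Defensive.
Import Order.TTheory GRing.Theory Num.Theory.
Import numFieldNormedType.Exports.
Local Open Scope classical_set_scope.
Local Open Scope ring_scope.

(* Three Cayley-Dickson doublings of R, with (conj = conjugation)
     (a, b) (c, d) = (a c - conj d b, d a + b conj c),
     conj (a, b) = (conj a, - b).
   The vector space structure and the topology are those of the product R^8.
   Pitfall: the library's own product and norm on this product type are the
   componentwise product and the sup norm; the octonion product and modulus are
   [omul] (infix [**]) and [onorm] below. *)
Section CayleyDickson.
Variable R : realType.

Definition cplx : normedModType R := (R * R)%type.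
Definition cmul (z w : cplx) : cplx :=
  (z.1 * w.1 - w.2 * z.2, w.2 * z.1 + z.2 * w.1).
Definition cconj (z : cplx) : cplx := (z.1, - z.2).

Definition quat : normedModType R := (cplx * cplx)%type.
Definition qmul (p q : quat) : quat :=
  (cmul p.1 q.1 - cmul (cconj q.2) p.2, cmul q.2 p.1 + cmul p.2 (cconj q.1)).
Definition qconj (p : quat) : quat := (cconj p.1, - p.2).

Definition octonion : normedModType R := (quat * quat)%type.
Definition omul (u v : octonion) : octonion :=
  (qmul u.1 v.1 - qmul (qconj v.2) u.2, qmul v.2 u.1 + qmul u.2 (qconj v.1)).
Definition oconj (u : octonion) : octonion := (qconj u.1, - u.2).

Definition oreal (r : R) : octonion := (((r, 0), (0, 0)), ((0, 0), (0, 0))).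
Definition oRe (u : octonion) : R := u.1.1.1.
Definition oIm (u : octonion) : octonion := u - oreal (oRe u).

End CayleyDickson.

Arguments oreal {R} r.
Arguments oRe {R} u.

Notation "u ** v" := (omul u v)
  (at level 40, left associativity) : ring_scope.

Section Octonion.
Variable R : realType.
Local Notation O := (octonion R).

Definition oinner (z w : O) : R := oRe (z ** oconj w).
Definition onorm (w : O) : R := Num.sqrt (oRe (w ** oconj w)).
Definition oinv (w : O) : O := (onorm w ^+ 2)^-1 *: oconj w.
Definition obracket (u v : O) : O := u ** v - v ** u.
Definition oassoc (u v w : O) : O := (u ** v) ** w - u ** (v ** w).

Definition oball : set O := [set w | onorm w < 1].
Definition osphere : set O := [set w | onorm w = 1].

Definition imag_units : set O := [set w | w ** w = oreal (-1)].

(* The point x + y I, for p = (x, y). *)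
Definition slice (I : O) (p : R * R) : O := oreal p.1 + p.2 *: I.

(* S_xi = x + y S for xi = x + y I. *)
Definition xi_sphere (xi : O) : set O :=
  [set w | exists p I J, [/\ imag_units I, imag_units J,
                             xi = slice I p & w = slice J p]].

(* Every w is x + y I with x = Re w, y = |Im w| and I = [iunit w]; for real w,
   where every imaginary unit would do, an arbitrary one is fixed. *)
Definition o_i : O := (((0, 1), (0, 0)), ((0, 0), (0, 0))).
Definition iunit (w : O) : O :=
  if oIm w == 0 then o_i else (onorm (oIm w))^-1 *: oIm w.
Definition coords (w : O) : R * R := (oRe w, onorm (oIm w)).

Lemma onorm_sqr (w : O) :
  onorm w ^+ 2 =
  w.1.1.1 ^+ 2 + w.1.1.2 ^+ 2 + w.1.2.1 ^+ 2 + w.1.2.2 ^+ 2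
  + w.2.1.1 ^+ 2 + w.2.1.2 ^+ 2 + w.2.2.1 ^+ 2 + w.2.2.2 ^+ 2.
Proof.
set t := (X in _ = X).
have wwE : oRe (w ** oconj w) = t.
  rewrite {}/t; case: w => [[[a b] [c d]] [[e f] [g h]]].
  by rewrite /oRe /=; ring.
by rewrite /onorm wwE sqr_sqrtr // /t !addr_ge0 ?sqr_ge0.
Qed.

Lemma onorm_eq0 (w : O) : onorm w = 0 -> w = 0.
Proof.
move=> w0; have := onorm_sqr w; rewrite w0 expr0n /=.
case: w {w0} => [[[a b] [c d]] [[e f] [g h]]] /= sum0.
suff [-> -> -> ->] : [/\ a = 0, b = 0, c = 0 & d = 0].
  suff [-> -> -> ->] : [/\ e = 0, f = 0, g = 0 & h = 0] by [].
  by split; nra.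
by split; nra.
Qed.

Lemma slice_iunit (w : O) : slice (iunit w) (coords w) = w.
Proof.
rewrite /slice /coords /iunit /=; case: eqP => [w0|/eqP w0].
  have -> : onorm (oIm w) = 0.
    apply/eqP; rewrite -sqrf_eq0 onorm_sqr w0 /=; apply/eqP; ring.
  by rewrite scale0r addr0; apply/eqP; rewrite eq_sym -subr_eq0; apply/eqP.
rewrite scalerA divff ?scale1r; first by rewrite addrC subrK.
by apply: contra w0 => /eqP /onorm_eq0 ->.
Qed.

Lemma iunit_imag (w : O) : imag_units (iunit w).
Proof.
have oeq (a b c d e f g h a' b' c' d' e' f' g' h' : R) :
    a = a' -> b = b' -> c = c' -> d = d' ->
    e = e' -> f = f' -> g = g' -> h = h' ->
    ((((a, b), (c, d)), ((e, f), (g, h))) : O) =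
    (((a', b'), (c', d')), ((e', f'), (g', h'))).
  by do 8! move=> ->.
rewrite /imag_units /= /iunit; case: eqP => [_|/eqP w0].
  by apply: oeq => /=; ring.
have n0 : onorm (oIm w) != 0 by apply: contra w0 => /eqP /onorm_eq0 ->.
move: (onorm_sqr (oIm w)) n0; move: (onorm _) => n; clear w0.
case: w => [[[a b] [c d]] [[e f] [g h]]] /=; rewrite /oRe /= subrr expr0n /= => n2 n0.
have := mulVf n0; set m := n^-1 => mn.
have {}mn : m ^+ 2 * n ^+ 2 = 1 by rewrite -exprMn mn expr1n.
apply: oeq => /=; rewrite /GRing.scale /= ?subrr; try ring.
by rewrite -mn n2; ring.
Qed.

End Octonion.

Arguments onorm {R} w.
Arguments oball {R}.
Arguments osphere {R}.
Arguments imag_units {R}.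

Definition domain (T : topologicalType) (D : set T) : Prop :=
  [/\ D !=set0, open D & connected D].

Section SliceRegular.
Variable R : realType.
Local Notation O := (octonion R).

(* C_I is identified with the plane R * R through [slice I], so that Omega_I is
   [slice I @^-1` Omega] and f_I is [f \o slice I]. *)
Definition symmetric_slice_domain (Omega : set O) : Prop :=
  [/\ domain Omega,
      exists x, Omega (oreal x),
      forall I, imag_units I -> domain (slice I @^-1` Omega) &
      forall I J p, imag_units I -> imag_units J ->
        Omega (slice I p) -> Omega (slice J p)].

Definition partial_x (f : O -> O) (I : O) : R * R -> O :=
  'D_((1, 0) : R * R) (f \o slice I).
Definition partial_y (f : O -> O) (I : O) : R * R -> O :=
  'D_((0, 1) : R * R) (f \o slice I).

Definition slice_regular (Omega : set O) (f : O -> O) : Prop :=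
  forall I p, imag_units I -> Omega (slice I p) ->
    [/\ derivable (f \o slice I) p (1, 0),
        derivable (f \o slice I) p (0, 1),
        {for p, continuous (partial_x f I)},
        {for p, continuous (partial_y f I)} &
        2^-1 *: (partial_x f I p + I ** partial_y f I p) = 0].

(* For slice regular f the value does not depend on the representation
   w = x + y I that is used. *)
Definition slice_derive (f : O -> O) (w : O) : O :=
  2^-1 *: (partial_x f (iunit w) (coords w)
           - iunit w ** partial_y f (iunit w) (coords w)).

(* f(x + y I) = alpha(x, y) + I beta(x, y) on Omega, for F = (alpha, beta). *)
Definition stem_of (Omega : set O) (f : O -> O)
    (F : (R * R -> O) * (R * R -> O)) : Prop :=
  [/\ forall x y, F.1 (x, - y) = F.1 (x, y),
      forall x y, F.2 (x, - y) = - F.2 (x, y) &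
      forall I p, imag_units I -> Omega (slice I p) ->
        f (slice I p) = F.1 p + I ** F.2 p].

(* Such a pair is determined on the (x, y) with x + y I in Omega. *)
Definition stem (Omega : set O) (f : O -> O) : (R * R -> O) * (R * R -> O) :=
  xget (fun=> 0, fun=> 0) [set F | stem_of Omega f F].

(* x + y I |-> A(x, y) + I B(x, y); independent of the representation of the
   argument when A is even and B is odd in y. *)
Definition slice_fun (A B : R * R -> O) (w : O) : O :=
  A (coords w) + iunit w ** B (coords w).

(* The operations below are meant on Omega; on it they only depend on the
   restrictions of f and g to Omega. *)
Definition regular_mul (Omega : set O) (f g : O -> O) : O -> O :=
  let: (alpha, beta) := stem Omega f in
  let: (gamma, delta) := stem Omega g in
  slice_fun (fun p => alpha p ** gamma p - beta p ** delta p)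
            (fun p => alpha p ** delta p + beta p ** gamma p).

Definition regular_conj (Omega : set O) (f : O -> O) : O -> O :=
  let: (alpha, beta) := stem Omega f in
  slice_fun (fun p => oconj (alpha p)) (fun p => oconj (beta p)).

Definition symmetrization (Omega : set O) (f : O -> O) : O -> O :=
  regular_mul Omega f (regular_conj Omega f).

Definition regular_recip (Omega : set O) (f : O -> O) (w : O) : O :=
  oinv (symmetrization Omega f w) ** regular_conj Omega f w.

(* R_xi f *)
Definition quotient_of (Omega : set O) (xi : O) (f g : O -> O) : Prop :=
  slice_regular Omega g /\
  forall w, Omega w -> f w - f xi = regular_mul Omega (fun v => v - xi) g w.

Definition quotient_at (Omega : set O) (xi : O) (f : O -> O) : O -> O :=
  xget (fun=> 0) [set g | quotient_of Omega xi f g].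

(* The extremal function w (1 - w a conj xi)^{-*} * (w conj xi - a), defined off
   the zero set of the symmetrization of 1 - w a conj xi. *)
Definition extremal_denom (xi : O) (a : R) (w : O) : O :=
  oreal 1 - (w ** oreal a) ** oconj xi.

Definition extremal_dom (xi : O) (a : R) : set O :=
  [set w | symmetrization setT (extremal_denom xi a) w <> 0].

Definition extremal (xi : O) (a : R) (w : O) : O :=
  let D := extremal_dom xi a in
  w ** regular_mul D (regular_recip D (extremal_denom xi a))
                     (fun v => v ** oconj xi - oreal a) w.

End SliceRegular.

(* Main.v *)
(* On each slice [C_I] the Hermitian products [<f, v>_I] of a slice regular [f] with
   fixed octonions [v] are holomorphic functions of one complex variable, so the theory
   of bounded functions on the disc applies to them.  Put [p = f xi], let [I] be the
   imaginary unit of [xi], and [h = R R f xi].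

   The function [<f, p>_I] maps the disc to itself and takes the value 1 at [xi], hence
   [xi <f' xi, p>_I] is real and nonnegative; it is the directional derivative.  On the
   sphere of [xi], [f (x + y J) = alpha + J beta] has modulus at most 1, with equality at
   [J = I]; so [J |-> <alpha, J beta>] is maximal at [I], which forces [p conj beta] into
   [C_I].  As [beta = y (f' xi - 2 y I h)], this rewrites the derivative in terms of [h].

   For the inequality, [phi = <f, p>_I] and [alpha = <f, f 0>_I] give the self-map
   [1 - (1 - |f 0| ^ 2) (1 - phi) / ((1 - alpha) (1 - phi 0))] of the disc, which vanishes
   at 0; the Schwarz lemma bounds its derivative at [xi].

   When [f 0 = 0] and [f xi = xi], the bound is the Julia inequality for [<f / z, 1>_I].
   Equality makes this function a Moebius map; having modulus 1 on the circle, it leaves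
   no room for the other components of [f / z], so [f] is known on [C_I], and its stem
   determines it on the other slices. *)

Require Import Defs.
From mathcomp Require Import all_boot all_order all_algebra.
From mathcomp Require Import all_classical all_reals all_analysis.
From mathcomp Require Import complex.
From mathcomp Require Import ring lra.
Import Order.TTheory GRing.Theory Num.Theory.
Import numFieldNormedType.Exports.
Import Normc.
Set Implicit Arguments.
Unset Strict Implicit.
Unset Printing Implicit Defensive.
Local Open Scope classical_set_scope.
Local Open Scope ring_scope.
Local Open Scope complex_scope.

(** * Strictly differentiable functions of one complex variable *)

(** The products [hprod I (f z) v], for all [v], determine [f z], so octonionic statements are
    tested on scalar functions of a variable in [R[i]]. The analysis runs without contour integrals:
    strict differentiability and the vertices of regular polygons give a maximum principle, and
    removability and the identity theorem follow from it.

    The identity for the derivative comes from an equation multiplied by [y], the imaginary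
    coordinate of [xi], so it says nothing when [xi] is real. There every imaginary unit is a
    possible [I], and letting it vary shows that [f xi] times the conjugate of [f' xi] is real.

    The bound [2 / (1 + t)], with [t = Re f' 0], is [1 + (1 - t) / (1 + t)]: the factor [z] of
    [f = z * (f / z)] adds 1 to the derivative, and Julia's inequality bounds the contribution of
    [<f / z, 1>_I]. Its value at 0 may be 1; the scalar function is then constant, and this is the
    case [t = 1], [a = -1]. In general [a = - t], which explains the half-open interval. *)

Section ComplexNorm.
Variable R : realType.
Local Notation C := R[i].
Implicit Types x y z w : C.

Lemma normc_sqr z : normc z ^+ 2 = complex.Re z ^+ 2 + complex.Im z ^+ 2.
Proof. by case: z => a b /=; rewrite sqr_sqrtr // addr_ge0 ?sqr_ge0. Qed.

Lemma normc_ge0 z : 0 <= normc z.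
Proof. by case: z => a b; exact: sqrtr_ge0. Qed.

Lemma normcB z w : normc (z - w) = normc (w - z).
Proof. by rewrite -opprB normcN. Qed.

Lemma normc_triangle y x z : normc (x - z) <= normc (x - y) + normc (y - z).
Proof. by rewrite (_ : x - z = (x - y) + (y - z)) ?le_normcD //; ring. Qed.

Lemma normc_subD z w : normc (z - w) <= normc z + normc w.
Proof. by rewrite -(normcN w) le_normcD. Qed.

Lemma normc_ler_add z w : normc z - normc w <= normc (z + w).
Proof.
by have := normc_subD (z + w) w; rewrite addrK lerBlDr.
Qed.

Lemma normc_real (a : R) : normc a%:C = `|a|.
Proof. by rewrite /= expr0n addr0 sqrtr_sqr. Qed.

Lemma normcX z n : normc (z ^+ n) = normc z ^+ n.
Proof. by elim: n => [|n IH]; rewrite ?expr0 ?normc1 // !exprS normcM IH. Qed.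

Lemma normc_conj z : normc z^* = normc z.
Proof. by case: z => a b /=; rewrite sqrrN. Qed.

Lemma normc_gt0 z : (0 < normc z) = (z != 0).
Proof.
rewrite lt_def normc_ge0 andbT; congr (~~ _); apply/eqP/eqP => [|->].
  exact: eq0_normc.
exact: normc0.
Qed.

Lemma normc_Re z : `|complex.Re z| <= normc z.
Proof.
by case: z => a b /=; rewrite -sqrtr_sqr ler_wsqrtr // lerDl sqr_ge0.
Qed.

Lemma normc_Im z : `|complex.Im z| <= normc z.
Proof.
by case: z => a b /=; rewrite -sqrtr_sqr ler_wsqrtr // lerDr sqr_ge0.
Qed.

Lemma normc_ReIm z : normc z <= `|complex.Re z| + `|complex.Im z|.
Proof.
rewrite -(ger0_norm (normc_ge0 z)) -[leRHS]ger0_norm ?addr_ge0 //.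
rewrite -ler_sqr ?nnegrE // !real_normK ?num_real // normc_sqr.
by rewrite sqrrD !real_normK ?num_real // addrAC lerDl mulrn_wge0 // mulr_ge0.
Qed.

Lemma normc_sum (T : Type) (s : seq T) (P : pred T) (F : T -> C) :
  normc (\sum_(i <- s | P i) F i) <= \sum_(i <- s | P i) normc (F i).
Proof.
elim/big_rec2: _ => [|i y1 y2 _ IH]; first by rewrite normc0.
by apply: le_trans (le_normcD _ _) _; rewrite lerD2l.
Qed.

Lemma normc_prod (T : Type) (s : seq T) (F : T -> C) :
  normc (\prod_(i <- s) F i) = \prod_(i <- s) normc (F i).
Proof.
by elim/big_rec2: _ => [|i y1 y2 _ IH]; rewrite ?normc1 // normcM IH.
Qed.

End ComplexNorm.

Lemma nbhs_distP (R : realType) (V : normedModType R) (x : V) (P : set V) :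
  nbhs x P <-> exists2 d : R, 0 < d & forall y, `|y - x| < d -> P y.
Proof.
split.
  move=> /nbhs_ballP[d d0 H]; exists d => // y yx; apply: H.
  by rewrite -ball_normE /ball_ /= distrC.
move=> [d d0 H]; apply/nbhs_ballP; exists d => // y.
by rewrite -ball_normE /ball_ /= distrC => /H.
Qed.

Lemma lt_both (R : realType) (a b : R) : 0 < a -> 0 < b -> exists t, [/\ 0 < t, t < a & t < b].
Proof.
move=> a0 b0; exists (Num.min a b / 2); have m0 : 0 < Num.min a b by rewrite lt_min a0.
have [h1 h2] : Num.min a b <= a /\ Num.min a b <= b by rewrite !ge_min !lexx orbT.
by split; lra.
Qed.

Section StrictDifferentiability.
Variable R : realType.
Local Notation C := R[i].
Implicit Types (x y z w : C) (phi psi : C -> C).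

Definition ccont phi z := forall e : R, 0 < e ->
  exists2 d : R, 0 < d & forall w, normc (w - z) < d -> normc (phi w - phi z) <= e.

(* Differentiability in two moving points: at every point of an open set it amounts
   to holomorphy, and local estimates add up along polygons without integrals. *)
Definition sdiff phi z L := forall e : R, 0 < e ->
  exists2 d : R, 0 < d & forall w w', normc (w - z) < d -> normc (w' - z) < d ->
    normc (phi w' - phi w - L * (w' - w)) <= e * normc (w' - w).

Definition sd phi z := exists L, sdiff phi z L.

(** Lets an estimate lose a factor that depends only on the point; the restriction [e <= 1] absorbs
    quadratic error terms. *)
Lemma sdiff_slack (K : R) phi z L : 0 <= K ->
  (forall e : R, 0 < e -> e <= 1 ->
    exists2 d : R, 0 < d & forall w w', normc (w - z) < d -> normc (w' - z) < d ->
      normc (phi w' - phi w - L * (w' - w)) <= K * e * normc (w' - w)) ->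
  sdiff phi z L.
Proof.
move=> K0 H e e0; have K1 : 0 < K + 1 by lra.
have e'0 : 0 < Num.min 1 (e / (K + 1)) by rewrite lt_min ltr01 divr_gt0.
have [|d d0 Hd] := H _ e'0; first by rewrite ge_min lexx.
exists d => // w w' wz w'z; apply: le_trans (Hd _ _ wz w'z) _.
rewrite ler_wpM2r ?normc_ge0 //.
have : Num.min 1 (e / (K + 1)) <= e / (K + 1) by rewrite ge_min lexx orbT.
rewrite ler_pdivlMr // => le; apply: le_trans le.
by rewrite mulrC ler_wpM2l ?(ltW e'0) //; lra.
Qed.

Lemma sdiff_near (r : R) phi psi z L : 0 < r ->
  (forall w, normc (w - z) < r -> phi w = psi w) -> sdiff phi z L -> sdiff psi z L.
Proof.
move=> r0 E H e e0; have [d d0 Hd] := H _ e0.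
exists (Num.min d r); first by rewrite lt_min d0.
by move=> w w'; rewrite !lt_min => /andP[wd wr] /andP[w'd w'r]; rewrite -!E // Hd.
Qed.

Lemma sd_near (r : R) phi psi z : 0 < r ->
  (forall w, normc (w - z) < r -> phi w = psi w) -> sd phi z -> sd psi z.
Proof. by move=> r0 E [L H]; exists L; apply: sdiff_near E H. Qed.

Lemma sdiff_lip phi z L : sdiff phi z L ->
  exists2 d : R, 0 < d & forall w w', normc (w - z) < d -> normc (w' - z) < d ->
    normc (phi w' - phi w) <= (normc L + 1) * normc (w' - w).
Proof.
move=> H; have [d d0 Hd] := H _ ltr01; exists d => // w w' wz w'z.
have := Hd _ _ wz w'z; rewrite mulrDl -normcM.
have := le_normcD (phi w' - phi w - L * (w' - w)) (L * (w' - w)).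
by rewrite subrK; lra.
Qed.

Lemma sdiff_cont phi z L : sdiff phi z L -> ccont phi z.
Proof.
move=> /sdiff_lip[d d0 Hd] e e0.
have L0 : 0 < normc L + 1 by have := normc_ge0 L; lra.
exists (Num.min d (e / (normc L + 1))); first by rewrite lt_min d0 divr_gt0.
move=> w; rewrite lt_min => /andP[wd we].
apply: le_trans (Hd _ _ _ wd) _; first by rewrite subrr normc0.
by rewrite mulrC -ler_pdivlMr // ltW.
Qed.

Lemma sd_cont phi z : sd phi z -> ccont phi z.
Proof. by move=> [L]; exact: sdiff_cont. Qed.

Lemma sdiff_lin (a b : C) z : sdiff (fun w => a * w + b) z a.
Proof.
move=> e e0; exists 1 => // w w' _ _.
rewrite (_ : _ - _ - _ = 0); last by ring.
by rewrite normc0 mulr_ge0 ?normc_ge0 // ltW.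
Qed.

Lemma sdiff_cst a z : sdiff (fun=> a) z 0.
Proof.
by move=> e e0; exists 1 => // w w' _ _; rewrite subrr mul0r subr0 normc0 mulr_ge0 ?normc_ge0 // ltW.
Qed.

Lemma sdiff_id z : sdiff id z 1.
Proof.
by move=> e e0; exists 1 => // w w' _ _; rewrite mul1r subrr normc0 mulr_ge0 ?normc_ge0 // ltW.
Qed.

Lemma sdiff_comp phi psi z L M :
  sdiff phi z L -> sdiff psi (phi z) M -> sdiff (psi \o phi) z (M * L).
Proof.
move=> Hphi Hpsi; apply: (@sdiff_slack (normc L + 1 + normc M)).
  by have := normc_ge0 L; have := normc_ge0 M; lra.
move=> e e0 _; have [d1 d10 H1] := Hpsi _ e0; have [d2 d20 H2] := Hphi _ e0.
have [d3 d30 H3] := sdiff_lip Hphi.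
have [d4 d40 H4] := sdiff_cont Hphi (ltac:(lra) : 0 < d1 / 2).
exists (Num.min (Num.min d2 d3) d4); first by rewrite !lt_min d20 d30 d40.
move=> w w'; rewrite !lt_min => /andP[/andP[w2 w3] w4] /andP[/andP[w'2 w'3] w'4].
have := H1 (phi w) (phi w'); rewrite (le_lt_trans (H4 _ w4)) ?(le_lt_trans (H4 _ w'4)); try lra.
move=> /(_ isT isT) A1; have A2 := H2 _ _ w2 w'2; have A3 := H3 _ _ w3 w'3.
have := le_normcD (psi (phi w') - psi (phi w) - M * (phi w' - phi w))
                  (M * (phi w' - phi w - L * (w' - w))).
rewrite normcM [X in normc X <= _ -> _](_ : _ = (psi \o phi) w' - (psi \o phi) w - M * L * (w' - w)); last by rewrite /comp; ring.
move=> A4; apply: (le_trans A4); rewrite -mulrA mulrDl; apply: lerD.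
  apply: le_trans A1 _; rewrite [leRHS]mulrCA; rewrite ler_wpM2l //; lra.
by rewrite ler_wpM2l ?normc_ge0.
Qed.

Lemma sdiffD phi psi z L M :
  sdiff phi z L -> sdiff psi z M -> sdiff (fun w => phi w + psi w) z (L + M).
Proof.
move=> Hphi Hpsi; apply: (@sdiff_slack 2) => // e e0 _.
have [d1 d10 H1] := Hpsi _ e0; have [d2 d20 H2] := Hphi _ e0.
exists (Num.min d1 d2); first by rewrite lt_min d10.
move=> w w'; rewrite !lt_min => /andP[w1 w2] /andP[w'1 w'2].
have := le_normcD (phi w' - phi w - L * (w' - w)) (psi w' - psi w - M * (w' - w)).
rewrite [X in normc X <= _ -> _](_ : _ = phi w' + psi w' - (phi w + psi w) - (L + M) * (w' - w)); last by ring.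
by have := H1 _ _ w1 w'1; have := H2 _ _ w2 w'2; lra.
Qed.

Lemma sdiffM phi psi z L M : sdiff phi z L -> sdiff psi z M ->
  sdiff (fun w => phi w * psi w) z (L * psi z + phi z * M).
Proof.
move=> Hphi Hpsi; apply: (@sdiff_slack (normc (psi z) + normc (phi z) + normc L + normc M + 2)).
  have := normc_ge0 (psi z); have := normc_ge0 (phi z).
  by have := normc_ge0 L; have := normc_ge0 M; lra.
move=> e e0 e1.
have [d1 d10 H1] := Hpsi _ e0; have [d2 d20 H2] := Hphi _ e0.
have [d3 d30 H3] := sdiff_cont Hpsi e0; have [d4 d40 H4] := sdiff_cont Hphi e0.
exists (Num.min (Num.min d1 d2) (Num.min d3 d4)); first by rewrite !lt_min d10 d20 d30 d40.
move=> w w'; rewrite !lt_min => /andP[/andP[w1 w2] /andP[w3 w4]].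
move=> /andP[/andP[w'1 w'2] /andP[w'3 w'4]].
have A1 := H1 _ _ w1 w'1; have A2 := H2 _ _ w2 w'2.
have A3 := H3 _ w'3; have A4 := H4 _ w4.
have B3 : normc (psi w') <= normc (psi z) + 1.
  by have := le_normcD (psi w' - psi z) (psi z); rewrite subrK; lra.
have B4 : normc (phi w) <= normc (phi z) + 1.
  by have := le_normcD (phi w - phi z) (phi z); rewrite subrK; lra.
set D := w' - w in A1 A2 *.
have -> : phi w' * psi w' - phi w * psi w - (L * psi z + phi z * M) * D =
  (phi w' - phi w - L * D) * psi w' + phi w * (psi w' - psi w - M * D)
  + (L * (psi w' - psi z) * D + M * (phi w - phi z) * D) by ring.
apply: le_trans (le_normcD _ _) _.
rewrite [X in _ <= X](_ : _ =
   (e * normc D * (normc (psi z) + 1) + (normc (phi z) + 1) * (e * normc D))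
   + (normc L * e * normc D + normc M * e * normc D)); last by ring.
have D0 := normc_ge0 D.
apply: lerD; apply: le_trans (le_normcD _ _) _; rewrite !normcM; apply: lerD.
- by apply: ler_pM => //; exact: normc_ge0.
- by apply: ler_pM => //; exact: normc_ge0.
- by rewrite ler_wpM2r // ler_wpM2l // normc_ge0.
- by rewrite ler_wpM2r // ler_wpM2l // normc_ge0.
Qed.

Lemma sdiff_inv a : a != 0 -> sdiff (fun w => w^-1) a (- (a ^- 2)).
Proof.
move=> a0; have na : 0 < normc a by rewrite normc_gt0.
(* The numerator below is at most [3 |a| e], and the denominator [|a| ^ 2 |b| |b'|] is at least
   [|a| ^ 4 / 4], because [|b|] and [|b'|] are at least [|a| / 2]. *)
apply: (@sdiff_slack (12 / normc a ^+ 3)).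
  by rewrite divr_ge0 // exprn_ge0 // normc_ge0.
move=> e e0 _; exists (Num.min (normc a / 2) e); first by rewrite lt_min e0 divr_gt0.
move=> b b'; rewrite !lt_min => /andP[b1 b2] /andP[b'1 b'2].
have nb : normc a / 2 <= normc b by have := normcB a b; have := le_normcD (a - b) b; rewrite subrK; lra.
have nb' : normc a / 2 <= normc b' by have := normcB a b'; have := le_normcD (a - b') b'; rewrite subrK; lra.
have b0 : b != 0 by rewrite -normc_gt0; lra.
have b'0 : b' != 0 by rewrite -normc_gt0; lra.
have -> : b'^-1 - b^-1 - - (a ^- 2) * (b' - b) =
  ((b - a) * b' + a * (b' - a)) * ((a ^+ 2 * b * b')^-1) * (b' - b).
  by field; rewrite a0 b0 b'0.
rewrite normcM ler_wpM2r ?normc_ge0 // normcM.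
have -> : normc ((a ^+ 2 * b * b')^-1) = (normc a ^+ 2 * normc b * normc b')^-1.
  by rewrite normcV normcM normcM normcX.
have ub' : normc b' <= 2 * normc a.
  by have := le_normcD (b' - a) a; rewrite subrK; lra.
have t1 : normc ((b - a) * b' + a * (b' - a)) <= 3 * normc a * e.
  apply: le_trans (le_normcD _ _) _; rewrite !normcM.
  have : normc (b - a) * normc b' <= e * (2 * normc a) by apply: ler_pM; rewrite ?normc_ge0 // ltW.
  have : normc a * normc (b' - a) <= normc a * e by rewrite ler_wpM2l ?normc_ge0 // ltW.
  by lra.
have t2 : normc a ^+ 4 / 4 <= normc a ^+ 2 * normc b * normc b'.
  rewrite (_ : _ / 4 = normc a ^+ 2 * (normc a / 2) * (normc a / 2)); last by field.
  by rewrite ler_pM ?mulr_ge0 ?sqr_ge0 //; try lra; rewrite ler_wpM2l ?sqr_ge0.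
have p4 : 0 < normc a ^+ 4 / 4 by rewrite divr_gt0 // exprn_gt0.
have -> : 12 / normc a ^+ 3 * e = 3 * normc a * e / (normc a ^+ 4 / 4).
  by field; rewrite gt_eqF.
apply: ler_pM; rewrite ?normc_ge0 ?invr_ge0 //; first by rewrite (le_trans (ltW p4)).
by rewrite lef_pV2 // posrE // (lt_le_trans p4).
Qed.

Lemma sdN phi z : sd phi z -> sd (fun w => - phi w) z.
Proof.
move=> [L H]; exists (-1 * L).
have : sdiff (fun w => -1 * w + 0) (phi z) (-1) by exact: sdiff_lin.
move=> /(sdiff_comp H); apply: sdiff_near ltr01 _ => w _ /=; ring.
Qed.

Lemma sdD phi psi z : sd phi z -> sd psi z -> sd (fun w => phi w + psi w) z.
Proof. by move=> [L H] [M K]; exists (L + M); exact: sdiffD. Qed.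

Lemma sdB phi psi z : sd phi z -> sd psi z -> sd (fun w => phi w - psi w) z.
Proof. by move=> H K; apply: sdD => //; exact: sdN. Qed.

Lemma sdM phi psi z : sd phi z -> sd psi z -> sd (fun w => phi w * psi w) z.
Proof. by move=> [L H] [M K]; eexists; exact: (sdiffM H K). Qed.

Lemma sd_cst a z : sd (fun=> a) z.
Proof. by exists 0; exact: sdiff_cst. Qed.

Lemma sd_id z : sd id z.
Proof. by exists 1; exact: sdiff_id. Qed.

Lemma sdV phi z : phi z != 0 -> sd phi z -> sd (fun w => (phi w)^-1) z.
Proof. by move=> p0 [L H]; eexists; exact: (sdiff_comp H (sdiff_inv p0)). Qed.

Lemma sdX n phi z : sd phi z -> sd (fun w => phi w ^+ n) z.
Proof.
move=> H; elim: n => [|n IH]; first exact: sd_cst.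
have [L HL] := sdM H IH; exists L; apply: sdiff_near ltr01 _ HL => w _.
by rewrite exprS.
Qed.

Lemma sd_lin a b phi z : sd phi (a * z + b) -> sd (fun w => phi (a * w + b)) z.
Proof. by move=> [L H]; eexists; exact: (sdiff_comp (@sdiff_lin a b z) H). Qed.

Lemma sd_shift h phi z : sd phi (z + h) -> sd (fun w => phi (w + h)) z.
Proof.
move=> H; have := @sd_lin 1 h phi z; rewrite mul1r => /(_ H).
by apply: sd_near ltr01 _ => w _; rewrite mul1r.
Qed.

Lemma sd_prod (T : Type) (s : seq T) (F : T -> C -> C) z :
  (forall i, sd (F i) z) -> sd (fun w => \prod_(i <- s) F i w) z.
Proof.
move=> H; elim: s => [|i s IH].
  apply: sd_near ltr01 _ (sd_cst 1 z) => w _; by rewrite big_nil.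
by apply: sd_near ltr01 _ (sdM (H i) IH) => w _; rewrite big_cons.
Qed.

(** The two conjugations cancel in the derivative. In this form the values at conjugate points enter
    the extension of a function from one slice to another. *)
Lemma sdiff_conj phi z L : sdiff phi z^* L -> sdiff (fun w => (phi w^*)^*) z L^*.
Proof.
move=> H e e0; have [d d0 Hd] := H _ e0; exists d => // w w' wz w'z.
have := Hd w^* w'^*; rewrite -!rmorphB /= !normc_conj => /(_ wz w'z).
by rewrite -[in leLHS]normc_conj !rmorphB rmorphM /= !rmorphB /= !conjcK.
Qed.

Lemma ccont_cst a z : ccont (fun=> a) z.
Proof. by move=> e e0; exists 1 => // w _; rewrite subrr normc0 ltW. Qed.

End StrictDifferentiability.

(** * Uniform radii and maxima on discs and circles *)

Section Compactness.
Variable R : realType.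
Local Notation C := R[i].
Implicit Types (x y z w : C) (A : set C).

(* Compactness in the form in which it is used: a local choice of radii can be made
   uniform. *)
Definition uniformizing A := forall P : C -> R -> Prop,
  (forall z d d', P z d -> 0 < d' -> d' <= d -> P z d') ->
  (forall z, A z -> exists2 d, 0 < d & forall w, A w -> normc (w - z) < d -> P w d) ->
  exists2 d, 0 < d & forall z, A z -> P z d.

Definition cpx (p : R * R) : C := p.1 +i* p.2.

Lemma cpx_dist (p q : R * R) : normc (cpx p - cpx q) <= 2 * `|p - q|.
Proof.
apply: le_trans (normc_ReIm _) _ => /=.
rewrite prod_normE /=.
by have [] := leP `|p.1 - q.1| `|p.2 - q.2|; lra.
Qed.

Lemma dist_cpx (p q : R * R) : `|p - q| <= normc (cpx p - cpx q).
Proof.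
rewrite prod_normE /= ge_max.
by rewrite (normc_Re (cpx p - cpx q)) (normc_Im (cpx p - cpx q)).
Qed.

Lemma cpx_normc_continuous c : continuous (fun p => normc (cpx p - c)).
Proof.
move=> p; apply/cvgrPdist_le => e e0.
near=> q.
have : `|normc (cpx p - c) - normc (cpx q - c)| <= normc (cpx p - cpx q).
  have := normc_triangle (cpx q) (cpx p) c; have := normc_triangle (cpx p) (cpx q) c.
  by rewrite (normcB (cpx q) (cpx p)) ler_norml => ? ?; apply/andP; split; lra.
move=> /le_trans; apply; apply: le_trans (cpx_dist _ _) _.
rewrite -ler_pdivlMl // mulrC; near: q.
by apply: cvgr_dist_le; rewrite ?divr_gt0.
Unshelve. all: by end_near. Qed.

(** This is the near-covering form of compactness, for the filter of small positive radii. *)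
Lemma compact_uniformizing A :
  compact (cpx @^-1` A) -> uniformizing A.
Proof.
move=> /compact_near_coveringP cA P mP locP.
have := cA R (0^'+) (fun d p => 0 < d -> A (cpx p) -> P (cpx p) d) _.
case.
- move=> p Ap; have [d d0 Hd] := locP _ Ap.
  exists ([set q | `|p - q| < d / 2], [set i | i < d]) => /=.
    split; first by apply/nbhs_distP; exists (d / 2); rewrite ?divr_gt0 // => y; rewrite distrC.
    exact: nbhs_right_lt.
  move=> [q i] /= [pq id] i0 Aq; apply: (mP _ d) => //; last exact: ltW.
  apply: Hd => //; apply: le_lt_trans (cpx_dist _ _) _.
  by rewrite distrC; lra.
- move=> d /= d0 H; exists (d / 2); first by rewrite divr_gt0.
  move=> z Az; rewrite -[z](_ : cpx (complex.Re z, complex.Im z) = z); last by case: (z).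
  apply: H; rewrite /=; try lra; try by rewrite divr_gt0.
  - by rewrite sub0r normrN gtr0_norm; lra.
  - by rewrite /cpx /=; case: (z) Az.
  - by rewrite /cpx /=; case: (z) Az.
Qed.

Lemma compact_closed_disc c (r : R) : compact (cpx @^-1` [set z | normc (z - c) <= r]).
Proof.
have [c1 c2] : (exists a, a = complex.Re c) /\ (exists b, b = complex.Im c) by split; eexists.
apply: (@subclosed_compact _ _ (`[complex.Re c - r, complex.Re c + r] `*` `[complex.Im c - r, complex.Im c + r])).
- have := @cpx_normc_continuous c; move=> /continuous_closedP /(_ [set x | x <= r]); apply.
  exact: closed_le.
- by apply: compact_setX; exact: segment_compact.
- move=> p /= H; have := le_trans (normc_Re _) H; have := le_trans (normc_Im _) H.
  rewrite /cpx; case: (c) => a b /=; rewrite !ler_norml !in_itv /= => /andP[? ?] /andP[? ?].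
  by split; apply/andP; split; lra.
Qed.

Lemma uniformizing_disc c (r : R) : uniformizing [set z | normc (z - c) <= r].
Proof. by apply: compact_uniformizing; exact: compact_closed_disc. Qed.

Lemma uniformizing_circle c (r : R) : uniformizing [set z | normc (z - c) = r].
Proof.
apply: compact_uniformizing; apply: subclosed_compact (@compact_closed_disc c r) _.
  have := @cpx_normc_continuous c; move=> /continuous_closedP /(_ [set x | x = r]); apply.
  exact: closed_eq.
by move=> p /= ->.
Qed.

(** Uniformization is used twice: for an upper bound of [u], and, if the supremum were not attained,
    for a uniform positive gap below it, which is absurd. *)
Lemma uniformizing_max A (u : C -> R) : uniformizing A -> A !=set0 ->
  (forall z, A z -> forall e, 0 < e ->
     exists2 d, 0 < d & forall w, A w -> normc (w - z) < d -> `|u w - u z| <= e) ->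
  exists2 z, A z & forall w, A w -> u w <= u z.
Proof.
move=> uA A0 cu.
have [d d0 Hd] : exists2 d, 0 < d & forall z, A z -> u z <= d^-1.
  (* The reciprocal of the radius serves as the bound: smaller radii give weaker bounds, as the
     monotonicity condition demands. *)
  apply: (uA (fun z d => u z <= d^-1)).
    move=> z d d' H d'0 d'd; apply: le_trans H _.
    by rewrite lef_pV2 // posrE (lt_le_trans d'0).
  move=> z Az; have [d d0 Hd] := cu _ Az _ ltr01.
  have K0 : 0 < `|u z| + 1 by have := normr_ge0 (u z); lra.
  exists (Num.min d (`|u z| + 1)^-1); first by rewrite lt_min d0 invr_gt0.
  move=> w Aw; rewrite lt_min => /andP[wd _].
  have := Hd _ Aw wd; rewrite ler_norml => /andP[_ H].
  have : u w <= `|u z| + 1 by have := ler_norm (u z); lra.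
  move=> /le_trans; apply; rewrite -[leLHS]invrK lef_pV2 ?posrE ?lt_min ?invr_gt0 ?d0 //.
  by rewrite ge_min lexx orbT.
pose U := [set u z | z in A].
have supU : has_sup U.
  split; first by have [z Az] := A0; exists (u z), z.
  by exists d^-1 => _ [z Az <-]; exact: Hd.
apply: contrapT => nomax.
have lt z : A z -> u z < sup U.
  move=> Az; rewrite lt_neqAle; apply/andP; split; last first.
    by apply: ub_le_sup; [case: supU | exists z].
  apply/eqP => E; apply: nomax; exists z => // w Aw; rewrite E.
  by apply: ub_le_sup; [case: supU | exists w].
have [e e0 He] : exists2 d, 0 < d & forall z, A z -> u z <= sup U - d.
  apply: (uA (fun z d => u z <= sup U - d)).
    by move=> z d1 d2 H1 _ d21; lra.
  move=> z Az; have := lt _ Az => zU.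
  have e0 : 0 < (sup U - u z) / 2 by lra.
  have [d1 d10 Hd1] := cu _ Az _ e0.
  exists (Num.min d1 ((sup U - u z) / 2)); first by rewrite lt_min d10.
  move=> w Aw; rewrite lt_min => /andP[/(Hd1 _ Aw) + _].
  rewrite ler_norml => /andP[_ ?].
  have : Num.min d1 ((sup U - u z) / 2) <= (sup U - u z) / 2 by rewrite ge_min lexx orbT.
  by lra.
have : sup U <= sup U - e.
  by apply: ge_sup; [case: supU | move=> _ [z Az <-]; exact: He].
by lra.
Qed.

End Compactness.

(** * The maximum principle and the Schwarz lemma *)

Section MeanValue.
Variable R : realType.
Local Notation C := R[i].
Implicit Types (z w : C) (phi : C -> C).

Lemma sumr_cst (K : pzRingType) (N : nat) (x : K) : \sum_(k < N) x = N%:R * x.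
Proof. by rewrite sumr_const card_ord mulr_natl. Qed.

Lemma root_of_unity_near_1 (e : R) : 0 < e -> exists (N : nat) (u : C),
  [/\ (0 < N)%N, u ^+ N = 1, u != 1, normc u = 1 & normc (u - 1) < e].
Proof.
move=> e0; pose cis t : C := cos t +i* sin t.
have cisX t n : cis t ^+ n = cis (n%:R * t).
  elim: n => [|n IH]; first by rewrite expr0 mul0r /cis cos0 sin0.
  rewrite exprS IH -natr1 mulrDl mul1r /cis addrC cosD sinD /=.
  by simpc; rewrite [sin t * _ + _]addrC [cos t * sin _ + _]addrC.
have n1 t : normc (cis t) = 1 by rewrite /cis /= cos2Dsin2 sqrtr1.
have [d d0 Hd] : exists2 d, 0 < d & forall t, `|t| < d -> normc (cis t - 1) < e.
  have c0 : \forall t \near (0 : R), `|cos 0 - cos t| < e / 2.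
    by move: (@continuous_cos R 0) => /cvgrPdist_lt; apply; rewrite divr_gt0.
  have s0 : \forall t \near (0 : R), `|sin 0 - sin t| < e / 2.
    by move: (@continuous_sin R 0) => /cvgrPdist_lt; apply; rewrite divr_gt0.
  move: c0 s0 => /nbhs_distP[d1 d10 H1] /nbhs_distP[d2 d20 H2].
  exists (Num.min d1 d2) => [|t]; rewrite lt_min ?d10 // => /andP[td1 td2].
  have /= := H1 t; rewrite subr0 => /(_ td1); rewrite cos0 distrC => {}H1.
  have /= := H2 t; rewrite subr0 => /(_ td2); rewrite sin0 sub0r normrN => {}H2.
  by rewrite -[ltLHS]/(normc (cis t - 1)); apply: le_lt_trans (normc_ReIm _) _; rewrite /= subr0; lra.
(* One successor already makes the angle [2 pi / N] smaller than [d]; three give [N > 2], so that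
   the angle lies strictly between 0 and [pi] and its sine shows [u != 1]. *)
pose N := (Num.truncn (2 * pi / d)).+3.
have N0 : 0 < N%:R :> R by rewrite ltr0n.
have Nd : 2 * pi / N%:R < d.
  rewrite ltr_pdivrMr // [ltRHS]mulrC -ltr_pdivrMr //.
  apply: (@lt_trans _ _ (Num.truncn (2 * pi / d)).+1%:R); first exact: truncnS_gt.
  by rewrite ltr_nat.
have t0 : 0 < 2 * pi / N%:R :> R by rewrite divr_gt0 // mulr_gt0 ?pi_gt0.
exists N, (cis (2 * pi / N%:R)); split => //.
- rewrite cisX mulrCA mulfV ?gt_eqF // mulr1 mulr_natl.
  by rewrite /cis cos2pi sin2pi.
- apply/eqP => [] [] _ /eqP; apply/negP; rewrite gt_eqF //; apply: sin_gt0_pi.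
  rewrite t0 /= ltr_pdivrMr // [ltLHS]mulrC ltr_pM2l ?pi_gt0 //.
  by rewrite (ltr_nat R 2).
- by apply: Hd; rewrite gtr0_norm.
Qed.

Lemma sum_root_of_unity (N : nat) (u : C) : u ^+ N = 1 -> u != 1 ->
  \sum_(k < N) u ^+ k = 0.
Proof.
move=> uN u1; have := subrX1 u N; rewrite uN subrr => /esym/eqP.
by rewrite mulf_eq0 subr_eq0 (negbTE u1) => /eqP.
Qed.

Lemma sdiff_dist phi z M L (d e : R) : 0 < d -> sdiff phi z M ->
  (forall w, normc (w - z) < d ->
     normc (phi w - phi z - L * (w - z)) <= e * normc (w - z)) ->
  normc (M - L) <= e.
Proof.
move=> d0 HM HL; apply/ler_addgt0Pr => e' e'0.
have [d' d'0 Hd'] := HM _ e'0.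
have [h [h0 hd hd']] := lt_both d0 d'0.
have nh : normc (h%:C : C) = h by rewrite normc_real gtr0_norm.
have E : z + h%:C - z = h%:C by ring.
have := HL (z + h%:C); have := Hd' z (z + h%:C).
rewrite subrr normc0 E nh => /(_ d'0 hd') H1 /(_ hd) H2.
rewrite -(ler_pM2r h0) mulrDl -[X in normc _ * X]nh -normcM.
rewrite (_ : _ * _ = (phi (z + h%:C) - phi z - L * h%:C) - (phi (z + h%:C) - phi z - M * h%:C)); last by ring.
by have := normc_subD (phi (z + h%:C) - phi z - L * h%:C) (phi (z + h%:C) - phi z - M * h%:C); lra.
Qed.

Lemma sdiff_unique phi z M L : sdiff phi z M -> sdiff phi z L -> M = L.
Proof.
move=> HM HL; apply/eqP; rewrite -subr_eq0; apply/eqP; apply: eq0_normc; apply/eqP.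
rewrite eq_le normc_ge0 andbT; apply/ler_addgt0Pr => e e0; rewrite add0r.
have [d d0 Hd] := HL _ e0; apply: (sdiff_dist d0 HM) => w wz.
by apply: (Hd _ _ _ wz); rewrite subrr normc0.
Qed.

(** The estimate at [z] holds with moving base points; at a nearby [w], [sdiff_dist] puts [D w]
    within [e / 3] of [D z], so one radius serves a whole neighbourhood and can be made uniform. *)
Lemma sd_uniform (A : set C) phi : uniformizing A -> (forall z, A z -> sd phi z) ->
  exists D : C -> C, forall e, 0 < e -> exists2 d : R, 0 < d &
    forall z w, A z -> normc (w - z) < d ->
      normc (phi w - phi z - D z * (w - z)) <= e * normc (w - z).
Proof.
move=> uA sdA.
have /choice[D HD] : forall z, exists L, A z -> sdiff phi z L.
  move=> z.
  have [Az|nAz] := pselect (A z); last by exists 0.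
  by have [L HL] := sdA _ Az; exists L.
exists D => e e0.
pose P z d := forall w, normc (w - z) < d ->
      normc (phi w - phi z - D z * (w - z)) <= e * normc (w - z).
suff [d d0 Hd] : exists2 d, 0 < d & forall z, A z -> P z d by exists d => // z w /Hd; apply.
apply: uA => [z d d' H _ d'd w wz|z Az]; first by apply: H; exact: lt_le_trans wz d'd.
have [d d0 Hd] := HD _ Az _ (ltac:(lra) : 0 < e / 3).
exists (d / 2) => [|w Aw wz w' w'w]; first by rewrite divr_gt0.
have wd : normc (w - z) < d by lra.
have near w1 : normc (w1 - w) < d / 2 -> normc (phi w1 - phi w - D z * (w1 - w)) <= e / 3 * normc (w1 - w).
  by move=> ?; apply: Hd => //; have := normc_triangle w w1 z; lra.
have DD : normc (D w - D z) <= e / 3.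
  by apply: sdiff_dist (HD _ Aw) near; rewrite divr_gt0.
rewrite (_ : _ - _ * _ = (phi w' - phi w - D z * (w' - w)) - (D w - D z) * (w' - w)); last by ring.
apply: le_trans (normc_subD _ _) _; rewrite normcM.
have := ler_wpM2r (normc_ge0 (w' - w)) DD; have := near _ w'w.
have : 0 <= e * normc (w' - w) by rewrite mulr_ge0 ?normc_ge0 ?ltW.
by lra.
Qed.

(** Multiplication by [u] permutes the vertices of the polygon cyclically. *)
Lemma telescope_root_of_unity phi c (N : nat) (u a : C) : u ^+ N = 1 ->
  \sum_(k < N) phi (c + a * (u ^+ k * u)) = \sum_(k < N) phi (c + a * u ^+ k).
Proof.
case: N => [|N] uN; first by rewrite !big_ord0.
rewrite big_ord_recr big_ord_recl /= -exprSr uN expr0 addrC; congr (_ + _).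
by apply: eq_bigr => k _; rewrite /bump leq0n add1n exprSr.
Qed.

(* Summing the increments of [phi] between consecutive points of the regular
   N-gon of radius [t] gives 0; as each of them is nearly
   [phi' (z_k) * t * (u - 1) * u ^+ k], so is the radial derivative
   [\sum_k phi' (z_k) * u ^+ k]. *)
Lemma mean_value phi c (r e : R) : 0 < r -> 0 < e ->
  (forall z, normc (z - c) <= r -> sd phi z) ->
  exists (N : nat) (u : C), [/\ (0 < N)%N, normc u = 1,
    \sum_(k < N) u ^+ k = 0 &
    normc (\sum_(k < N) phi (c + r%:C * u ^+ k) - N%:R * phi c) <= N%:R * e].
Proof.
move=> r0 e0 sdphi.
have [D HD] := sd_uniform (@uniformizing_disc R c r) sdphi.
(* Per vertex and unit of radial length the error will be [2 * e']: one [e'] from linearizing [phi],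
   one from [tan]. Over the length [r] this is [e]. *)
have e1 : 0 < e / (2 * r) by rewrite divr_gt0 // mulr_gt0.
have [d d0 Hd] := HD _ e1; set e' := e / (2 * r) in e1 Hd.
have [N [u [N0 uN u1 nu ud]]] := root_of_unity_near_1 (divr_gt0 d0 r0).
have nuk k : normc (u ^+ k) = 1 by rewrite normcX nu expr1n.
exists N, u; split=> //; first exact: sum_root_of_unity.
pose S t := \sum_(k < N) phi (c + t%:C * u ^+ k).
have inA t k : 0 <= t -> t <= r -> normc (c + t%:C * u ^+ k - c) <= r.
  by move=> t0 tr; rewrite addrAC subrr add0r normcM normc_real nuk mulr1 ger0_norm.
have tan t : 0 < t -> t <= r ->
    normc (\sum_(k < N) D (c + t%:C * u ^+ k) * u ^+ k) <= N%:R * e'.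
  move=> t0 tr.
  have tu : 0 < normc (t%:C * (u - 1)).
    have t0' : t%:C != 0 by rewrite -normc_gt0 normc_real gtr0_norm.
    by rewrite normc_gt0 mulf_neq0 // subr_eq0.
  rewrite -(ler_pM2r tu) -normcM mulr_suml.
  set X := \sum_(k < N) _.
  have -> : X = - \sum_(k < N) (phi (c + t%:C * (u ^+ k * u)) - phi (c + t%:C * u ^+ k)
      - D (c + t%:C * u ^+ k) * (t%:C * (u ^+ k * u) - t%:C * u ^+ k)).
    rewrite !sumrB telescope_root_of_unity // subrr sub0r opprK.
    by apply: eq_bigr => k _; ring.
  rewrite normcN; apply: le_trans (normc_sum _ _ _) _.
  apply: le_trans (_ : \sum_(k < N) e' * normc (t%:C * (u - 1)) <= _); last first.
    by rewrite sumr_cst mulrA.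
  apply: ler_sum => k _.
  have E : c + t%:C * (u ^+ k * u) - (c + t%:C * u ^+ k) = t%:C * (u - 1) * u ^+ k by ring.
  have := Hd (c + t%:C * u ^+ k) (c + t%:C * (u ^+ k * u)).
  rewrite E normcM nuk mulr1 => H.
  rewrite (_ : _ - _ * _ = phi (c + t%:C * (u ^+ k * u)) - phi (c + t%:C * u ^+ k)
      - D (c + t%:C * u ^+ k) * (t%:C * (u - 1) * u ^+ k)); last by ring.
  apply: H; first by apply: inA => //; exact: ltW.
  rewrite normcM normc_real gtr0_norm //; apply: le_lt_trans (_ : r * normc (u - 1) < _).
    by rewrite ler_wpM2r ?normc_ge0.
  by rewrite mulrC -ltr_pdivlMr.
(* The expansion is at the outer radius [t], since [tan] divides by [t * (u - 1)]; the inner radius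
   [t'] may then be 0, where the walk to [r] begins. *)
have step t t' : 0 < t -> t <= r -> `|t' - t| < d ->
    normc (S t' - S t) <= N%:R * (2 * e') * `|t' - t|.
  move=> t0 tr tt'; rewrite /S -sumrB.
  have -> : \sum_(k < N) (phi (c + t'%:C * u ^+ k) - phi (c + t%:C * u ^+ k)) =
    \sum_(k < N) (phi (c + t'%:C * u ^+ k) - phi (c + t%:C * u ^+ k)
        - D (c + t%:C * u ^+ k) * (t' - t)%:C * u ^+ k)
    + (\sum_(k < N) D (c + t%:C * u ^+ k) * u ^+ k) * (t' - t)%:C.
    rewrite mulr_suml -big_split /=; apply: eq_bigr => k _; ring.
  apply: le_trans (le_normcD _ _) _.
  rewrite [leRHS](_ : _ = N%:R * e' * `|t' - t| + N%:R * e' * `|t' - t|); last by ring.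
  apply: lerD; last by rewrite normcM normc_real ler_wpM2r // tan.
  apply: le_trans (normc_sum _ _ _) _.
  apply: le_trans (_ : \sum_(k < N) e' * `|t' - t| <= _); last first.
    by rewrite sumr_cst mulrA.
  apply: ler_sum => k _.
  have E : c + t'%:C * u ^+ k - (c + t%:C * u ^+ k) = (t' - t)%:C * u ^+ k.
    by rewrite rmorphB; ring.
  have := Hd (c + t%:C * u ^+ k) (c + t'%:C * u ^+ k).
  rewrite E normcM nuk mulr1 normc_real mulrA => H; apply: H => //.
  by apply: inA => //; exact: ltW.
pose n := (Num.truncn (r / d)).+1.
have n0 : 0 < n%:R :> R by rewrite ltr0n.
have rn : r / n%:R < d.
  by rewrite ltr_pdivrMr // [ltRHS]mulrC -ltr_pdivrMr // truncnS_gt.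
have rn0 : 0 < r / n%:R by rewrite divr_gt0.
have main k : (k <= n)%N ->
    normc (S (k%:R * (r / n%:R)) - S 0) <= N%:R * (2 * e') * (k%:R * (r / n%:R)).
  elim: k => [|k IH] kn; first by rewrite !mul0r mulr0 subrr normc0.
  have a0 : 0 < k.+1%:R * (r / n%:R) by rewrite mulr_gt0 ?ltr0n.
  have ar : k.+1%:R * (r / n%:R) <= r.
    by rewrite mulrCA ger_pMr // ler_pdivrMr // mul1r ler_nat.
  have ab : k%:R * (r / n%:R) - k.+1%:R * (r / n%:R) = - (r / n%:R).
    by rewrite -natr1; ring.
  have := step _ (k%:R * (r / n%:R)) a0 ar.
  rewrite ab normrN gtr0_norm // => /(_ rn).
  have := IH (ltnW kn).
  have := normc_triangle (S (k%:R * (r / n%:R))) (S (k.+1%:R * (r / n%:R))) (S 0).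
  have := normcB (S (k%:R * (r / n%:R))) (S (k.+1%:R * (r / n%:R))).
  rewrite (_ : k.+1%:R * (r / n%:R) = k%:R * (r / n%:R) + r / n%:R); last by rewrite -natr1; ring.
  by rewrite (mulrDr (N%:R * (2 * e'))); lra.
have := main n (leqnn n); rewrite mulrCA mulfV ?gt_eqF // mulr1.
rewrite (_ : N%:R * (2 * e') * r = N%:R * e); last by rewrite /e'; field; rewrite gt_eqF.
suff -> : S 0 = N%:R * phi c by [].
rewrite /S (eq_bigr (fun=> phi c)); last by move=> k _; rewrite mul0r addr0.
by rewrite sumr_cst.
Qed.

End MeanValue.

(** * The maximum modulus principle *)

Section MaximumPrinciple.
Variable R : realType.
Local Notation C := R[i].
Implicit Types (z w c zeta : C) (phi psi : C -> C).

Lemma normc_sqrD z w :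
  normc (z + w) ^+ 2 = normc z ^+ 2 + normc w ^+ 2 + 2 * complex.Re (z^* * w).
Proof. by rewrite !normc_sqr; case: z => a b; case: w => c d /=; ring. Qed.

Lemma Re_sum (T : Type) (s : seq T) (F : T -> C) :
  complex.Re (\sum_(i <- s) F i) = \sum_(i <- s) complex.Re (F i).
Proof. by elim/big_rec2: _ => [|i y1 y2 _ <-] //; case: (F i); case: y2. Qed.

Lemma ccontM phi psi z : ccont phi z -> ccont psi z -> ccont (fun w => phi w * psi w) z.
Proof.
move=> Hphi Hpsi e e0.
pose K := normc (psi z) + normc (phi z) + 2.
have K0 : 0 < K by have := normc_ge0 (psi z); have := normc_ge0 (phi z); rewrite /K; lra.
have e'0 : 0 < Num.min 1 (e / K) by rewrite lt_min ltr01 divr_gt0.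
have [d1 d10 H1] := Hphi _ e'0; have [d2 d20 H2] := Hpsi _ e'0.
exists (Num.min d1 d2) => [|w]; first by rewrite lt_min d10.
rewrite lt_min => /andP[/H1 A1 /H2 A2].
set e' := Num.min 1 (e / K) in e'0 A1 A2.
have e'1 : e' <= 1 by rewrite /e' ge_min lexx.
have e'K : e' * K <= e by rewrite -ler_pdivlMr // /e' ge_min lexx orbT.
have -> : phi w * psi w - phi z * psi z =
   (phi w - phi z) * (psi w - psi z) + (phi w - phi z) * psi z + phi z * (psi w - psi z) by ring.
apply: le_trans e'K; apply: le_trans (le_normcD _ _) _.
have := le_normcD ((phi w - phi z) * (psi w - psi z)) ((phi w - phi z) * psi z).
rewrite !normcM.
have := ler_wpM2r (normc_ge0 (psi z)) A1; have := ler_wpM2l (normc_ge0 (phi z)) A2.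
have : normc (phi w - phi z) * normc (psi w - psi z) <= e' * 1.
  by apply: ler_pM; rewrite ?normc_ge0 //; lra.
by rewrite /K !mulrDr; lra.
Qed.

Lemma ccont_near (r : R) phi psi z : 0 < r ->
  (forall w, normc (w - z) < r -> phi w = psi w) -> ccont phi z -> ccont psi z.
Proof.
move=> r0 E H e e0; have [d d0 Hd] := H _ e0.
exists (Num.min d r) => [|w]; rewrite lt_min ?d0 // => /andP[wd wr].
rewrite -!E //; first exact: Hd.
by rewrite subrr normc0.
Qed.

Lemma ccontX n phi z : ccont phi z -> ccont (fun w => phi w ^+ n) z.
Proof.
move=> H; elim: n => [|n IH]; first exact: ccont_cst.
by apply: ccont_near ltr01 _ (ccontM H IH) => w _; rewrite exprS.
Qed.

Lemma ccontB phi psi z : ccont phi z -> ccont psi z -> ccont (fun w => phi w - psi w) z.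
Proof.
move=> Hphi Hpsi e e0; have e2 : 0 < e / 2 by lra.
have [d1 d10 H1] := Hphi _ e2; have [d2 d20 H2] := Hpsi _ e2.
exists (Num.min d1 d2) => [|w]; rewrite lt_min ?d10 // => /andP[/H1 A1 /H2 A2].
rewrite (_ : _ - _ - _ = (phi w - phi z) - (psi w - psi z)); last by ring.
by apply: le_trans (normc_subD _ _) _; lra.
Qed.

Lemma ccont_shift h phi z : ccont phi (z + h) -> ccont (fun w => phi (w + h)) z.
Proof.
move=> H e /H[d d0 Hd]; exists d => // w wz; apply: Hd.
by rewrite (_ : _ - _ = w - z) //; ring.
Qed.

Lemma ccont_le phi c (M r : R) : 0 < r -> ccont phi c ->
  (forall z, z != c -> normc (z - c) < r -> normc (phi z) <= M) -> normc (phi c) <= M.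
Proof.
move=> r0 cp H; apply/ler_addgt0Pr => e e0; have [d d0 Hd] := cp _ e0.
have [t [t0 td tr]] := lt_both d0 r0.
have E : normc (c + t%:C - c) = t by rewrite addrC addKr normc_real gtr0_norm.
have nc : c + t%:C != c by rewrite -subr_eq0 -normc_gt0 E.
have := H _ nc; rewrite E => /(_ tr) A; have := Hd (c + t%:C); rewrite E => /(_ td) B.
by have := normc_subD (phi (c + t%:C)) (phi (c + t%:C) - phi c); rewrite subKr; lra.
Qed.

Lemma ccont_bound phi zeta (M : R) : normc zeta = 1 -> ccont phi zeta ->
  (forall z, normc z < 1 -> normc (phi z) <= M) -> normc (phi zeta) <= M.
Proof.
move=> nz cphi bphi; apply/ler_addgt0Pr => e e0; have [d d0 Hd] := cphi _ e0.
have [t [t0 td t1]] := lt_both d0 ltr01.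
set z := (1 - t)%:C * zeta.
have nzt : normc z = 1 - t by rewrite normcM nz mulr1 normc_real ger0_norm //; lra.
have := Hd z; rewrite (_ : z - zeta = - (t%:C * zeta)); last by rewrite /z rmorphB; ring.
rewrite normcN normcM nz mulr1 normc_real gtr0_norm // => /(_ td) A.
have := bphi z; rewrite nzt => /(_ (ltac:(lra))) B.
by have := normc_subD (phi z) (phi z - phi zeta); rewrite subKr; lra.
Qed.

Lemma boundary_agree phi psi zeta : normc zeta = 1 -> ccont phi zeta -> ccont psi zeta ->
  (forall z, normc z < 1 -> phi z = psi z) -> phi zeta = psi zeta.
Proof.
move=> n1 cp cq E.
have : normc (phi zeta - psi zeta) <= 0.
  by apply: ccont_bound n1 (ccontB cp cq) _ => z z1; rewrite E // subrr normc0.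
by move=> H0; apply/eqP; rewrite -subr_eq0; apply: contraTT H0; rewrite -ltNge normc_gt0.
Qed.

(** If [|phi z0| > M], then [|phi| ^ 2 + eps |z - c| ^ 2] has an interior maximum [z1] with
    [phi z1 != 0], where [phi] is differentiable. Its average over a small polygon around [z1]
    exceeds its value there by nearly [eps * rho ^+ 2], a contradiction. *)
Lemma max_modulus_zeros phi c (r M : R) : 0 < r -> 0 <= M ->
  (forall z, normc (z - c) <= r -> ccont phi z) ->
  (forall z, normc (z - c) < r -> phi z != 0 -> sd phi z) ->
  (forall z, normc (z - c) = r -> normc (phi z) <= M) ->
  forall z, normc (z - c) <= r -> normc (phi z) <= M.
Proof.
move=> r0 M0 cphi dphi bphi z0 z0r; rewrite leNgt; apply/negP => Mz0.
have Mz02 : M ^+ 2 < normc (phi z0) ^+ 2.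
  by rewrite ltr_sqr ?nnegrE ?normc_ge0.
(* [eps * r ^+ 2] is half the excess of [|phi z0| ^ 2] over [M ^+ 2], so the added term cannot move
   the maximum to the circle. *)
pose eps := (normc (phi z0) ^+ 2 - M ^+ 2) / (2 * r ^+ 2).
have r20 : 0 < r ^+ 2 by rewrite exprn_gt0.
have eps0 : 0 < eps by rewrite divr_gt0 ?subr_gt0 // mulr_gt0.
have epsE : eps * r ^+ 2 = (normc (phi z0) ^+ 2 - M ^+ 2) / 2.
  by rewrite /eps; field; rewrite gt_eqF.
pose u z := normc (phi z) ^+ 2 + eps * normc (z - c) ^+ 2.
have [z1 /= z1r z1max] : exists2 z, [set z | normc (z - c) <= r] z &
    forall w, [set z | normc (z - c) <= r] w -> u w <= u z.
  apply: uniformizing_max; [exact: uniformizing_disc|by exists z0|].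
  move=> z /= zr e e0.
  have c1 := cphi _ zr.
  have c2 := sd_cont (sdB (@sd_id R z) (sd_cst c z)).
  pose psi w := (phi w * (phi w)^*) + eps%:C * ((w - c) * (w - c)^*).
  have uE w : u w = complex.Re (psi w).
    rewrite /u /psi !normc_sqr; case: (phi w) => ? ?; case: (w - c) => ? ? /=; ring.
  have cconj f : ccont f z -> ccont (fun w => (f w)^*) z.
    move=> cf e1 e10; have [d d0 Hd] := cf _ e10; exists d => // w /Hd.
    by rewrite -rmorphB /= normc_conj.
  have c3 := ccontM c1 (cconj _ c1).
  have c4 := ccontM (ccont_cst eps%:C z) (ccontM c2 (cconj _ c2)).
  have e20 : 0 < e / 2 by rewrite divr_gt0.
  have [d1 d10 H1] := c3 _ e20; have [d2 d20 H2] := c4 _ e20.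
  exists (Num.min d1 d2) => [|w _]; rewrite lt_min ?d10 // => /andP[/H1 A1 /H2 A2].
  rewrite !uE; have -> : complex.Re (psi w) - complex.Re (psi z) = complex.Re (psi w - psi z).
    by case: (psi w); case: (psi z).
  apply: le_trans (normc_Re _) _.
  set a := phi w * _ - _ in A1; set b := eps%:C * _ - _ in A2.
  by rewrite (_ : psi w - psi z = a + b); [have := le_normcD a b; lra | rewrite /psi /a /b; ring].
have uz1 := z1max _ z0r.
have n2 z : 0 <= normc z ^+ 2 by rewrite sqr_ge0.
have z1r2 : normc (z1 - c) ^+ 2 <= r ^+ 2 by rewrite ler_sqr ?nnegrE ?normc_ge0 // ltW.
have ez1 : eps * normc (z1 - c) ^+ 2 <= eps * r ^+ 2 by rewrite ler_wpM2l // ltW.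
have ez0 : 0 <= eps * normc (z0 - c) ^+ 2 by rewrite mulr_ge0 // ltW.
have big : M ^+ 2 < normc (phi z1) ^+ 2 by move: uz1; rewrite /u; lra.
have z1lt : normc (z1 - c) < r.
  rewrite lt_neqAle z1r andbT; apply/eqP => /bphi.
  by rewrite -ler_sqr ?nnegrE ?normc_ge0 // leNgt big.
have p1 : 0 < normc (phi z1).
  by rewrite lt_neqAle normc_ge0 andbT; apply/eqP => E; move: big; rewrite -E expr0n /= ltNge sqr_ge0.
have [d d0 Hd] := cphi _ z1r _ (ltac:(lra) : 0 < normc (phi z1) / 2).
have rz1 : 0 < r - normc (z1 - c) by rewrite subr_gt0.
have [rho [rho0 rd rr]] := lt_both d0 rz1.
have near z : normc (z - z1) <= rho -> sd phi z.
  move=> zr; apply: dphi.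
    by have := normc_triangle z1 z c; lra.
  rewrite -normc_gt0; have := Hd z (le_lt_trans zr rd).
  by have := normc_subD (phi z) (phi z - phi z1); rewrite subKr; lra.
(* With this accuracy the mean value error costs [2 |phi z1| e], which is half of the gain
   [eps * rho ^+ 2]. *)
have e0 : 0 < eps * rho ^+ 2 / (4 * normc (phi z1)).
  by apply: divr_gt0; apply: mulr_gt0 => //; exact: exprn_gt0.
have [N [v [N0 nv vs mv]]] := mean_value rho0 e0 near.
set e := eps * _ / _ in e0 mv.
have nvk k : normc (v ^+ k) = 1 by rewrite normcX nv expr1n.
have inr k : normc (z1 + rho%:C * v ^+ k - c) <= r.
  rewrite addrAC; apply: le_trans (le_normcD _ _) _.
  by rewrite normcM nvk mulr1 normc_real gtr0_norm //; lra.
have Nr : 0 < N%:R :> R by rewrite ltr0n.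
pose F k := phi (z1 + rho%:C * v ^+ k).
have s1 : \sum_(k < N) u (z1 + rho%:C * v ^+ k) <= N%:R * u z1.
  by rewrite -sumr_cst; apply: ler_sum => k _; apply: z1max; exact: inr.
have s2 : \sum_(k < N) normc (z1 + rho%:C * v ^+ k - c) ^+ 2
    = N%:R * (normc (z1 - c) ^+ 2 + rho ^+ 2).
  transitivity (\sum_(k < N) (normc (z1 - c) ^+ 2 + rho ^+ 2
      + 2 * complex.Re ((z1 - c)^* * (rho%:C * v ^+ k)))).
    apply: eq_bigr => k _; rewrite addrAC normc_sqrD.
    by rewrite normcM nvk mulr1 normc_real gtr0_norm.
  rewrite big_split /= sumr_cst -mulr_sumr -Re_sum -mulr_sumr -mulr_sumr vs.
  by rewrite !mulr0 addr0.
(* Subharmonicity of [|phi| ^ 2] up to the mean value error: [|F k| ^ 2] is at least its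
   linearization at [phi z1]. *)
have s3 : N%:R * (normc (phi z1) ^+ 2) - 2 * normc (phi z1) * (N%:R * e)
    <= \sum_(k < N) normc (F k) ^+ 2.
  apply: le_trans (_ : \sum_(k < N) (normc (phi z1) ^+ 2
      + 2 * complex.Re ((phi z1)^* * (F k - phi z1))) <= _); last first.
    apply: ler_sum => k _.
    rewrite -[F k in leRHS](subrKC (phi z1)) normc_sqrD.
    by have := n2 (F k - phi z1); lra.
  rewrite big_split /= sumr_cst -mulr_sumr -Re_sum -mulr_sumr sumrB sumr_cst.
  set X := _ - _ in mv; rewrite -/X.
  rewrite lerD2l -mulrA -mulrN ler_wpM2l //.
  have := normc_Re ((phi z1)^* * X); rewrite normcM normc_conj ler_norml => /andP[H _].
  by have := ler_wpM2l (normc_ge0 (phi z1)) mv; lra.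
have : \sum_(k < N) u (z1 + rho%:C * v ^+ k) = \sum_(k < N) normc (F k) ^+ 2
   + eps * (N%:R * (normc (z1 - c) ^+ 2 + rho ^+ 2)).
  by rewrite -s2 mulr_sumr -big_split.
move=> sE; rewrite {}sE in s1.
have : N%:R * (eps * rho ^+ 2) <= N%:R * (2 * normc (phi z1) * e).
  by move: s1 s3; rewrite /u; lra.
rewrite ler_pM2l // leNgt => /negP; apply.
rewrite /e (_ : 2 * _ * _ = eps * rho ^+ 2 / 2); last by field; rewrite gt_eqF.
by have : 0 < eps * rho ^+ 2 by [rewrite mulr_gt0 // exprn_gt0]; lra.
Qed.

(** For [0 < M < x] the powers of [x / M] would stay below [K / k], against Bernoulli's inequality.
    This replaces the extraction of [n]-th roots. *)
Lemma expr_dominated (k x K M : R) : 0 < k -> 0 <= x -> 0 <= M ->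
  (forall n, k * x ^+ n <= K * M ^+ n) -> x <= M.
Proof.
move=> k0 x0 M0 H; rewrite leNgt; apply/negP => Mx.
have [M00|] := eqVneq M 0.
  have := H 1%N; rewrite M00 !expr1 mulr0 leNgt mulr_gt0 //.
  by apply: le_lt_trans Mx.
move=> Mn0; have {}M0 : 0 < M by rewrite lt_def Mn0.
pose q := x / M; have q1 : 0 < q - 1 by rewrite subr_gt0 /q ltr_pdivlMr ?mul1r.
have Hq n : k * q ^+ n <= K.
  by rewrite /q expr_div_n mulrA ler_pdivrMr ?exprn_gt0.
have bern n : 1 + n%:R * (q - 1) <= q ^+ n.
  elim: n => [|n IH]; first by rewrite mul0r addr0 expr0.
  rewrite exprS; apply: le_trans (ler_wpM2l _ IH); last by lra.
  rewrite -natr1; have : 0 <= n%:R * (q - 1) ^+ 2 by rewrite mulr_ge0 ?sqr_ge0.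
  by move=> H1; rewrite -subr_ge0; apply: le_trans H1 _; rewrite le_eqVlt; apply/orP; left; apply/eqP; ring.
pose n := Num.truncn (K / k / (q - 1)).
have := truncnS_gt (K / k / (q - 1)); rewrite ltr_pdivrMr // ltr_pdivrMr // -/n => H1.
have := Hq n.+1; have := bern n.+1; rewrite -(ler_pM2l k0) mulrDr => H2 H3.
by move: H1 H2 H3 k0; lra.
Qed.

Lemma punctured_nbhs_notin (S : seq C) z : exists2 d : R, 0 < d &
  forall w, w != z -> normc (w - z) < d -> w \notin S.
Proof.
elim: S => [|s S [d d0 IH]]; first by exists 1.
have [->|sz] := eqVneq s z.
  by exists d => // w wz wd; rewrite inE negb_or wz IH.
exists (Num.min d (normc (s - z))); first by rewrite lt_min d0 normc_gt0 subr_eq0.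
move=> w wz; rewrite lt_min => /andP[wd ws]; rewrite inE negb_or IH // andbT.
by apply/eqP => E; move: ws; rewrite E ltxx.
Qed.

(* Multiplying a high power of [phi] by [\prod_(s <- S) (z - s)] kills the
   exceptional points, at a cost that disappears when taking roots. *)
Lemma max_modulus (S : seq C) phi c (r M : R) : 0 < r -> 0 <= M ->
  (forall z, normc (z - c) <= r -> ccont phi z) ->
  (forall z, normc (z - c) < r -> z \notin S -> sd phi z) ->
  (forall z, normc (z - c) = r -> normc (phi z) <= M) ->
  forall z, normc (z - c) <= r -> normc (phi z) <= M.
Proof.
move=> r0 M0 cphi dphi bphi.
have main z : normc (z - c) < r -> z \notin S -> normc (phi z) <= M.
  move=> zr zS; pose P w := \prod_(s <- S) (w - s).
  have sdP w : sd P w.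
    by apply: (@sd_prod R _ S (fun s w => w - s)) => s; exact: sdB (sd_id _) (sd_cst _ _).
  have P0 : 0 < normc (P z).
    rewrite normc_prod; rewrite big_seq; apply: prodr_gt0 => s sS.
    by rewrite normc_gt0 subr_eq0; apply: contraNneq zS => ->.
  apply: (expr_dominated P0 (K := \prod_(s <- S) (r + normc (c - s)))); rewrite ?normc_ge0 // => n.
  rewrite -normcX -normcM.
  apply: (@max_modulus_zeros (fun w => P w * phi w ^+ n) c r) => //; last exact: ltW.
  - rewrite mulr_ge0 ?exprn_ge0 // prodr_ge0 // => s _; rewrite addr_ge0 ?normc_ge0 //; exact: ltW.
  - by move=> w wr; apply: ccontM; [exact: sd_cont | exact: ccontX (cphi _ wr)].
  - move=> w wr Pw0; apply: sdM => //; apply: sdX; apply: dphi => //.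
    apply: contraNN Pw0 => wS; rewrite /P (big_rem w) //= subrr !mul0r //.
  - move=> w wr; rewrite normcM normcX normc_prod; apply: ler_pM.
    + by apply: prodr_ge0 => s _; exact: normc_ge0.
    + by rewrite exprn_ge0 ?normc_ge0.
    + apply: ler_prod => s _; rewrite normc_ge0 /= -wr; exact: normc_triangle.
    + by rewrite lerXn2r ?nnegrE ?normc_ge0 // bphi.
move=> z; rewrite le_eqVlt => /predU1P[/bphi //|zr].
have [d d0 Hd] := punctured_nbhs_notin S z.
have rz : 0 < r - normc (z - c) by rewrite subr_gt0.
have [t [t0 td tr]] := lt_both d0 rz.
apply: ccont_le t0 (cphi _ (ltW zr)) _ => w wz wt; apply: main.
  by have := normc_triangle z w c; lra.
by apply: Hd wz _; lra.
Qed.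

End MaximumPrinciple.

(** * Schwarz lemma, removable singularities, identity theorem *)

Section DiscFunctions.
Variable R : realType.
Local Notation C := R[i].
Implicit Types (z w : C) (phi psi G : C -> C).

Definition diff_quot G (a L z : C) : C := if z == a then L else (G z - G a) / (z - a).

Lemma diff_quotE G a L z : z != a -> diff_quot G a L z = (G z - G a) / (z - a).
Proof. by rewrite /diff_quot => /negbTE ->. Qed.

Lemma sd_diff_quot G a L z : z != a -> sd G z -> sd (diff_quot G a L) z.
Proof.
move=> za sdG.
have r0 : 0 < normc (z - a) by rewrite normc_gt0 subr_eq0.
apply: (@sd_near R (normc (z - a)) (fun w => (G w - G a) * (w - a)^-1)) => //.
  move=> w wr; rewrite diff_quotE //; apply: contraTneq wr => ->.
  by rewrite normcB ltxx.
apply: sdM; first exact: sdB sdG (sd_cst _ _).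
by apply: sdV; [rewrite subr_eq0 | exact: sdB (sd_id _) (sd_cst _ _)].
Qed.

Lemma ccont_diff_quot G a L : sdiff G a L -> ccont (diff_quot G a L) a.
Proof.
move=> H e e0; have [d d0 Hd] := H _ e0; exists d => // w wd.
rewrite /diff_quot eqxx; case: eqVneq => [_|wa].
  by rewrite subrr normc0 ltW.
have wa0 : w - a != 0 by rewrite subr_eq0.
rewrite (_ : _ - L = (G w - G a - L * (w - a)) / (w - a)); last by field.
rewrite normcM normcV ler_pdivrMr ?normc_gt0 //.
by apply: Hd => //; rewrite subrr normc0.
Qed.

(** The maximum principle is applied to [G z / z] on a circle of radius [r < 1]; at the exceptional
    point 0 the quotient is at this stage only known to be continuous. *)
Lemma schwarz G (m : R) : 0 <= m ->
  (forall z, normc z < 1 -> sd G z) -> G 0 = 0 ->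
  (forall z, normc z < 1 -> normc (G z) <= m) ->
  forall z, normc z < 1 -> normc (G z) <= m * normc z.
Proof.
move=> m0 sdG G0 bG z z1.
have [L HL] : sd G 0 by apply: sdG; rewrite normc0.
have [->|z0] := eqVneq z 0; first by rewrite G0 !normc0 mulr0.
have nz0 : 0 < normc z by rewrite normc_gt0.
rewrite leNgt; apply/negP => big.
have Gz0 : 0 < normc (G z) by apply: le_lt_trans big; rewrite mulr_ge0 // ltW.
(* By the assumption [big] this is less than 1; any [r] between [q] and 1 gives a bound [m / r] that
   is smaller than [|G z| / |z|]. *)
pose q := Num.max (normc z) (m * normc z / normc (G z)).
have q1 : q < 1 by rewrite gt_max z1 ltr_pdivrMr // mul1r.
have [zq mq] : normc z <= q /\ m * normc z / normc (G z) <= q.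
  by rewrite !le_max !lexx orbT.
pose r := (1 + q) / 2.
have [qr r1] : q < r /\ r < 1 by rewrite /r; split; lra.
have r0 : 0 < r by lra.
have : normc (diff_quot G 0 L z) <= m / r.
  apply: (@max_modulus R [:: 0] _ 0 r) => //.
  - by rewrite divr_ge0 // ltW.
  - move=> w; rewrite subr0 => wr.
    have [->|w0] := eqVneq w 0; first exact: ccont_diff_quot.
    by apply/sd_cont/sd_diff_quot => //; apply: sdG; lra.
  - move=> w; rewrite subr0 inE => wr w0; apply: sd_diff_quot => //; apply: sdG; lra.
  - move=> w; rewrite subr0 => wr.
    rewrite diff_quotE -?normc_gt0 ?wr // G0 !subr0 normcM normcV wr.
    by rewrite ler_pM2r ?invr_gt0 // bG // wr.
  - by rewrite subr0; lra.
rewrite diff_quotE // G0 !subr0 normcM normcV ler_pdivrMr // mulrAC.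
rewrite ler_pdivlMr //; apply/negP; rewrite -ltNge.
by move: mq; rewrite ler_pdivrMr // => mq; apply: le_lt_trans mq _; rewrite mulrC ltr_pM2l.
Qed.

Lemma real_cauchy (f : R -> R) :
  (forall e, 0 < e -> exists2 d, 0 < d & forall h k, 0 < h -> h < d -> 0 < k -> k < d ->
     `|f h - f k| <= e) ->
  exists l, forall e, 0 < e -> exists2 d, 0 < d & forall h, 0 < h -> h < d -> `|f h - l| <= e.
Proof.
move=> H.
have : cauchy (f @ 0^'+).
  apply/cauchyP => e e0.
  have [d d0 Hd] := H _ (ltac:(lra) : 0 < e / 2).
  exists (f (d / 2)).
  suff : \forall h \near 0^'+, ball (f (d / 2)) e (f h) by [].
  near=> h.
  rewrite /= -ball_normE /ball_ /=; apply: (@le_lt_trans _ _ (e / 2)); last by lra.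
  apply: Hd; try lra.
  - near: h; exact: nbhs_right_gt.
  - near: h; exact: nbhs_right_lt.
move=> /cauchy_cvgP/cvg_ex[l /cvgrPdist_le Hl]; exists l => e e0.
have [d d0 Hd] := Hl _ e0; exists d => // h h0 hd.
by rewrite distrC; apply: Hd => //; rewrite /= sub0r normrN gtr0_norm.
Unshelve. all: by end_near. Qed.

Lemma complex_cauchy (f : R -> C) :
  (forall e, 0 < e -> exists2 d, 0 < d & forall h k, 0 < h -> h < d -> 0 < k -> k < d ->
     normc (f h - f k) <= e) ->
  exists l, forall e, 0 < e -> exists2 d, 0 < d & forall h, 0 < h -> h < d -> normc (f h - l) <= e.
Proof.
move=> H.
have [a Ha] : exists l, forall e, 0 < e -> exists2 d, 0 < d & forall h, 0 < h -> h < d ->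
    `|complex.Re (f h) - l| <= e.
  apply: real_cauchy => e /H[d d0 Hd]; exists d => // h k h0 hd k0 kd.
  apply: le_trans (Hd _ _ h0 hd k0 kd); apply: le_trans (normc_Re _).
  by case: (f h); case: (f k).
have [b Hb] : exists l, forall e, 0 < e -> exists2 d, 0 < d & forall h, 0 < h -> h < d ->
    `|complex.Im (f h) - l| <= e.
  apply: real_cauchy => e /H[d d0 Hd]; exists d => // h k h0 hd k0 kd.
  apply: le_trans (Hd _ _ h0 hd k0 kd); apply: le_trans (normc_Im _).
  by case: (f h); case: (f k).
exists (a +i* b) => e e0; have e2 : 0 < e / 2 by lra.
have [d1 d10 H1] := Ha _ e2; have [d2 d20 H2] := Hb _ e2.
exists (Num.min d1 d2) => [|h h0]; rewrite lt_min ?d10 // => /andP[h1 h2].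
apply: le_trans (normc_ReIm _) _.
have := H1 _ h0 h1; have := H2 _ h0 h2; case: (f h) => u v /=; lra.
Qed.

(* The difference quotients [(phi (z + h) - phi z) / h] are uniformly Cauchy on
   a circle around [s], hence, by the maximum principle, on its disc. *)
Lemma removable phi s (rho : R) : 0 < rho -> ccont phi s ->
  (forall z, z != s -> normc (z - s) < rho -> sd phi z) -> sd phi s.
Proof.
move=> rho0 cs dphi.
have cphi z : normc (z - s) < rho -> ccont phi z.
  by have [->|zs zr] := eqVneq z s; [|apply/sd_cont/dphi].
pose r := rho / 2; have r0 : 0 < r by rewrite /r; lra.
have [D HD] : exists D : C -> C, forall e, 0 < e -> exists2 d : R, 0 < d &
    forall z w, normc (z - s) = r -> normc (w - z) < d ->
      normc (phi w - phi z - D z * (w - z)) <= e * normc (w - z).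
  apply: (sd_uniform (@uniformizing_circle R s r)) => z /= zr; apply: dphi.
    by rewrite -subr_eq0 -normc_gt0 zr.
  by rewrite zr /r; lra.
pose Q h z := (phi (z + h) - phi z) / h.
have Qs h z : h != 0 -> normc (z - s) < r -> normc h < r ->
    (z \notin [:: s; s - h]) -> sd (Q h) z.
  move=> h0 zr hr; rewrite !inE negb_or => /andP[zs zsh].
  apply: sdM; last exact: sd_cst.
  apply: sdB; last by apply: dphi => //; rewrite /r in zr; lra.
  apply: sd_shift; apply: dphi; first by apply: contraNneq zsh => <-; rewrite addrK.
  by rewrite addrAC; apply: le_lt_trans (le_normcD _ _) _; rewrite /r in zr hr; lra.
have Qc h z : normc (z - s) <= r -> normc h < r -> ccont (Q h) z.
  move=> zr hr; apply: ccontM; last exact: ccont_cst.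
  have zr' : normc (z - s) < rho by rewrite /r in zr; lra.
  apply: ccontB; last exact: cphi.
  apply: ccont_shift; apply: cphi.
  by rewrite addrAC; apply: le_lt_trans (le_normcD _ _) _; rewrite /r in zr hr; lra.
have cauchy e : 0 < e -> exists2 d : R, 0 < d & forall h k z, h != 0 -> k != 0 ->
    normc h < d -> normc k < d -> normc (z - s) <= r -> normc (Q h z - Q k z) <= e.
  move=> e0; have [d d0 Hd] := HD _ (ltac:(lra) : 0 < e / 2).
  exists (Num.min d r) => [|h k z h0 k0]; rewrite lt_min ?d0 // => /andP[hd hr].
  rewrite lt_min => /andP[kd kr] zr.
  (* [Q h - Q k] evaluates [phi] at [z], [z + h] and [z + k]; the exceptional points are those where
     one of these is [s]. *)
  apply: (@max_modulus R [:: s; s - h; s - k] (fun z => Q h z - Q k z) s r) => //.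
  - exact: ltW.
  - by move=> w wr; apply: ccontB; exact: Qc.
  - move=> w wr; rewrite !inE !negb_or => /and3P[w1 w2 w3].
    by apply: sdB; apply: Qs; rewrite // !inE negb_or w1.
  - move=> w wr.
    have Qd x : x != 0 -> normc x < d -> normc (Q x w - D w) <= e / 2.
      move=> x0 xd; rewrite (_ : _ - _ = (phi (w + x) - phi w - D w * x) / x); last by rewrite /Q; field.
      rewrite normcM normcV ler_pdivrMr ?normc_gt0 //.
      have := Hd w (w + x) wr; rewrite (_ : w + x - w = x); last by ring.
      exact.
    by have := normc_triangle (D w) (Q h w) (Q k w); have := Qd _ h0 hd; have := Qd _ k0 kd; rewrite (normcB (D w)); lra.
have [L HL] : exists L, forall e, 0 < e -> exists2 d, 0 < d & forall h, 0 < h -> h < d ->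
    normc (Q h%:C s - L) <= e.
  apply: complex_cauchy => e /cauchy[d d0 Hd]; exists d => // h k h0 hd k0 kd.
  apply: Hd; rewrite ?normc_real ?gtr0_norm ?subrr ?normc0 ?ltW //.
  - by rewrite -normc_gt0 normc_real gtr0_norm.
  - by rewrite -normc_gt0 normc_real gtr0_norm.
exists L => e e0; have e3 : 0 < e / 3 by lra.
have [d1 d10 H1] := cauchy _ e3; have [d2 d20 H2] := HL _ e3.
have [h' [h'0 h'1 h'2]] := lt_both d10 d20; have [h [h0 hh' hr]] := lt_both h'0 r0.
have [hd1 hd2] : h < d1 /\ h < d2 by split; lra.
have nh : normc (h%:C : C) = h by rewrite normc_real gtr0_norm.
have hC0 : h%:C != 0 by rewrite -normc_gt0 nh.
have [d3 d30 H3] : exists2 d : R, 0 < d & forall w, normc (w - s) < d ->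
    normc (Q h%:C w - Q h%:C s) <= e / 3.
  by apply: Qc; rewrite ?nh // subrr normc0 ltW.
exists (Num.min (Num.min (d1 / 2) d3) r) => [|w w']; rewrite !lt_min ?divr_gt0 ?d30 //.
move=> /andP[/andP[w1 w3] wr] /andP[/andP[w'1 _] _].
have [->|ww'] := eqVneq w' w; first by rewrite !subrr mulr0 subr0 normc0 mulr0.
have x0 : w' - w != 0 by rewrite subr_eq0.
(* For one fixed small real [h], the quotient [Q (w' - w) w] is compared with [Q h w], then with
   [Q h s], then with [L], at a cost of [e / 3] each. *)
have -> : phi w' - phi w - L * (w' - w) = (Q (w' - w) w - L) * (w' - w).
  by rewrite /Q subrKC; field.
rewrite normcM ler_wpM2r ?normc_ge0 //.
have xd : normc (w' - w) < d1 by have := normc_triangle s w' w; rewrite (normcB s); lra.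
have hd : normc h%:C < d1 by rewrite nh.
have A1 := H1 _ _ w x0 hC0 xd hd (ltW wr).
have A2 := H2 _ h0 hd2; have A3 := H3 _ w3.
have := normc_triangle (Q h%:C w) (Q (w' - w) w) L.
by have := normc_triangle (Q h%:C s) (Q h%:C w) L; lra.
Qed.

Lemma sd_diff_quot_all G a L z (r : R) : 0 < r -> sdiff G a L ->
  (forall w, normc (w - a) < r -> sd G w) -> normc (z - a) < r -> sd (diff_quot G a L) z.
Proof.
move=> r0 HL sdG zr; have [->|za] := eqVneq z a; last by apply: sd_diff_quot => //; exact: sdG.
apply: (@removable _ a r) => // [|w wa wr]; first exact: ccont_diff_quot.
by apply: sd_diff_quot => //; exact: sdG.
Qed.

(* For [c > 0], [Re q >= 0] makes [q / (q + 2 c)] a self-map of the disc fixing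
   [0]; let [c] tend to [0] in the Schwarz lemma. *)
Lemma Re_ge0_eq0 (q : C -> C) : (forall z, normc z < 1 -> sd q z) ->
  (forall z, normc z < 1 -> 0 <= complex.Re (q z)) -> q 0 = 0 ->
  forall z, normc z < 1 -> q z = 0.
Proof.
move=> sdq req q0 z z1.
have pos (c : R) w : 0 < c -> normc w < 1 -> 0 < normc (q w + (2 * c)%:C) /\
    normc (q w) <= normc (q w + (2 * c)%:C).
  move=> c0 w1; have rw := req _ w1.
  have le : normc (q w) <= normc (q w + (2 * c)%:C).
    rewrite -ler_sqr ?nnegrE ?normc_ge0 // !normc_sqr.
    by case: (q w) rw => a b /= a0; nra.
  split=> //; have := normc_Re (q w + (2 * c)%:C); apply: lt_le_trans.
  by case: (q w) rw => a b /= a0; rewrite gtr0_norm; lra.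
have S (c : R) : 0 < c -> normc (q z) <= normc z * (normc (q z) + 2 * c).
  move=> c0; have [p le] := pos _ _ c0 z1.
  have : normc (q z / (q z + (2 * c)%:C)) <= 1 * normc z.
    apply: (@schwarz (fun w => q w / (q w + (2 * c)%:C))) => //.
    - move=> w w1; apply: sdM; first exact: sdq.
      apply: sdV; first by rewrite -normc_gt0; have [] := pos _ _ c0 w1.
      by apply: sdD; [exact: sdq | exact: sd_cst].
    - by rewrite q0 mul0r.
    - move=> w w1; rewrite normcM normcV; have [p' le'] := pos _ _ c0 w1.
      by rewrite ler_pdivrMr // mul1r.
  rewrite mul1r normcM normcV ler_pdivrMr // => H; apply: le_trans H _.
  rewrite ler_wpM2l ?normc_ge0 //; apply: le_trans (le_normcD _ _) _.
  by rewrite normc_real gtr0_norm // mulr_gt0.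
apply: eq0_normc; apply/eqP; rewrite eq_le normc_ge0 andbT leNgt; apply/negP => p.
have z0 := normc_ge0 z.
have := S (normc (q z) * (1 - normc z) / 4).
have -> : 0 < normc (q z) * (1 - normc z) / 4 by rewrite divr_gt0 // mulr_gt0 // subr_gt0.
have p' : 0 < normc (q z) * (1 - normc z) by rewrite mulr_gt0 // subr_gt0.
have := ler_wpM2r (ltW p') (ltW z1); rewrite mul1r.
by move=> H /(_ isT); move: H p'; lra.
Qed.

(** [1 - conj (G 0) * G] has nonnegative real part and vanishes at 0, so [Re_ge0_eq0] applies. *)
Lemma constant_of_max G : (forall z, normc z < 1 -> sd G z) ->
  (forall z, normc z < 1 -> normc (G z) <= 1) -> normc (G 0) = 1 ->
  forall z, normc z < 1 -> G z = G 0.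
Proof.
move=> sdG bG G01 z z1.
have G0J : (G 0)^* * G 0 = 1.
  have := normc_sqr (G 0); rewrite G01 expr1n; case: (G 0) => a b /= E.
  by apply/eqP; rewrite eq_complex /=; apply/andP; split; apply/eqP; [rewrite E|]; ring.
have : 1 - (G 0)^* * G z = 0.
  apply: (@Re_ge0_eq0 (fun w => 1 - (G 0)^* * G w)) => //.
  - by move=> w w1; apply: sdB; [exact: sd_cst|apply: sdM; [exact: sd_cst|exact: sdG]].
  - move=> w w1; have := normc_Re ((G 0)^* * G w).
    rewrite normcM normc_conj G01 mul1r => H; have := bG _ w1.
    have := ler_norm (complex.Re ((G 0)^* * G w)).
    by case: ((G 0)^* * G w) H => a b /=; lra.
  - by rewrite G0J subrr.
move=> /eqP; rewrite subr_eq0 => /eqP E.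
by rewrite -[LHS]mul1r -G0J mulrAC -E mul1r.
Qed.

(** As [phi] vanishes near [c], it can be divided by every power of [z - c]. The maximum principle
    on a circle of radius [s > |z0 - c|] bounds [|phi z0|] by a constant times [(|z0 - c| / s) ^ n]
    for all [n]. *)
Lemma vanish_disc phi c (r rho : R) : 0 < rho ->
  (forall z, normc (z - c) < r -> sd phi z) ->
  (forall z, normc (z - c) < rho -> phi z = 0) ->
  forall z, normc (z - c) < r -> phi z = 0.
Proof.
move=> rho0 sdphi phi0 z0 z0r; apply/eqP; rewrite -[_ == _]negbK -normc_gt0.
apply/negP => k0.
pose s := (normc (z0 - c) + r) / 2.
have [zs sr] : normc (z0 - c) < s /\ s < r by rewrite /s; split; lra.
have s0 : 0 < s by have := normc_ge0 (z0 - c); lra.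
have [z1 _ z1max] : exists2 z, [set z | normc (z - c) = s] z &
    forall w, [set z | normc (z - c) = s] w -> normc (phi w) <= normc (phi z).
  apply: (uniformizing_max (u := fun w => normc (phi w))); first exact: uniformizing_circle.
    by exists (c + s%:C) => /=; rewrite addrC addKr normc_real gtr0_norm.
  move=> z /= zr e e0; have [|d d0 Hd] := sd_cont (sdphi z _) e0; first by rewrite zr.
  exists d => // w _ /Hd; have := normc_ler_add (phi w) (- phi z); have := normc_ler_add (phi z) (- phi w).
  by rewrite !normcN (normcB (phi z)) ler_norml => *; apply/andP; split; lra.
suff : s <= normc (z0 - c) by lra.
apply: (expr_dominated k0 (K := normc (phi z1))); rewrite ?normc_ge0 ?ltW // => n.
have : normc (phi z0 / (z0 - c) ^+ n) <= normc (phi z1) / s ^+ n.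
  apply: (@max_modulus_zeros R (fun w => phi w / (w - c) ^+ n) c s) => //.
  - by rewrite divr_ge0 ?normc_ge0 // exprn_ge0 // ltW.
  - move=> z zr; have [->|zc] := eqVneq z c.
      by apply: ccont_near rho0 _ (ccont_cst 0 _) => w /phi0 ->; rewrite mul0r.
    apply: sd_cont; apply: sdM; first by apply: sdphi; lra.
    apply: sdV; first by rewrite expf_neq0 // subr_eq0.
    by apply: sdX; exact: sdB (sd_id _) (sd_cst _ _).
  - move=> z zr; rewrite mulf_eq0 negb_or => /andP[pz _].
    apply: sdM; first by apply: sdphi; lra.
    apply: sdV; last by apply: sdX; exact: sdB (sd_id _) (sd_cst _ _).
    rewrite expf_neq0 // subr_eq0; apply: contraNneq pz => ->.
    by rewrite phi0 // subrr normc0.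
  - move=> z zr; rewrite normcM normcV normcX zr ler_pM2r ?invr_gt0 ?exprn_gt0 //.
    exact: z1max.
  - exact: ltW.
have [zc|zc] := eqVneq z0 c; first by move: k0; rewrite phi0 ?zc ?subrr ?normc0 // ltxx.
have p : 0 < normc (z0 - c) ^+ n by rewrite exprn_gt0 // normc_gt0 subr_eq0.
rewrite normcM normcV normcX ler_pdivrMr // mulrAC ler_pdivlMr ?exprn_gt0 //.
Qed.

(* Cutting [phi] to 0 below the real axis keeps it strictly differentiable. *)
Lemma vanish_upper phi (c r : R) :
  (forall z, normc (z - c%:C) < r -> sd phi z) ->
  (forall t : R, normc (t%:C - c%:C) < r -> phi t%:C = 0) ->
  forall z, normc (z - c%:C) < r -> 0 < complex.Im z -> phi z = 0.
Proof.
move=> sdphi phi0 z0 z0r im0.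
pose cut z := if 0 < complex.Im z then phi z else 0.
have sdcut z : normc (z - c%:C) < r -> sd cut z.
  move=> zr; have [zpos|zneg|zreal] := ltrgtP 0 (complex.Im z).
  - apply: sd_near zpos _ (sdphi _ zr) => w wz; rewrite /cut.
    have := normc_Im (w - z).
    case: w wz => a b; case: z {zr} => a' b' wz /=; rewrite ler_norml => /andP[H _].
    by case: ltP => // bb; move: wz H => /= wz H; exfalso; lra.
  - have zneg' : 0 < - complex.Im z by rewrite oppr_gt0.
    apply: sd_near zneg' _ (sd_cst 0 z) => w wz; rewrite /cut.
    have := normc_Im (w - z).
    case: w wz => a b; case: z {zr zneg} => a' b' wz /=; rewrite ler_norml => /andP[_ H].
    by case: ltP => // bb; move: wz H => /= wz H; exfalso; lra.
  - have zE : z = (complex.Re z)%:C by case: z zreal {zr} => a b /= <-.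
    have [L HL] := sdphi _ zr.
    have phiz : phi z = 0 by rewrite zE phi0 // -zE.
    have r1 : 0 < r - normc (z - c%:C) by rewrite subr_gt0.
    have projz w : normc ((complex.Re w)%:C - z) <= normc (w - z).
      rewrite {1}zE -rmorphB normc_real; apply: le_trans (normc_Re _).
      by case: (w); case: (z).
    have real_near w : normc (w - z) < r - normc (z - c%:C) -> phi (complex.Re w)%:C = 0.
      move=> wz; apply: phi0; have := normc_triangle z (complex.Re w)%:C c%:C.
      by have := projz w; lra.
    (* [phi] is zero at the real points near [z], and [L] is its derivative along the real axis. *)
    have L0 : L = 0.
      apply/eqP; rewrite -[_ == _]negbK -normc_gt0; apply/negP => nL.
      have [d d0 Hd] := HL _ (ltac:(lra) : 0 < normc L / 2).
      have [h [h0 hd hr]] := lt_both d0 r1.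
      have nh : normc (h%:C : C) = h by rewrite normc_real gtr0_norm.
      have := Hd z (z + h%:C); rewrite subrr normc0 => /(_ d0).
      have -> : z + h%:C - z = h%:C by ring.
      rewrite nh => /(_ hd).
      have -> : phi (z + h%:C) = 0.
        have <- : phi (complex.Re (z + h%:C))%:C = 0.
          by apply: real_near; rewrite (_ : z + h%:C - z = h%:C) ?nh //; ring.
        by congr phi; move: zreal; case: (z) => a b /= <-; apply/eqP; rewrite eq_complex /= addr0 !eqxx.
      rewrite phiz subrr sub0r normcN normcM nh ler_pM2r //; lra.
    rewrite L0 in HL; exists 0 => e e0; have [d d0 Hd] := HL _ e0.
    exists (Num.min d (r - normc (z - c%:C))) => [|w w']; first by rewrite lt_min d0 r1.
    rewrite !lt_min => /andP[wd wr] /andP[w'd w'r]; rewrite mul0r subr0.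
    (* [phi] vanishes at the foot [Re u], so [|phi u| <= e * Im u]; a point [v] on the other side of
       the axis is at least [Im u] away from [u]. *)
    have key u v : normc (u - z) < d -> normc (u - z) < r - normc (z - c%:C) ->
        0 < complex.Im u -> complex.Im v <= 0 -> normc (phi u) <= e * normc (v - u).
      move=> ud ur upos vneg.
      have := Hd (complex.Re u)%:C u (le_lt_trans (projz u) ud) ud.
      rewrite real_near // mul0r !subr0 => H; apply: le_trans H _.
      rewrite ler_wpM2l ?(ltW e0) //.
      have -> : u - (complex.Re u)%:C = 0 +i* complex.Im u.
        by case: (u) => a b; apply/eqP; rewrite eq_complex /= subrr subr0 !eqxx.
      rewrite /= expr0n /= add0r sqrtr_sqr gtr0_norm //.
      apply: le_trans (normc_Im (v - u)); move: upos vneg; case: (u) => a b; case: (v) => a' b' /= H1 H2.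
      by rewrite ltr0_norm; lra.
    rewrite /cut; case: ltP => iw'; case: ltP => iw.
    + by have := Hd w w' wd w'd; rewrite mul0r subr0.
    + by rewrite subr0 (normcB w' w); exact: key.
    + by rewrite sub0r normcN; exact: key.
    + by rewrite subrr normc0 mulr_ge0 ?normc_ge0 // ltW.
have r2 : 0 < (r - normc (z0 - c%:C)) / 2 by rewrite divr_gt0 // subr_gt0.
(* The centre is lowered by [eta], so that [cut] vanishes on the disc of radius [eta] around it; the
   disc of radius [r - eta] still contains [z0]. *)
have [eta [eta0 etai etar]] := lt_both im0 r2.
have ne : normc (0 +i* - eta) = eta :> R.
  by rewrite /= expr0n /= add0r sqrrN sqrtr_sqr gtr0_norm.
pose c' : C := c%:C + (0 +i* - eta).
have cc z : normc (z - c%:C) <= normc (z - c') + eta.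
  by rewrite -ne -[in leLHS](_ : (z - c') + (0 +i* - eta) = z - c%:C) ?le_normcD // /c'; ring.
have c'c z : normc (z - c') <= normc (z - c%:C) + eta.
  rewrite -ne (_ : z - c' = (z - c%:C) - (0 +i* - eta)) ?normc_subD // /c'; ring.
have <- : cut z0 = phi z0 by rewrite /cut im0.
apply: (@vanish_disc cut c' (r - eta) eta) => //.
- by move=> z zr; apply: sdcut; have := cc z; lra.
- move=> z zr; rewrite /cut; case: ltP => // iz; exfalso.
  have := normc_Im (z - c'); rewrite /c' ler_norml => /andP[_].
  move: zr iz; rewrite /c'; case: (z) => a b zr iz; have -> : complex.Im (a +i* b - (c%:C + (0 +i* - eta))) = b + eta by rewrite /=; ring.
  by move: zr iz; rewrite -[complex.Im (a +i* b)]/b; lra.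
- by have := c'c z0; lra.
Qed.

Lemma vanish_real phi (c r : R) :
  (forall z, normc (z - c%:C) < r -> sd phi z) ->
  (forall t : R, normc (t%:C - c%:C) < r -> phi t%:C = 0) ->
  forall z, normc (z - c%:C) < r -> phi z = 0.
Proof.
move=> sdphi phi0 z zr; have [zpos|zneg|zreal] := ltrgtP 0 (complex.Im z).
- exact: (@vanish_upper phi c r).
(* The half turn about [c] exchanges the two half-planes, preserves the real axis and, unlike the
   reflection, is holomorphic. *)
- have E w : -1 * w + (2 * c)%:C - c%:C = - (w - c%:C) by rewrite rmorphM rmorph_nat; ring.
  have F w : -1 * (-1 * w + (2 * c)%:C) + (2 * c)%:C = w by ring.
  rewrite -[z]F; apply: (@vanish_upper (fun w => phi (-1 * w + (2 * c)%:C)) c r).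
  + by move=> w wr; apply: sd_lin; apply: sdphi; rewrite E normcN.
  + move=> t tr; have -> : -1 * t%:C + (2 * c)%:C = (2 * c - t)%:C by rewrite rmorphB; ring.
    apply: phi0; have -> : (2 * c - t)%:C - c%:C = - (t%:C - c%:C).
      by rewrite rmorphB rmorphM rmorph_nat; ring.
    by rewrite normcN.
  + by rewrite E normcN.
  + have -> : complex.Im (-1 * z + (2 * c)%:C) = - complex.Im z.
      by case: (z) => a b /=; ring.
    by rewrite oppr_gt0.
- by move: zreal zr; case: z => a b /= <-; exact: phi0.
Qed.

(** The points near which [phi] vanishes form a set that is open and closed in [W]; [vanish_real]
    puts the real point [c] in it. *)
Lemma vanish_connected (W : set (R * R)) phi (c : R) : open W -> connected W ->
  W (c, 0) -> (forall p, W p -> sd phi (cpx p)) ->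
  (forall t, W (t, 0) -> phi (cpx (t, 0)) = 0) ->
  forall p, W p -> phi (cpx p) = 0.
Proof.
move=> oW cW Wc sdphi phi0.
have near p : W p -> exists2 d, 0 < d & forall q, normc (cpx q - cpx p) < d -> W q.
  move=> Wp; have : nbhs p W by exact: open_nbhs_nbhs.
  move=> /nbhs_distP[d d0 Hd]; exists d => // q /(le_lt_trans (dist_cpx _ _)) qp.
  exact: Hd.
have cpxE z : z = cpx (complex.Re z, complex.Im z) by case: z.
pose Z := [set p | W p /\ exists2 d, 0 < d & forall z, normc (z - cpx p) < d -> phi z = 0].
have ZW : Z = W.
  apply: cW.
  - exists (c, 0); split=> //; have [d d0 Hd] := near _ Wc; exists d => // z zd.
    apply: (@vanish_real phi c d) => // [w wd|t td].
      by rewrite (cpxE w); apply: sdphi; apply: Hd; rewrite -cpxE.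
    by apply: phi0; apply: Hd.
  - exists Z; last by apply/seteqP; split=> [p Zp|p []] //; split=> //; case: Zp.
    rewrite openE => p [Wp [d d0 Hd]]; apply/nbhs_distP.
    have [d1 d10 Hd1] := near _ Wp.
    exists (Num.min d d1 / 4) => [|q]; first by rewrite divr_gt0 // lt_min d0.
    move=> qp; have := cpx_dist q p.
    have := lexx (Num.min d d1); rewrite le_min => /andP[l1 l2] l3.
    have l4 : 0 < Num.min d d1 by rewrite lt_min d0.
    split; first by apply: Hd1; lra.
    exists (d / 2) => [|z zq]; first by rewrite divr_gt0.
    by apply: Hd; have := normc_triangle (cpx q) z (cpx p); lra.
  - exists (closure Z); first exact: closed_closure.
    apply/seteqP; split=> [p Zp|p [Wp clp]].
      by split; [case: Zp | exact: subset_closure].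
    split=> //; have [r r0 Hr] := near _ Wp.
    have /clp[q [[Wq [d d0 Hd]] qp]] : nbhs p [set q | normc (cpx q - cpx p) < r / 3].
      apply/nbhs_distP; exists (r / 6) => [|q qp]; first by rewrite divr_gt0.
      suff : normc (cpx q - cpx p) < r / 3 by [].
      by have := cpx_dist q p; lra.
    exists (r / 3) => [|z zp]; first by rewrite divr_gt0.
    have tri w := normc_triangle (cpx q) w (cpx p).
    have tri' := normc_triangle (cpx p) z (cpx q).
    rewrite (normcB (cpx p) (cpx q)) in tri'.
    have {}qp : normc (cpx q - cpx p) < r / 3 by exact: qp.
    apply: (@vanish_disc phi (cpx q) (2 * r / 3) d) => // [w wr|]; last by lra.
    by rewrite (cpxE w); apply: sdphi; apply: Hr; rewrite -cpxE; have := tri w; lra.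
move=> p; rewrite -ZW => -[Wp [d d0 Hd]]; apply: Hd.
by rewrite subrr normc0.
Qed.

End DiscFunctions.

(** * Boundary points of the disc *)

Section BoundaryPoint.
Variable R : realType.
Local Notation C := R[i].
Implicit Types (z w zeta L : C) (phi psi G : C -> C).

(* [|1 + h| < 1] for [h = - t] and for [h = - t ^ 2 +- i t]. *)
Lemma boundary_derivative phi zeta L : normc zeta = 1 -> sdiff phi zeta L ->
  (forall z, normc z < 1 -> normc (phi z) <= 1) -> phi zeta = 1 ->
  complex.Im (zeta * L) = 0 /\ 0 <= complex.Re (zeta * L).
Proof.
move=> nz HL bphi phi1; set lam := zeta * L.
have key e : 0 < e -> exists2 d, 0 < d & forall h, normc h < d -> normc (1 + h) < 1 ->
    complex.Re (lam * h) <= e * normc h.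
  move=> e0; have [d d0 Hd] := HL _ e0; exists d => // h hd h1.
  have := Hd zeta (zeta + zeta * h).
  rewrite subrr normc0 (_ : zeta + zeta * h - zeta = zeta * h); last by ring.
  rewrite normcM nz mul1r => /(_ d0 hd); rewrite phi1 => H.
  have : normc (phi (zeta + zeta * h)) <= 1.
    by apply: bphi; rewrite -[X in X + _]mulr1 -mulrDr normcM nz mul1r.
  move=> /(le_trans (normc_Re _)); rewrite ler_norml => /andP[_].
  have := normc_Re (phi (zeta + zeta * h) - 1 - L * (zeta * h)).
  rewrite ler_norml => /andP[A _]; have := le_trans A (lexx _).
  have E : L * (zeta * h) = lam * h by rewrite /lam; ring.
  move: A H; rewrite E; move: (normc (_ - _)) => n.
  by case: (phi _) => a b; case: (lam * h) => x y /=; lra.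
have ReM x y : complex.Re (lam * (x +i* y)) = x * complex.Re lam - y * complex.Im lam.
  by move: (lam) => [a b] /=; ring.
split; last first.
  apply/ler_addgt0Pr => e e0; have [d d0 Hd] := key _ e0.
  have [t [t0 td t1]] := lt_both d0 ltr01.
  have nt : normc (- t +i* 0) = t by rewrite /= expr0n addr0 sqrrN sqrtr_sqr gtr0_norm.
  have := Hd (- t +i* 0); rewrite nt ReM => /(_ td).
  have -> : normc (1 + (- t +i* 0)) < 1.
    have -> : 1 + (- t +i* 0) = (1 - t)%:C by apply/eqP; rewrite eq_complex /= addr0 !eqxx.
    by rewrite normc_real ger0_norm; lra.
  by move=> /(_ isT) H; rewrite -(ler_pM2l t0) mulr0 mulrDr; lra.
have im (s : R) : s ^+ 2 = 1 -> 0 <= s * complex.Im lam.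
  move=> s1; apply/ler_addgt0Pr => e e0.
  have e3 : 0 < e / 3 by lra.
  have [d d0 Hd] := key _ e3.
  have K0 : 0 < 3 * (`|complex.Re lam| + 1) by have := normr_ge0 (complex.Re lam); lra.
  have [m [m0 md m1]] := lt_both (ltac:(lra) : 0 < d / 2) ltr01.
  have [t [t0 tm te]] := lt_both m0 (divr_gt0 e0 K0).
  have [td t1] : 2 * t < d /\ t < 1 by split; lra.
  have te' : t * `|complex.Re lam| <= e / 3.
    by move: te; rewrite ltr_pdivlMr // => te; move: t0 te; lra.
  have t21 : t ^+ 2 < 1 by rewrite expr_lt1 // ltW.
  have t20 : 0 < t ^+ 2 by rewrite exprn_gt0.
  have t42 : t ^+ 4 < t ^+ 2.
    by rewrite (_ : t ^+ 4 = t ^+ 2 * t ^+ 2) ?gtr_pMr //; ring.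
  pose h : C := - t ^+ 2 +i* (s * t).
  have st : (s * t) ^+ 2 = t ^+ 2 by rewrite exprMn s1 mul1r.
  have nh2 : normc h ^+ 2 = t ^+ 4 + t ^+ 2 by rewrite normc_sqr /= st; ring.
  have nh : normc h <= 2 * t.
    have t2 : 0 <= 2 * t by rewrite mulr_ge0 // ltW.
    by rewrite -ler_sqr ?nnegrE ?normc_ge0 // nh2 (_ : (2 * t) ^+ 2 = 4 * t ^+ 2); [lra | ring].
  have h1 : normc (1 + h) < 1.
    have E : normc (1 + h) ^+ 2 = (1 - t ^+ 2) ^+ 2 + t ^+ 2.
      by rewrite normc_sqr /= add0r st.
    have : normc (1 + h) ^+ 2 < 1 by rewrite E; move: t42; lra.
    by rewrite expr_lt1 // normc_ge0.
  have := Hd h (le_lt_trans nh td) h1; rewrite ReM => H.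
  have H2 : t * (- (t * complex.Re lam) - s * complex.Im lam) <= t * (2 * e / 3).
    apply: le_trans (_ : e / 3 * normc h <= _); last first.
      by apply: le_trans (ler_wpM2l (ltW e3) nh) _; lra.
    by apply: le_trans H; rewrite le_eqVlt; apply/orP; left; apply/eqP; ring.
  move: H2; rewrite ler_pM2l // => H2.
  have := ler_norm (complex.Re lam); rewrite -(ler_pM2l t0) => H3.
  by lra.
have := im 1; have := im (-1); rewrite sqrrN expr1n => /(_ erefl) A /(_ erefl) B.
lra.
Qed.

(* [G = 1 - A (1 - phi) / ((1 - alpha) (1 - phi 0))] is a self-map of the disc
   with [G 0 = 0]; the Schwarz lemma gives [1 - r <= |1 - G (r zeta)|]. *)
Lemma julia phi alpha zeta L (A : R) : normc zeta = 1 -> 0 < A ->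
  (forall z, normc z < 1 -> sd phi z) -> (forall z, normc z < 1 -> sd alpha z) ->
  sdiff phi zeta L -> ccont alpha zeta -> phi zeta = 1 -> phi 0 != 1 ->
  alpha 0 = 1 - A%:C ->
  (forall z, normc z < 1 -> alpha z != 1) ->
  (forall z, normc z < 1 -> normc ((1 - alpha z) * (1 - phi 0) - A%:C * (1 - phi z))
     <= normc ((1 - alpha z) * (1 - phi 0))) ->
  normc (1 - alpha zeta) * normc (1 - phi 0) <= A * normc L.
Proof.
move=> nz A0 sphi salpha HL calpha phi1 phi01 alpha0 alpha1 ineq.
have k0 : 1 - phi 0 != 0 by rewrite subr_eq0 eq_sym.
have nk0 : 0 < normc (1 - phi 0) by rewrite normc_gt0.
have a1 z : normc z < 1 -> 1 - alpha z != 0 by move=> z1; rewrite subr_eq0 eq_sym alpha1.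
pose G z := 1 - A%:C * (1 - phi z) / ((1 - alpha z) * (1 - phi 0)).
have bG z : normc z < 1 -> normc (G z) <= 1 * normc z.
  apply: schwarz => // {z}.
  - move=> z z1; apply: sdB; first exact: sd_cst.
    apply: sdM; first by apply: sdM; [exact: sd_cst|apply: sdB; [exact: sd_cst|exact: sphi]].
    apply: sdV; first by rewrite mulf_neq0 ?a1.
    apply: sdM; last exact: sd_cst.
    by apply: sdB; [exact: sd_cst|exact: salpha].
  - rewrite /G alpha0 subKr divff ?subrr // mulf_neq0 //.
    by rewrite -normc_gt0 normc_real gtr0_norm.
  - move=> z z1; have d0 : (1 - alpha z) * (1 - phi 0) != 0 by rewrite mulf_neq0 ?a1.
    rewrite /G (_ : 1 - _ / _ = ((1 - alpha z) * (1 - phi 0) - A%:C * (1 - phi z))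
       / ((1 - alpha z) * (1 - phi 0))); last by field; rewrite k0 a1.
    by rewrite normcM normcV ler_pdivrMr ?normc_gt0 // mul1r ineq.
have key (t : R) : 0 < t -> t < 1 ->
    t * (normc (1 - alpha ((1 - t)%:C * zeta)) * normc (1 - phi 0))
      <= A * normc (phi ((1 - t)%:C * zeta) - phi zeta).
  move=> t0 t1; set z := (1 - t)%:C * zeta.
  have nzt : normc z = 1 - t by rewrite normcM nz mulr1 normc_real ger0_norm //; lra.
  have z1 : normc z < 1 by rewrite nzt; lra.
  have := bG _ z1; rewrite mul1r nzt => H.
  have : t <= normc (1 - G z) by have := normc_ler_add 1 (- G z); rewrite normc1 normcN; lra.
  rewrite /G subKr normcM normcV !normcM normc_real gtr0_norm // phi1 (normcB (phi z)).
  by rewrite ler_pdivlMr // mulr_gt0 // normc_gt0 a1.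
apply/ler_addgt0Pr => e e0.
pose K := normc (1 - phi 0) + A.
have K0 : 0 < K by rewrite addr_gt0.
have e1 : 0 < e / K by rewrite divr_gt0.
have [d1 d10 H1] := HL _ e1; have [d2 d20 H2] := calpha _ e1.
have [d [d0 dd1 dd2]] := lt_both d10 d20; have [t [t0 td t1]] := lt_both d0 ltr01.
have [td1 td2] : t < d1 /\ t < d2 by split; lra.
set z := (1 - t)%:C * zeta.
have E : z - zeta = - (t%:C * zeta) by rewrite /z rmorphB; ring.
have nE : normc (z - zeta) = t by rewrite E normcN normcM nz mulr1 normc_real gtr0_norm.
have := H1 zeta z; rewrite subrr normc0 nE => /(_ d10 td1) B1.
have := H2 z; rewrite nE => /(_ td2) B2.
have B3 : normc (phi z - phi zeta) <= (normc L + e / K) * t.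
  have := le_normcD (phi z - phi zeta - L * (z - zeta)) (L * (z - zeta)).
  by rewrite subrK normcM nE mulrDl; lra.
have := key t t0 t1; rewrite -/z => B4.
have B5 : t * (normc (1 - alpha z) * normc (1 - phi 0)) <= t * (A * (normc L + e / K)).
  by apply: le_trans B4 _; rewrite [leRHS]mulrCA ler_pM2l // mulrC.
rewrite ler_pM2l // in B5.
have B6 : normc (1 - alpha zeta) <= normc (1 - alpha z) + e / K.
  have := le_normcD (1 - alpha z) (alpha z - alpha zeta).
  by rewrite (_ : 1 - alpha z + _ = 1 - alpha zeta); [lra | ring].
apply: le_trans (ler_wpM2r (ltW nk0) B6) _.
rewrite mulrDl; move: B5; rewrite mulrDr => B5.
have : e / K * normc (1 - phi 0) + A * (e / K) = e by rewrite /K; field; rewrite -/K gt_eqF.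
lra.
Qed.

(** The squares of the two sides differ by [(1 - |a| ^ 2) * (1 - |w| ^ 2)]. *)
Lemma normc_moebius (w a : C) : normc w <= 1 -> normc a <= 1 ->
  normc (w - a) <= normc (1 - a^* * w).
Proof.
move=> w1 a1; rewrite -ler_sqr ?nnegrE ?normc_ge0 // !normc_sqr.
have : normc w ^+ 2 <= 1 by rewrite expr_le1 // normc_ge0.
have : normc a ^+ 2 <= 1 by rewrite expr_le1 // normc_ge0.
rewrite !normc_sqr; case: w w1 => x y _; case: a a1 => u v _ /= A B.
rewrite -subr_ge0 [X in 0 <= X](_ : _ = (1 - (u ^+ 2 + v ^+ 2)) * (1 - (x ^+ 2 + y ^+ 2))); last by ring.
by rewrite mulr_ge0 // subr_ge0.
Qed.

(** The case [alpha = conj (phi 0) * phi] and [A = 1 - |phi 0| ^ 2] of [julia], in which its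
    self-map condition becomes [normc_moebius]. *)
Lemma julia_scalar phi zeta L : normc zeta = 1 ->
  (forall z, normc z < 1 -> sd phi z) -> sdiff phi zeta L ->
  (forall z, normc z < 1 -> normc (phi z) <= 1) -> phi zeta = 1 -> normc (phi 0) < 1 ->
  normc (1 - phi 0) ^+ 2 <= (1 - normc (phi 0) ^+ 2) * normc L.
Proof.
move=> nz sphi HL bphi phi1 phi01.
have A0 : 0 < 1 - normc (phi 0) ^+ 2 by rewrite subr_gt0 expr_lt1 // normc_ge0.
have aJ : (phi 0)^* * phi 0 = (normc (phi 0) ^+ 2)%:C.
  by rewrite normc_sqr; case: (phi 0) => a b /=; apply/eqP; rewrite eq_complex /=; apply/andP; split; apply/eqP; ring.
have AE : (1 - normc (phi 0) ^+ 2)%:C = 1 - (phi 0)^* * phi 0 by rewrite aJ rmorphB rmorph1.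
have := @julia phi (fun z => (phi 0)^* * phi z) zeta L (1 - normc (phi 0) ^+ 2) nz A0 sphi.
rewrite phi1 mulr1; have -> : normc (1 - (phi 0)^*) = normc (1 - phi 0).
  by rewrite -[in RHS]normc_conj rmorphB rmorph1.
rewrite -expr2; apply => //.
- by move=> z z1; apply: sdM; [exact: sd_cst|exact: sphi].
- by apply: ccontM; [exact: ccont_cst|exact: sdiff_cont HL].
- by apply: contraTneq phi01 => ->; rewrite normc1 ltxx.
- by rewrite AE subKr.
- move=> z z1; apply: contraTneq (lexx (1 : R)) => E.
  rewrite -ltNge -[ltLHS](normc1 R) -E normcM normc_conj.
  apply: le_lt_trans phi01; rewrite ler_piMr ?normc_ge0 //; exact: bphi.
- move=> z z1; rewrite AE.
  rewrite (_ : _ - _ = (phi z - phi 0) * (1 - (phi 0)^*)); last by ring.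
  rewrite !normcM -(normc_conj (1 - phi 0)) rmorphB rmorph1.
  by rewrite ler_wpM2r ?normc_ge0 //; apply: normc_moebius; [exact: bphi | exact: ltW].
Qed.

(** By the Schwarz lemma [g z = zeta * G z / z] is bounded by 1; it has value 1 at [zeta], and
    derivative 0 there because [zeta * L = 1]. Julia's inequality for [g] then excludes [|g 0| < 1],
    so [g] is constant. *)
Lemma schwarz_rigidity G zeta L : normc zeta = 1 ->
  (forall z, normc z < 1 -> sd G z) -> sdiff G zeta L ->
  (forall z, normc z < 1 -> normc (G z) <= 1) -> G 0 = 0 -> G zeta = 1 ->
  zeta * L = 1 -> forall z, normc z < 1 -> G z = zeta^-1 * z.
Proof.
move=> nz sG HL bG G0 G1 lam1.
have z0 : zeta != 0 by rewrite -normc_gt0 nz.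
have [L0 HL0] : sd G 0 by apply: sG; rewrite normc0.
pose g z := zeta * diff_quot G 0 L0 z.
have gE z : z != 0 -> g z = zeta * G z / z.
  by move=> zn0; rewrite /g diff_quotE // G0 !subr0 mulrA.
have sg z : normc z < 1 -> sd g z.
  move=> z1; apply: sdM; first exact: sd_cst.
  by apply: (@sd_diff_quot_all R _ _ _ _ 1) => // [w|]; rewrite subr0 //; exact: sG.
have bg z : normc z < 1 -> normc (g z) <= 1.
  move=> z1.
  have main w : w != 0 -> normc w < 1 -> normc (g w) <= 1.
    move=> w0 w1; rewrite gE // !normcM nz mul1r normcV ler_pdivrMr ?normc_gt0 //.
    exact: schwarz w1.
  have [->|zn0] := eqVneq z 0; last exact: main.
  apply: ccont_le ltr01 (sd_cont (sg 0 _)) _; first by rewrite normc0.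
  by move=> w w0; rewrite subr0; exact: main.
have Hg : sdiff g zeta 0.
  have K := sdiffM (sdiffM (@sdiff_cst R zeta zeta) HL) (sdiff_inv z0).
  have := @sdiff_near R (normc zeta) _ g zeta _ _ _ K.
  rewrite mul0r add0r lam1 G1 mulr1 mul1r => H.
  have -> : 0 = zeta^-1 + zeta * - zeta ^- 2 by field.
  apply: H => [|w wz]; first by rewrite nz.
  rewrite gE // -normc_gt0; have := normc_subD w (w - zeta); rewrite subKr; lra.
have g1 : g zeta = 1 by rewrite gE // G1 mulr1 divff.
have g01 : normc (g 0) = 1.
  apply/eqP; rewrite eq_le bg ?normc0 //= leNgt; apply/negP => lt1.
  have := julia_scalar nz sg Hg bg g1 lt1; rewrite normc0 mulr0 => H.
  have : normc (1 - g 0) = 0 by apply/eqP; rewrite -sqrf_eq0 eq_le H sqr_ge0.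
  move=> /eq0_normc/eqP; rewrite subr_eq0 => /eqP E.
  by move: lt1; rewrite -E normc1 ltxx.
have gc := constant_of_max sg bg g01.
have g0E : g 0 = 1.
  by rewrite -g1; apply/esym/(boundary_agree nz (sdiff_cont Hg) (ccont_cst _ _)).
move=> z z1; have [->|zn0] := eqVneq z 0; first by rewrite G0 mulr0.
have := gc _ z1; rewrite g0E gE // => H.
by apply: (mulfI z0); rewrite mulrA divff // mul1r -[RHS]mul1r -H; field.
Qed.

(** Composing [phi] with the automorphism [(w - t) / (1 - t w)], whose derivative at 1 is
    [(1 + t) / (1 - t)], reduces the claim to [schwarz_rigidity]. *)
Lemma julia_rigidity phi zeta L (t : R) : normc zeta = 1 ->
  (forall z, normc z < 1 -> sd phi z) -> sdiff phi zeta L ->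
  (forall z, normc z < 1 -> normc (phi z) <= 1) -> phi zeta = 1 ->
  phi 0 = t%:C -> `|t| < 1 -> zeta * L = ((1 - t) / (1 + t))%:C ->
  forall z, normc z < 1 ->
    phi z = (zeta^-1 * z + t%:C) / (1 + t%:C * (zeta^-1 * z)).
Proof.
move=> nz sphi HL bphi phi1 phi0 t1 lam z z1.
have z0 : zeta != 0 by rewrite -normc_gt0 nz.
have [t11 t12] : -1 < t /\ t < 1 by move: t1; rewrite ltr_norml => /andP[].
have nt : normc (t%:C : C) < 1 by rewrite normc_real.
have d0 (a : C) : normc a <= 1 -> 1 - t%:C * a != 0.
  move=> a1; rewrite subr_eq0; apply: contraTneq (lexx (1 : R)) => E.
  rewrite -ltNge -[ltLHS](normc1 R) E normcM.
  by apply: le_lt_trans nt; rewrite ler_piMr ?normc_ge0.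
have s1 : 1 - t%:C != 0 by have := @d0 1; rewrite mulr1; apply; rewrite normc1.
have s2 : 1 + t%:C != 0 by have := @d0 (-1); rewrite mulrN1 opprK; apply; rewrite normcN normc1.
pose G w := (phi w - t%:C) / (1 - t%:C * phi w).
have HG : sdiff G zeta (L * ((1 + t%:C) / (1 - t%:C))).
  have K1 := sdiffD HL (@sdiff_cst R (- t%:C) zeta).
  have K2 := sdiffD (@sdiff_cst R 1 zeta) (sdiffM (@sdiff_cst R (- t%:C) zeta) HL).
  have n2 : 1 + - t%:C * phi zeta != 0 by rewrite phi1 mulr1.
  have := sdiffM K1 (sdiff_comp K2 (sdiff_inv n2)).
  rewrite /comp phi1; set D := (X in sdiff _ _ X -> _) => H.
  have -> : L * ((1 + t%:C) / (1 - t%:C)) = D by rewrite /D; field; rewrite s1.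
  by apply: sdiff_near ltr01 _ H => w _; rewrite /G mulNr.
have := @schwarz_rigidity G zeta _ nz _ HG => /(_ _ _ _ _ _ z z1) H.
have : G z = zeta^-1 * z.
  apply: H.
  - move=> w w1; apply: sdM; first exact: sdB (sphi _ w1) (sd_cst _ _).
    apply: sdV; first by apply: d0; exact: bphi.
    by apply: sdB; [exact: sd_cst|apply: sdM; [exact: sd_cst|exact: sphi]].
  - move=> w w1; rewrite normcM normcV ler_pdivrMr ?normc_gt0 ?d0 ?bphi // mul1r.
    have tJ : (t%:C)^* = t%:C :> C by rewrite /= oppr0.
    apply: le_trans (@normc_moebius (phi w) t%:C (bphi _ w1) (ltW nt)) _.
    by rewrite le_eqVlt; apply/orP; left; apply/eqP; congr (normc (1 - _ * _)); exact: tJ.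
  - by rewrite /G phi0 subrr mul0r.
  - by rewrite /G phi1 mulr1 divff.
  - rewrite mulrA lam rmorphM rmorphV ?unitfE; last by rewrite gt_eqF //; lra.
    by rewrite rmorphB rmorphD rmorph1; field; rewrite s1.
rewrite /G => E.
have dz := d0 _ (bphi _ z1).
have E' : phi z - t%:C = zeta^-1 * z * (1 - t%:C * phi z) by rewrite -E; field.
have nn : 1 + t%:C * (zeta^-1 * z) != 0.
  have := @d0 (- (zeta^-1 * z)); rewrite mulrN opprK; apply.
  by rewrite normcN normcM normcV nz invr1 mul1r ltW.
apply: (mulIf nn); rewrite mulfVK //.
move: E'; set s := zeta^-1 * z => /eqP; rewrite subr_eq => /eqP E'.
by rewrite mulrDr mulr1 {1}E'; ring.
Qed.

End BoundaryPoint.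

(** * Octonions and Hermitian products *)

Lemma oct_eq (R : realType) (u v : octonion R) :
  u.1.1.1 = v.1.1.1 -> u.1.1.2 = v.1.1.2 -> u.1.2.1 = v.1.2.1 -> u.1.2.2 = v.1.2.2 ->
  u.2.1.1 = v.2.1.1 -> u.2.1.2 = v.2.1.2 -> u.2.2.1 = v.2.2.1 -> u.2.2.2 = v.2.2.2 ->
  u = v.
Proof.
case: u => [[[? ?] [? ?]] [[? ?] [? ?]]]; case: v => [[[? ?] [? ?]] [[? ?] [? ?]]] /=.
by do 8! move=> ->.
Qed.

Ltac oct_ring := apply: oct_eq => /=; rewrite /GRing.scale /=; ring.

Section OctonionAlgebra.
Variable R : realType.
Local Notation C := R[i].
Local Notation O := (octonion R).
Implicit Types (u v w I J : O) (a b : R).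


Lemma omulDl u v w : (u + v) ** w = u ** w + v ** w. Proof. by oct_ring. Qed.
Lemma omulDr u v w : u ** (v + w) = u ** v + u ** w. Proof. by oct_ring. Qed.
Lemma omulNl u v : (- u) ** v = - (u ** v). Proof. by oct_ring. Qed.
Lemma omulNr u v : u ** (- v) = - (u ** v). Proof. by oct_ring. Qed.
Lemma omulBl u v w : (u - v) ** w = u ** w - v ** w. Proof. by rewrite omulDl omulNl. Qed.
Lemma omulBr u v w : u ** (v - w) = u ** v - u ** w. Proof. by rewrite omulDr omulNr. Qed.
Lemma omulZl a u v : (a *: u) ** v = a *: (u ** v). Proof. by oct_ring. Qed.
Lemma omulZr a u v : u ** (a *: v) = a *: (u ** v). Proof. by oct_ring. Qed.
Lemma omul0l u : 0 ** u = 0. Proof. by oct_ring. Qed.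
Lemma omul0r u : u ** 0 = 0. Proof. by oct_ring. Qed.
Lemma oreal_mull a u : oreal a ** u = a *: u. Proof. by oct_ring. Qed.
Lemma oreal_mulr a u : u ** oreal a = a *: u. Proof. by oct_ring. Qed.
Lemma oconjK u : oconj (oconj u) = u. Proof. by oct_ring. Qed.
Lemma oconjD u v : oconj (u + v) = oconj u + oconj v. Proof. by oct_ring. Qed.
Lemma oconjN u : oconj (- u) = - oconj u. Proof. by oct_ring. Qed.
Lemma oconjZ a u : oconj (a *: u) = a *: oconj u. Proof. by oct_ring. Qed.
Lemma oconjM u v : oconj (u ** v) = oconj v ** oconj u. Proof. by oct_ring. Qed.
Lemma oconj_real a : oconj (oreal a) = oreal a. Proof. by oct_ring. Qed.
Lemma orealD a b : oreal (a + b) = oreal a + oreal b. Proof. by oct_ring. Qed.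
Lemma orealB a b : oreal (a - b) = oreal a - oreal b. Proof. by oct_ring. Qed.
Lemma orealM a b : oreal (a * b) = oreal a ** oreal b. Proof. by oct_ring. Qed.
Lemma oreal_scale a : oreal a = a *: oreal 1. Proof. by oct_ring. Qed.
Lemma oreal0 : oreal 0 = 0 :> O. Proof. by oct_ring. Qed.

Lemma oinnerE u v : oinner u v =
  u.1.1.1 * v.1.1.1 + u.1.1.2 * v.1.1.2 + u.1.2.1 * v.1.2.1 + u.1.2.2 * v.1.2.2
  + u.2.1.1 * v.2.1.1 + u.2.1.2 * v.2.1.2 + u.2.2.1 * v.2.2.1 + u.2.2.2 * v.2.2.2.
Proof. by rewrite /oinner /oRe /=; ring. Qed.

Lemma oinnerC u v : oinner u v = oinner v u. Proof. by rewrite !oinnerE; ring. Qed.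
Lemma oinnerDl u v w : oinner (u + v) w = oinner u w + oinner v w.
Proof. by rewrite !oinnerE /=; ring. Qed.
Lemma oinnerNl u w : oinner (- u) w = - oinner u w.
Proof. by rewrite !oinnerE /=; ring. Qed.
Lemma oinnerBl u v w : oinner (u - v) w = oinner u w - oinner v w.
Proof. by rewrite oinnerDl oinnerNl. Qed.
Lemma oinnerZl a u w : oinner (a *: u) w = a * oinner u w.
Proof. by rewrite !oinnerE /= /GRing.scale /=; ring. Qed.
Lemma oinnerDr u v w : oinner w (u + v) = oinner w u + oinner w v.
Proof. by rewrite oinnerC oinnerDl !(oinnerC w). Qed.
Lemma oinnerNr u w : oinner w (- u) = - oinner w u.
Proof. by rewrite oinnerC oinnerNl (oinnerC w). Qed.
Lemma oinnerBr u v w : oinner w (u - v) = oinner w u - oinner w v.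
Proof. by rewrite oinnerDr oinnerNr. Qed.
Lemma oinnerZr a u w : oinner w (a *: u) = a * oinner w u.
Proof. by rewrite oinnerC oinnerZl (oinnerC w). Qed.
Lemma oinner0l u : oinner 0 u = 0. Proof. by rewrite -(scale0r 0) oinnerZl mul0r. Qed.
Lemma oinner_adjl u v w : oinner (u ** v) w = oinner v (oconj u ** w).
Proof. by rewrite !oinnerE /=; ring. Qed.
Lemma oinner_adjr u v w : oinner (u ** v) w = oinner u (w ** oconj v).
Proof. by rewrite !oinnerE /=; ring. Qed.
Lemma oinner_mul u v w : oinner (u ** v) (u ** w) = oinner u u * oinner v w.
Proof. by rewrite !oinnerE /=; ring. Qed.
Lemma oinner_realr u a : oinner u (oreal a) = a * oRe u.
Proof. by rewrite !oinnerE /oRe /=; ring. Qed.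

Lemma oinner_sqr u : oinner u u = onorm u ^+ 2.
Proof. by rewrite onorm_sqr oinnerE; ring. Qed.

Lemma onorm_ge0 u : 0 <= onorm u. Proof. exact: sqrtr_ge0. Qed.

Lemma onormE u : onorm u = Num.sqrt (oinner u u). Proof. by []. Qed.

Lemma onormM u v : onorm (u ** v) = onorm u * onorm v.
Proof.
apply/eqP; rewrite -(eqrXn2 (n := 2)) ?mulr_ge0 ?onorm_ge0 //.
by rewrite -oinner_sqr oinner_mul exprMn !oinner_sqr.
Qed.

Lemma onorm_conj u : onorm (oconj u) = onorm u.
Proof. by rewrite !onormE; congr Num.sqrt; rewrite !oinnerE /=; ring. Qed.

Lemma onorm_real a : onorm (oreal a : O) = `|a|.
Proof. by rewrite onormE oinnerE /= !mulr0 !addr0 -expr2 sqrtr_sqr. Qed.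

Lemma onormZ a u : onorm (a *: u) = `|a| * onorm u.
Proof. by rewrite -oreal_mull onormM onorm_real. Qed.

Lemma onorm0 : onorm (0 : O) = 0. Proof. by rewrite -oreal0 onorm_real normr0. Qed.

Lemma oconj_mul_norm u v : oconj u ** (u ** v) = onorm u ^+ 2 *: v.
Proof. by rewrite onorm_sqr; oct_ring. Qed.

Lemma omul_conj_norm u : u ** oconj u = oreal (onorm u ^+ 2).
Proof. by rewrite onorm_sqr; oct_ring. Qed.

Lemma oconjE u : oconj u = 2 * oRe u *: oreal 1 - u. Proof. by oct_ring. Qed.

(** Since [u] and [oconj u] differ by a real and a sign, left alternativity is equivalent to
    [oconj_mul_norm]. *)
Lemma omul_altl u v : u ** (u ** v) = (u ** u) ** v.
Proof.
have E : u = (2 * oRe u) *: oreal 1 - oconj u by rewrite oconjE subKr.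
have H : u ** (u ** v) = (2 * oRe u *: oreal 1 - oconj u) ** (u ** v) by rewrite -E.
have K : u ** u = u ** (2 * oRe u *: oreal 1 - oconj u) by rewrite -E.
rewrite H K omulBl oconj_mul_norm omulBr omulZr oreal_mulr scale1r omulZl.
rewrite oreal_mull scale1r.
have -> : u ** oconj u = (onorm u ^+ 2) *: oreal 1 by rewrite omul_conj_norm oreal_scale.
by rewrite omulBl !omulZl oreal_mull scale1r.
Qed.

Lemma omul_altr u v : (v ** u) ** u = v ** (u ** u).
Proof.
by apply: (can_inj oconjK); rewrite !oconjM omul_altl.
Qed.

Lemma omul_flex u v : (u ** v) ** u = u ** (v ** u).
Proof.
have := omul_altl (u + v) u; rewrite !omulDl !omulDr !omulDl omul_altr (omul_altl v u).
rewrite !addrA => /addIr; rewrite -!addrA => /addrI.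
by rewrite -omul_altr => /addIr.
Qed.

End OctonionAlgebra.

Section OctonionIdentities.
Variable R : realType.
Local Notation C := R[i].
Local Notation O := (octonion R).
Implicit Types (u v w I J : O).

(** Polarization of left alternativity: expand it at [u + v]. The next lemma polarizes right
    alternativity. *)
Lemma oassoc_swapl u v w : oassoc u v w = - oassoc v u w.
Proof.
have := omul_altl (u + v) w; rewrite !omulDl !omulDr !omulDl !omul_altl /oassoc.
move: ((u ** u) ** w) ((v ** v) ** w) ((u ** v) ** w) ((v ** u) ** w).
move: (u ** (v ** w)) (v ** (u ** w)) => a b c d x y H.
by apply/eqP; rewrite -subr_eq0 opprK; move/eqP: H; rewrite -subr_eq0 => /eqP H; apply/eqP; rewrite -oppr0 -H; oct_ring.
Qed.

Lemma oassoc_swapr u v w : oassoc u v w = - oassoc u w v.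
Proof.
have := omul_altr (v + w) u; rewrite !omulDr !omulDl !omulDr !omul_altr /oassoc.
move: (u ** (v ** v)) (u ** (w ** w)) ((u ** v) ** w) ((u ** w) ** v).
move: (u ** (v ** w)) (u ** (w ** v)) => a b c d x y H.
by apply/eqP; rewrite -subr_eq0 opprK; move/eqP: H; rewrite -subr_eq0 => /eqP H; apply/eqP; rewrite -H; oct_ring.
Qed.

(* [oassoc] is alternating, and conjugating an argument changes its sign. *)
Lemma oassoc_conj u v w : oassoc u v w = v ** (oconj w ** u) - (v ** oconj w) ** u.
Proof.
rewrite oassoc_swapl oassoc_swapr opprK /oassoc oconjE.
set e : O := 2 * oRe w *: oreal 1.
have eE : e = oreal (2 * oRe w) by rewrite [RHS]oreal_scale.
have H1 : (e - w) ** u = 2 * oRe w *: u - w ** u by rewrite omulBl eE oreal_mull.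
have H2 : v ** (e - w) = 2 * oRe w *: v - v ** w by rewrite omulBr eE oreal_mulr.
rewrite H1 H2 omulBr omulBl omulZr omulZl.
move: ((v ** w) ** u) (v ** (w ** u)) (v ** u) => x y t.
by oct_ring.
Qed.

Lemma omul_anticomm u v :
  u ** v + v ** u = 2 * oRe u *: v + 2 * oRe v *: u - oreal (2 * oinner u v).
Proof. by rewrite oinnerE; oct_ring. Qed.

(** The norms are sup norms, and the inner product is a sum of eight products of coordinates. *)
Lemma oinner_norm_le u v : `|oinner u v| <= 8 * `|v| * `|u|.
Proof.
have nE (x : O) : `|x| = Num.max (Num.max (Num.max `|x.1.1.1| `|x.1.1.2|) (Num.max `|x.1.2.1| `|x.1.2.2|))
   (Num.max (Num.max `|x.2.1.1| `|x.2.1.2|) (Num.max `|x.2.2.1| `|x.2.2.2|)).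
  by rewrite prod_normE /= !prod_normE.
have le (x : O) : [/\ `|x.1.1.1| <= `|x|, `|x.1.1.2| <= `|x|, `|x.1.2.1| <= `|x| & `|x.1.2.2| <= `|x|]
   /\ [/\ `|x.2.1.1| <= `|x|, `|x.2.1.2| <= `|x|, `|x.2.2.1| <= `|x| & `|x.2.2.2| <= `|x|].
  by rewrite nE !le_max !lexx ?orbT.
have M (x y : R) : `|x| <= `|u| -> `|y| <= `|v| -> `|x * y| <= `|v| * `|u|.
  by move=> H1 H2; rewrite normrM mulrC; apply: ler_pM.
have [[u1 u2 u3 u4] [u5 u6 u7 u8]] := le u; have [[v1 v2 v3 v4] [v5 v6 v7 v8]] := le v.
rewrite oinnerE.
rewrite (_ : 8 * `|v| * `|u| = `|v| * `|u| + `|v| * `|u| + `|v| * `|u| + `|v| * `|u|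
  + `|v| * `|u| + `|v| * `|u| + `|v| * `|u| + `|v| * `|u|); last by ring.
by do 7! (apply: le_trans (ler_normD _ _) _; apply: lerD; last exact: M); exact: M.
Qed.

End OctonionIdentities.

(** * Imaginary units, slices and the Hermitian product *)

Section HermitianProduct.
Variable R : realType.
Local Notation C := R[i].
Local Notation O := (octonion R).
Implicit Types (u v w I J : O) (a b : R).

Lemma oinner_CS u v : `|oinner u v| <= onorm u * onorm v.
Proof.
rewrite -ler_sqr ?nnegrE ?mulr_ge0 ?onorm_ge0 // exprMn real_normK ?num_real //.
have [v0|v0] := eqVneq (onorm v) 0.
  by rewrite (onorm_eq0 v0) oinnerC oinner0l onorm0 expr0n /= mulr0.
have := sqr_ge0 (onorm (onorm v ^+ 2 *: u - oinner u v *: v)).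
rewrite -(oinner_sqr (_ - _)) !(oinnerBl, oinnerBr, oinnerZl, oinnerZr) (oinnerC v u) !oinner_sqr.
rewrite [X in 0 <= X](_ : _ = onorm v ^+ 2 * (onorm u ^+ 2 * onorm v ^+ 2 - oinner u v ^+ 2)); last by ring.
by rewrite pmulr_rge0 ?subr_ge0 // exprn_gt0 // lt_def v0 onorm_ge0.
Qed.

Lemma osqrE u : u ** u = 2 * oRe u *: u - oreal (onorm u ^+ 2).
Proof. by rewrite onorm_sqr; oct_ring. Qed.

(** The quadratic equation of [I] reads [2 Re I * I = |I| ^ 2 - 1]; a nonzero real part would make
    [I] real, with square -1. *)
Lemma imag_unitP I : imag_units I -> oRe I = 0 /\ onorm I = 1.
Proof.
move=> /= H.
have H1 : oRe (I ** I) = -1 by rewrite H.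
have H2 : 2 * oRe I *: I - oreal (onorm I ^+ 2) = oreal (-1) by rewrite -H osqrE.
have r0 : oRe I = 0.
  apply/eqP; rewrite -[_ == _]negbK; apply/negP => r0.
  have r20 : 2 * oRe I != 0 by rewrite mulf_neq0.
  have E : 2 * oRe I *: I = oreal (onorm I ^+ 2 - 1).
    by move/eqP: H2; rewrite subr_eq => /eqP ->; rewrite addrC orealB; congr (_ + _); oct_ring.
  have {}E : I = oreal ((2 * oRe I)^-1 * (onorm I ^+ 2 - 1)).
    by rewrite oreal_scale -scalerA -oreal_scale -E scalerA mulVf // scale1r.
  move: H1; rewrite E -orealM /oRe /= => H1.
  by have := sqr_ge0 ((2 * oRe I)^-1 * (onorm I ^+ 2 - 1)); rewrite expr2 H1; lra.
split=> //; apply/eqP; rewrite -(eqrXn2 (n := 2)) ?onorm_ge0 // expr1n; apply/eqP.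
have : oRe (2 * oRe I *: I - oreal (onorm I ^+ 2)) = -1 by rewrite H2.
by rewrite r0 mulr0 scale0r sub0r /oRe /= => H3; lra.
Qed.

Lemma imag_unitI I : oRe I = 0 -> onorm I = 1 -> imag_units I.
Proof.
by move=> r0 n1; rewrite /imag_units /= osqrE r0 n1 mulr0 scale0r expr1n; oct_ring.
Qed.

Lemma imag_unitN I : imag_units I -> imag_units (- I).
Proof. by rewrite /imag_units /= omulNl omulNr opprK. Qed.

Lemma oconj_imag I : oRe I = 0 -> oconj I = - I.
Proof.
move=> r0; apply/eqP; rewrite -subr_eq0 opprK; apply/eqP.
by transitivity (2 * oRe I *: oreal 1 : O); [oct_ring | rewrite r0 mulr0 scale0r].
Qed.

Lemma imag_mulK I u : imag_units I -> I ** (I ** u) = - u.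
Proof. by move=> /= H; rewrite omul_altl H oreal_mull scaleN1r. Qed.

Lemma slice0 I x : slice I (x, 0) = oreal x.
Proof. by rewrite /slice scale0r addr0. Qed.

Lemma sliceE I p : slice I p = oreal p.1 + p.2 *: I.
Proof. by []. Qed.

Lemma sliceN I p : slice (- I) p = slice I (p.1, - p.2).
Proof. by rewrite /slice /= scalerN scaleNr. Qed.

Lemma slice_mul I p u : slice I p ** u = p.1 *: u + p.2 *: (I ** u).
Proof. by rewrite /slice omulDl oreal_mull omulZl. Qed.

Lemma slice_add I p q : slice I p + slice I q = slice I (p + q).
Proof. by rewrite /slice /= orealD scalerDl addrACA. Qed.

Lemma slice_sub I p q : slice I p - slice I q = slice I (p - q).
Proof. by rewrite /slice /= orealB scalerBl opprD addrACA. Qed.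

Lemma slice_scale I a p : a *: slice I p = slice I (a *: p).
Proof. by rewrite /slice /= /GRing.scale /= -/(GRing.scale _ _); oct_ring. Qed.

Lemma onorm_slice I p : imag_units I -> onorm (slice I p) = normc (cpx p).
Proof.
move=> /imag_unitP[I0 I1].
apply/eqP; rewrite -(eqrXn2 (n := 2)) ?onorm_ge0 ?normc_ge0 // normc_sqr /=; apply/eqP.
rewrite -oinner_sqr /slice !(oinnerDl, oinnerDr, oinnerZl, oinnerZr).
rewrite (oinnerC (oreal _) I) !oinner_realr I0 oinner_sqr I1 /oRe /=; ring.
Qed.

Lemma oconj_slice I p : imag_units I -> oconj (slice I p) = slice I (p.1, - p.2).
Proof.
move=> /imag_unitP[I0 _]; rewrite /slice oconjD oconj_real oconjZ oconj_imag //=.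
by rewrite scalerN scaleNr.
Qed.

(* The Hermitian product of [O] as a left vector space over [C_I], linear in [u];
   it makes [f_I] holomorphic if and only if all the [hprod I (f_I z) v] are. *)
Definition hprod I u v : C := oinner u v +i* oinner u (I ** v).

Lemma hprodDl I u v w : hprod I (u + v) w = hprod I u w + hprod I v w.
Proof. by rewrite /hprod !oinnerDl. Qed.

Lemma hprodNl I u w : hprod I (- u) w = - hprod I u w.
Proof. by rewrite /hprod !oinnerNl. Qed.

Lemma hprodBl I u v w : hprod I (u - v) w = hprod I u w - hprod I v w.
Proof. by rewrite hprodDl hprodNl. Qed.

Lemma hprod0l I w : hprod I 0 w = 0.
Proof. by rewrite /hprod !oinner0l. Qed.

Lemma hprodZl I a u w : hprod I (a *: u) w = a%:C * hprod I u w.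
Proof. by rewrite /hprod !oinnerZl /=; apply/eqP; rewrite eq_complex /=; apply/andP; split; apply/eqP; ring. Qed.

Lemma hprodDr I u v w : hprod I u (v + w) = hprod I u v + hprod I u w.
Proof. by rewrite /hprod omulDr !oinnerDr. Qed.

Lemma hprodZr I a u w : hprod I u (a *: w) = a%:C * hprod I u w.
Proof. by rewrite /hprod omulZr !oinnerZr /=; apply/eqP; rewrite eq_complex /=; apply/andP; split; apply/eqP; ring. Qed.

Lemma hprod_imagl I u v : imag_units I -> hprod I (I ** u) v = 0 +i* 1 * hprod I u v.
Proof.
move=> II; have [I0 I1] := imag_unitP II; rewrite /hprod oinner_mul oinner_sqr I1.
rewrite oinner_adjl oconj_imag // omulNl oinnerNr.
by apply/eqP; rewrite eq_complex /=; apply/andP; split; apply/eqP; ring.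
Qed.

Lemma hprod_slice I p u v : imag_units I ->
  hprod I (slice I p ** u) v = cpx p * hprod I u v.
Proof.
move=> II; rewrite slice_mul hprodDl !hprodZl hprod_imagl //.
by case: (hprod I u v) => a b; apply/eqP; rewrite eq_complex /=; apply/andP; split; apply/eqP; ring.
Qed.

Lemma hprod_conj I u v : imag_units I -> hprod I v u = (hprod I u v)^*.
Proof.
move=> /imag_unitP[I0 I1]; rewrite /hprod /= oinnerC; congr (_ +i* _).
by rewrite oinnerC oinner_adjl oconj_imag // omulNl oinnerNr.
Qed.

Lemma hprodxx I u : imag_units I -> hprod I u u = (onorm u ^+ 2)%:C.
Proof.
move=> II; have := hprod_conj u u II; rewrite /hprod oinner_sqr /= => -[H].
by congr (_ +i* _); lra.
Qed.

Lemma hprod_CS I u v : imag_units I -> normc (hprod I u v) <= onorm u * onorm v.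
Proof.
move=> II; have [n0|n0] := eqVneq (hprod I u v) 0.
  by rewrite n0 normc0 mulr_ge0 ?onorm_ge0.
have np : 0 < normc (hprod I u v) by rewrite normc_gt0.
rewrite -(ler_pM2l np) -expr2.
(* Multiplying [u] by the conjugate of [hprod I u v] turns the product with [v] into
   [|hprod I u v| ^ 2], to which the real Cauchy-Schwarz inequality applies. *)
set p := (complex.Re (hprod I u v), - complex.Im (hprod I u v)).
have : oinner (slice I p ** u) v = normc (hprod I u v) ^+ 2.
  transitivity (complex.Re (hprod I (slice I p ** u) v)) => //.
  by rewrite hprod_slice // normc_sqr /p; case: (hprod I u v) => a b /=; ring.
move=> <-; apply: le_trans (ler_norm _) _; apply: le_trans (oinner_CS _ _) _.
have <- : normc (cpx p) = normc (hprod I u v).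
  by rewrite /p /cpx -[RHS]normc_conj; case: (hprod I u v).
by rewrite onormM onorm_slice // mulrA.
Qed.

Lemma hprod_inj I u : imag_units I -> (forall v, hprod I u v = 0) -> u = 0.
Proof.
move=> II /(_ u); rewrite hprodxx // => -[/eqP]; rewrite sqrf_eq0 => /eqP.
exact: onorm_eq0.
Qed.

End HermitianProduct.

(** * Slice regularity, stems and quotients *)

Section SliceDifferentiability.
Variable R : realType.
Local Notation C := R[i].
Local Notation O := (octonion R).
Implicit Types (u v w I J : O) (a b : R) (p q : R * R) (F : R * R -> O).

Definition rip (z : C) : R * R := (complex.Re z, complex.Im z).

Lemma ripK z : cpx (rip z) = z. Proof. by case: z. Qed.
Lemma cpxK p : rip (cpx p) = p. Proof. by case: p. Qed.

(** Strict differentiability on the slice [C_J], tested weakly: a single octonion [D] must represent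
    the derivatives of all the scalar components. *)
Definition vdiff J F p (D : O) := forall v,
  sdiff (fun z => hprod J (F (rip z)) v) (cpx p) (hprod J D v).

Lemma is_derive_cvg (V W : normedModType R) (f : V -> W) (a v : V) (l : W) :
  h^-1 *: (f (h *: v + a) - f a) @[h --> (0:R)^'] --> l -> is_derive a v f l.
Proof.
move=> H; apply: DeriveDef; last exact: cvg_lim H.
by rewrite /derivable; apply/cvg_ex; exists l.
Qed.

Lemma cvg_is_derive (V W : normedModType R) (f : V -> W) (a v : V) (l : W) :
  is_derive a v f l -> h^-1 *: (f (h *: v + a) - f a) @[h --> (0:R)^'] --> l.
Proof. by move=> [H <-]; exact: H. Qed.

Lemma oinner_norm v : exists2 K : R, 0 <= K & forall u, `|oinner u v| <= K * `|u|.
Proof.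
by exists (8 * `|v|) => [|u]; [rewrite mulr_ge0|exact: oinner_norm_le].
Qed.

Lemma oinner_cvg (T : Type) (G : set_system T) (g : T -> O) (l : O) v : Filter G ->
  g @ G --> l -> (fun x => oinner (g x) v) @ G --> oinner l v.
Proof.
move=> FG H; have [K K0 HK] := oinner_norm v.
have K1 : 0 < K + 1 by lra.
apply/cvgrPdist_le => e e0.
have /cvgrPdist_le /(_ (e / (K + 1))) := H; rewrite divr_gt0 // => /(_ isT).
apply: filterS => x Hx; rewrite -oinnerBl; apply: le_trans (HK _) _.
apply: le_trans (ler_wpM2l K0 Hx) _.
rewrite mulrCA ger_pMr // ler_pdivrMr // mul1r; lra.
Qed.

Definition coord_vec (i : 'I_8) : O :=
  let d k : R := (i == k :> nat)%:R in
  (((d 0%N, d 1%N), (d 2%N, d 3%N)), ((d 4%N, d 5%N), (d 6%N, d 7%N))).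

Lemma cvg_prod (V W : normedModType R) (T : Type) (G : set_system T) (f : T -> V)
    (g : T -> W) (a : V) (b : W) : Filter G ->
  f @ G --> a -> g @ G --> b -> (fun x => (f x, g x)) @ G --> ((a, b) : (V * W)%type).
Proof. by move=> FG Hf Hg; exact: cvg_pair. Qed.

Lemma oct_cvg (T : Type) (G : set_system T) (g : T -> O) (l : O) : Filter G ->
  (forall v, (fun x => oinner (g x) v) @ G --> oinner l v) -> g @ G --> l.
Proof.
move=> FG H.
have c i := H (coord_vec i).
have E (j : O -> R) i : (forall u, j u = oinner u (coord_vec i)) -> (fun x => j (g x)) @ G --> j l.
  move=> ij; rewrite ij (_ : (fun x => j (g x)) = (fun x => oinner (g x) (coord_vec i))).
    exact: c.
  by apply/funext => x; exact: ij.
have E1 := @E (fun u => u.1.1.1) (inord 0). have E2 := @E (fun u => u.1.1.2) (inord 1).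
have E3 := @E (fun u => u.1.2.1) (inord 2). have E4 := @E (fun u => u.1.2.2) (inord 3).
have E5 := @E (fun u => u.2.1.1) (inord 4). have E6 := @E (fun u => u.2.1.2) (inord 5).
have E7 := @E (fun u => u.2.2.1) (inord 6). have E8 := @E (fun u => u.2.2.2) (inord 7).
have gE : g = fun x => ((((g x).1.1.1, (g x).1.1.2), ((g x).1.2.1, (g x).1.2.2)),
     (((g x).2.1.1, (g x).2.1.2), ((g x).2.2.1, (g x).2.2.2))).
  by apply/funext => x; case: (g x) => [[[? ?] [? ?]] [[? ?] [? ?]]].
have lE : l = (((l.1.1.1, l.1.1.2), (l.1.2.1, l.1.2.2)), ((l.2.1.1, l.2.1.2), (l.2.2.1, l.2.2.2))).
  by case: (l) => [[[? ?] [? ?]] [[? ?] [? ?]]].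
rewrite gE lE.
apply: (@cvg_prod (quat R) (quat R)); apply: (@cvg_prod (cplx R) (cplx R));
  apply: (@cvg_prod R R);
  [apply: E1 | apply: E2 | apply: E3 | apply: E4 | apply: E5 | apply: E6 | apply: E7 | apply: E8];
  by move=> u; rewrite oinnerE /coord_vec !inordK //= ?mulr1 ?mulr0 ?addr0 ?add0r.
Qed.

End SliceDifferentiability.

(** * Continuous partial derivatives versus strict complex differentiability *)

Section SliceRegularity.
Variable R : realType.
Local Notation C := R[i].
Local Notation O := (octonion R).
Implicit Types (u v w I J : O) (a b : R) (p q : R * R) (F : R * R -> O).

Lemma increment_bound (k k' : R -> R) (x y L e : R) :
  (forall t, x <= t <= y \/ y <= t <= x -> is_derive t 1 k (k' t)) ->
  (forall t, x <= t <= y \/ y <= t <= x -> `|k' t - L| <= e) ->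
  `|k y - k x - L * (y - x)| <= e * `|y - x|.
Proof.
have main (x' y' : R) : x' < y' -> (forall t, x' <= t <= y' -> is_derive t 1 k (k' t)) ->
    (forall t, x' <= t <= y' -> `|k' t - L| <= e) ->
    `|k y' - k x' - L * (y' - x')| <= e * `|y' - x'|.
  move=> xy dk bk; have [|||c cxy ->] := @MVT R k k' x' y'.
  - exact: xy.
  - by move=> t /[!in_itv] /= /andP[t1 t2]; apply: dk; rewrite !ltW.
  - apply: derivable_within_continuous => t /[!in_itv] /= tI.
    by have [] := dk _ tI.
  rewrite -mulrBl normrM ler_wpM2r //; apply: bk.
  by move: cxy; rewrite in_itv /= => /andP[? ?]; rewrite !ltW.
move=> dk bk; have [xy|] := ltP x y.
  by apply: main => // t tI; [apply: dk | apply: bk]; left.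
rewrite le_eqVlt => /predU1P[->|yx].
  by rewrite !subrr mulr0 subr0 normr0 mulr0.
have -> : `|k y - k x - L * (y - x)| = `|k x - k y - L * (x - y)|.
  by rewrite -normrN; congr `|_|; ring.
by rewrite (distrC y x); apply: main => // t tI; [apply: dk | apply: bk]; right.
Qed.

Lemma is_derive_x F v x y (D : O) : is_derive (x, y) ((1, 0) : R * R) F D ->
  is_derive x 1 (fun t => oinner (F (t, y)) v) (oinner D v).
Proof.
move=> /cvg_is_derive /(@oinner_cvg _ _ _ _ _ v) H; apply: is_derive_cvg.
move: H; apply: cvg_trans; apply: near_eq_cvg; near=> h.
have E : h *: ((1, 0) : R * R) + (x, y) = (h *: 1 + x, y).
  by apply/pair_equal_spec; rewrite /= /GRing.scale /= mulr0 add0r.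
by rewrite E oinnerZl oinnerBl.
Unshelve. all: by end_near. Qed.

Lemma is_derive_y F v x y (D : O) : is_derive (x, y) ((0, 1) : R * R) F D ->
  is_derive y 1 (fun t => oinner (F (x, t)) v) (oinner D v).
Proof.
move=> /cvg_is_derive /(@oinner_cvg _ _ _ _ _ v) H; apply: is_derive_cvg.
move: H; apply: cvg_trans; apply: near_eq_cvg; near=> h.
have E : h *: ((0, 1) : R * R) + (x, y) = (x, h *: 1 + y).
  by apply/pair_equal_spec; rewrite /= /GRing.scale /= mulr0 add0r.
by rewrite E oinnerZl oinnerBl.
Unshelve. all: by end_near. Qed.

Lemma dist_pair (p q : R * R) : `|p - q| = Num.max `|p.1 - q.1| `|p.2 - q.2|.
Proof. by rewrite prod_normE. Qed.

(** The increment is taken along two sides of a rectangle, each estimated by the mean value theorem.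
    Balls of [R * R] are squares, so the rectangle stays inside the neighbourhood. *)
Lemma real_increment F (Dx Dy : R * R -> O) p v e : 0 < e ->
  nbhs p [set q | is_derive q ((1, 0) : R * R) F (Dx q) /\ is_derive q ((0, 1) : R * R) F (Dy q)] ->
  {for p, continuous Dx} -> {for p, continuous Dy} ->
  exists2 d, 0 < d & forall q q', `|q - p| < d -> `|q' - p| < d ->
    `|oinner (F q' - F q) v - (q'.1 - q.1) * oinner (Dx p) v - (q'.2 - q.2) * oinner (Dy p) v|
      <= e * (`|q'.1 - q.1| + `|q'.2 - q.2|).
Proof.
move=> e0 /nbhs_distP[d1 d10 H1] cx cy.
have near (D : R * R -> O) : {for p, continuous D} ->
    exists2 d, 0 < d & forall q, `|q - p| < d -> `|oinner (D q) v - oinner (D p) v| <= e.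
  move=> cD.
  have /cvgrPdist_le /(_ _ e0) : oinner (D q) v @[q --> p] --> oinner (D p) v.
    by apply: oinner_cvg; exact: cD.
  move=> /nbhs_distP[d d0 Hd]; exists d => // q /Hd /=; by rewrite distrC.
have [d2 d20 H2] := near _ cx; have [d3 d30 H3] := near _ cy.
exists (Num.min d1 (Num.min d2 d3)); first by rewrite !lt_min d10 d20 d30.
move=> [x y] [x' y'] qd qd'.
have box t s : (x <= t <= x' \/ x' <= t <= x) -> (y <= s <= y' \/ y' <= s <= y) ->
    `|(t, s) - p| < Num.min d1 (Num.min d2 d3).
  move: qd qd'; rewrite !dist_pair !gt_max /= !ltr_norml.
  set d := Num.min _ _ => /andP[/andP[? ?] /andP[? ?]] /andP[/andP[? ?] /andP[? ?]].
  by move=> [] /andP[? ?] [] /andP[? ?]; apply/andP; split; apply/andP; split; lra.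
have yy : y <= y <= y' \/ y' <= y <= y by rewrite !lexx; case: leP => ?; [left | right; rewrite ltW].
have xx' : x <= x' <= x' \/ x' <= x' <= x.
  by rewrite !lexx; case: (leP x x') => ?; [left | right; rewrite ltW].
have xx : x <= x <= x' \/ x' <= x <= x by rewrite !lexx; case: leP => ?; [left | right; rewrite ltW].
have yy' : y <= y' <= y' \/ y' <= y' <= y.
  by rewrite !lexx; case: (leP y y') => ?; [left | right; rewrite ltW].
have A : `|oinner (F (x', y')) v - oinner (F (x, y')) v - oinner (Dx p) v * (x' - x)| <= e * `|x' - x|.
  apply: (increment_bound (k := fun t => oinner (F (t, y')) v) (k' := fun t => oinner (Dx (t, y')) v)) => t tI.
    have := box t y' tI yy'; rewrite !lt_min => /andP[/H1[Hx _] _].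
    exact: is_derive_x.
  by have := box t y' tI yy'; rewrite !lt_min => /and3P[_ /H2].
have B : `|oinner (F (x, y')) v - oinner (F (x, y)) v - oinner (Dy p) v * (y' - y)| <= e * `|y' - y|.
  apply: (increment_bound (k := fun t => oinner (F (x, t)) v) (k' := fun t => oinner (Dy (x, t)) v)) => t tI.
    have := box x t xx tI; rewrite !lt_min => /andP[/H1[_ Hy] _].
    exact: is_derive_y.
  by have := box x t xx tI; rewrite !lt_min => /and3P[_ _ /H3].
have := le_trans (ler_normD _ _) (lerD A B); rewrite -mulrDr; apply: le_trans.
rewrite oinnerBl -[(x', y').1]/x' -[(x', y').2]/y' -[(x, y).1]/x -[(x, y).2]/y.
move: (oinner (F (x', y')) v) (oinner (F (x, y')) v) (oinner (F (x, y)) v) (oinner (Dx p) v) (oinner (Dy p) v).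
by move=> a1 a2 a3 l1 l2; rewrite le_eqVlt; apply/orP; left; apply/eqP; congr `|_|; ring.
Qed.

Lemma vdiff_of_derive J F (Dx Dy : R * R -> O) p : imag_units J ->
  nbhs p [set q | is_derive q ((1, 0) : R * R) F (Dx q) /\ is_derive q ((0, 1) : R * R) F (Dy q)] ->
  {for p, continuous Dx} -> {for p, continuous Dy} -> Dx p + J ** Dy p = 0 ->
  vdiff J F p (Dx p).
Proof.
move=> JJ near cx cy CR v.
have DyE : Dy p = J ** Dx p.
  have -> : Dx p = - (J ** Dy p) by apply/eqP; rewrite -subr_eq0 opprK CR.
  by rewrite omulNr imag_mulK // opprK.
(* The real and imaginary parts are each bounded by [e (|dx| + |dy|)], hence by [2 e |w' - w|]. *)
apply: (@sdiff_slack R 4) => // e e0 _.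
have [d1 d10 H1] := real_increment v e0 near cx cy.
have [d2 d20 H2] := real_increment (J ** v) e0 near cx cy.
exists (Num.min d1 d2); first by rewrite lt_min d10.
move=> w w'; rewrite !lt_min => /andP[w1 w2] /andP[w'1 w'2].
have conv z d : normc (z - cpx p) < d -> `|rip z - p| < d.
  by apply: le_lt_trans; apply: le_trans (dist_cpx _ _) _; rewrite ripK.
have A := H1 _ _ (conv _ _ w1) (conv _ _ w'1).
have B := H2 _ _ (conv _ _ w2) (conv _ _ w'2).
rewrite -hprodBl; apply: le_trans (normc_ReIm _) _.
have D1 : `|(rip w').1 - (rip w).1| <= normc (w' - w).
  by apply: le_trans (normc_Re _); case: (w); case: (w').
have D2 : `|(rip w').2 - (rip w).2| <= normc (w' - w).
  by apply: le_trans (normc_Im _); case: (w); case: (w').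
have D3 : e * (`|(rip w').1 - (rip w).1| + `|(rip w').2 - (rip w).2|) <= e * (2 * normc (w' - w)).
  by rewrite ler_wpM2l ?(ltW e0) //; lra.
have RE : complex.Re (hprod J (F (rip w') - F (rip w)) v - hprod J (Dx p) v * (w' - w)) =
   oinner (F (rip w') - F (rip w)) v - ((rip w').1 - (rip w).1) * oinner (Dx p) v
     - ((rip w').2 - (rip w).2) * oinner (Dy p) v.
  rewrite DyE oinner_adjl oconj_imag; last by have [] := imag_unitP JJ.
  by rewrite omulNl oinnerNr; case: (w') => ? ?; case: (w) => ? ? /=; ring.
have IM : complex.Im (hprod J (F (rip w') - F (rip w)) v - hprod J (Dx p) v * (w' - w)) =
   oinner (F (rip w') - F (rip w)) (J ** v) - ((rip w').1 - (rip w).1) * oinner (Dx p) (J ** v)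
     - ((rip w').2 - (rip w).2) * oinner (Dy p) (J ** v).
  have [J0 J1] := imag_unitP JJ.
  rewrite DyE oinner_mul oinner_sqr J1 expr1n mul1r.
  by case: (w') => ? ?; case: (w) => ? ? /=; ring.
rewrite RE IM; lra.
Qed.

Lemma regular_vdiff Omega f J p : imag_units J -> open (slice J @^-1` Omega) ->
  slice_regular Omega f -> Omega (slice J p) ->
  vdiff J (f \o slice J) p (partial_x f J p) /\ partial_y f J p = J ** partial_x f J p.
Proof.
move=> JJ oW rf Op.
have [_ _ cx cy CR] := rf _ _ JJ Op.
have {}CR : partial_x f J p + J ** partial_y f J p = 0.
  by move/eqP: CR; rewrite scaler_eq0 invr_eq0 pnatr_eq0 /= => /eqP.
split; last first.
  have -> : partial_x f J p = - (J ** partial_y f J p) by apply/eqP; rewrite -subr_eq0 opprK CR.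
  by rewrite omulNr imag_mulK // opprK.
apply: (@vdiff_of_derive J _ _ (partial_y f J)) => //.
have : nbhs p (slice J @^-1` Omega) by exact: open_nbhs_nbhs.
apply: filterS => q Oq; have [dx dy _ _ _] := rf _ _ JJ Oq.
by split; [exact: (derivableP dx) | exact: (derivableP dy)].
Qed.

(** A strict derivative at [z] also linearizes around nearby base points, so nearby derivatives are
    close to it. This supplies the continuous partial derivatives that slice regularity requires. *)
Lemma sdiff_near_derive (phi psi : C -> C) (z : C) (r : R) L : 0 < r ->
  (forall w : C, normc (w - z) < r -> sdiff phi w (psi w)) -> sdiff phi z L -> ccont psi z.
Proof.
move=> r0 Hpsi HL e e0; have [d d0 Hd] := HL _ e0.
have Lz : psi z = L by apply: sdiff_unique HL; apply: Hpsi; rewrite subrr normc0.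
exists (Num.min (d / 2) r) => [|w]; first by rewrite lt_min divr_gt0.
rewrite lt_min => /andP[wd wr]; rewrite Lz.
apply: (@sdiff_dist R phi w _ _ (d / 2)); [by rewrite divr_gt0 | exact: Hpsi |].
move=> w' w'w; apply: Hd; first by lra.
by have := normc_triangle w w' z; lra.
Qed.

(** The derivative [L v] is real linear in [v] and satisfies [L (J ** v) = - i * L v], so it is
    [hprod J D v] for the octonion [D] whose coordinates are the real parts of [L] on the basis. *)
Lemma vdiff_exists J F p : imag_units J ->
  (forall v, sd (fun z => hprod J (F (rip z)) v) (cpx p)) -> exists D, vdiff J F p D.
Proof.
move=> JJ /choice[L HL].
pose e i : O := coord_vec R (inord i).
have vE v : v = v.1.1.1 *: e 0%N + v.1.1.2 *: e 1%N + v.1.2.1 *: e 2%N + v.1.2.2 *: e 3%N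
  + v.2.1.1 *: e 4%N + v.2.1.2 *: e 5%N + v.2.2.1 *: e 6%N + v.2.2.2 *: e 7%N.
  by apply: oct_eq; rewrite /= /e /coord_vec !inordK // /GRing.scale /=; ring.
have LD v w : L (v + w) = L v + L w.
  apply: sdiff_unique (HL _) _; apply: sdiff_near ltr01 _ (sdiffD (HL v) (HL w)) => z _.
  by rewrite hprodDr.
have LZ a v : L (a *: v) = a%:C * L v.
  have := sdiffM (@sdiff_cst R a%:C (cpx p)) (HL v); rewrite mul0r add0r => H.
  apply: sdiff_unique (HL _) _; apply: sdiff_near ltr01 _ H => z _.
  by rewrite hprodZr.
have LJ v : L (J ** v) = - 'i * L v.
  have := sdiffM (@sdiff_cst R (- 'i) (cpx p)) (HL v); rewrite mul0r add0r => H.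
  apply: sdiff_unique (HL _) _; apply: sdiff_near ltr01 _ H => z _.
  rewrite /hprod imag_mulK // oinnerNr.
  by apply/eqP; rewrite eq_complex /=; apply/andP; split; apply/eqP; ring.
pose l i := complex.Re (L (e i)).
pose D : O := (((l 0%N, l 1%N), (l 2%N, l 3%N)), ((l 4%N, l 5%N), (l 6%N, l 7%N))).
have DE v : oinner D v = complex.Re (L v).
  rewrite {2}(vE v) !LD !LZ oinnerE /D /l /=.
  by do 8! case: (L (e _)) => ? ? /=; ring.
exists D => v; have -> : hprod J D v = L v.
  by rewrite /hprod !DE LJ; case: (L v) => a b; apply/eqP; rewrite eq_complex /=; apply/andP; split; apply/eqP; ring.
exact: HL.
Qed.

Lemma vdiff_is_derive J F p D (r : C) : imag_units J -> vdiff J F p D ->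
  is_derive p (rip r) F (slice J (rip r) ** D).
Proof.
move=> JJ H; apply: is_derive_cvg; apply: oct_cvg => v.
apply/cvgrPdist_le => e e0.
have nr : 0 < normc r + 1 by have := normc_ge0 r; lra.
have e1 : 0 < e / (normc r + 1) by rewrite divr_gt0.
have [d d0 Hd] := H v _ e1.
near=> h.
have h0 : h != 0 by near: h; exact: nbhs_dnbhs_neq.
have hd : `|h| < d / (normc r + 1).
  near: h; apply: dnbhs0_lt; by rewrite divr_gt0.
have nh : normc (h%:C * r) < d.
  rewrite normcM normc_real; apply: le_lt_trans (_ : `|h| * (normc r + 1) < d).
    by rewrite ler_wpM2l //; lra.
  by rewrite -ltr_pdivlMr.
have := Hd (cpx p) (h%:C * r + cpx p); rewrite subrr normc0 addrK => /(_ d0 nh).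
have -> : rip (h%:C * r + cpx p) = h *: rip r + p.
  by case: (r) => a b; case: (p) => x y; apply/pair_equal_spec; split; rewrite /= /GRing.scale /=; ring.
rewrite cpxK normcM normc_real -hprodBl => K.
have h0' : 0 < `|h| by rewrite normr_gt0.
rewrite -(ler_pM2l h0') -normrM oinnerZl mulrBr mulrA mulfV // mul1r.
have : complex.Re (hprod J (F (h *: rip r + p) - F p) v - hprod J D v * (h%:C * r)) =
   oinner (F (h *: rip r + p) - F p) v - h * oinner (slice J (rip r) ** D) v.
  have -> : oinner (slice J (rip r) ** D) v = complex.Re (hprod J (slice J (rip r) ** D) v) by [].
  rewrite hprod_slice // ripK mulrC.
  by case: (hprod J D v) => ? ?; case: (r) => ? ? /=; ring.
move=> E; rewrite distrC -E; apply: le_trans (normc_Re _) _; apply: le_trans K _.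
rewrite mulrCA ler_wpM2l //; rewrite mulrAC ler_pdivrMr // ler_wpM2l ?(ltW e0) //; lra.
Unshelve. all: by end_near. Qed.

Lemma vdiff_regular J (W : set (R * R)) F (D : R * R -> O) p : imag_units J -> open W ->
  (forall q, W q -> vdiff J F q (D q)) -> W p ->
  [/\ is_derive p ((1, 0) : R * R) F (D p), is_derive p ((0, 1) : R * R) F (J ** D p) &
      {for p, continuous D}].
Proof.
move=> JJ oW HD Wp; split.
- have := vdiff_is_derive 1 JJ (HD _ Wp); rewrite /rip /= slice0 oreal_mull scale1r.
  exact.
- have := vdiff_is_derive 'i JJ (HD _ Wp); rewrite /rip /= slice_mul /= scale0r scale1r add0r.
  exact.
- apply: oct_cvg => v; apply/cvgrPdist_le => e e0.
  have : nbhs p W by exact: open_nbhs_nbhs.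
  move=> /nbhs_distP[r r0 Hr].
  have [] := @sdiff_near_derive (fun z => hprod J (F (rip z)) v)
     (fun z => hprod J (D (rip z)) v) (cpx p) r _ r0 _ (HD _ Wp v) e e0.
    move=> w wr; have := HD (rip w); rewrite /vdiff ripK; apply.
    by apply: Hr; apply: le_lt_trans (dist_cpx _ _) _; rewrite ripK.
  move=> d d0 Hd.
  suff : nbhs p [set q | `|oinner (D p) v - oinner (D q) v| <= e] by [].
  apply/nbhs_distP; exists (d / 2) => [|q qp]; first by rewrite divr_gt0.
  have := Hd (cpx q); rewrite !cpxK -hprodBl => H.
  have /H : normc (cpx q - cpx p) < d by have := cpx_dist q p; lra.
  rewrite /= distrC -oinnerBl; apply: le_trans; exact: (normc_Re (hprod J _ v)).
Unshelve. all: by end_near. Qed.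

End SliceRegularity.

(** * Stems and the representation formula *)

Section Stems.
Variable R : realType.
Local Notation C := R[i].
Local Notation O := (octonion R).
Implicit Types (u v w I J : O) (a b : R) (p q : R * R) (F G : R * R -> O) (Omega : set O).

Definition pconj p : R * R := (p.1, - p.2).

Lemma pconjK p : pconj (pconj p) = p.
Proof. by case: p => x y; rewrite /pconj /= opprK. Qed.

Lemma cpx_pconj p : cpx (pconj p) = (cpx p)^*.
Proof. by []. Qed.

Definition axially_symmetric Omega := forall I J p, imag_units I -> imag_units J ->
  Omega (slice I p) -> Omega (slice J p).

Definition even_odd (A B : R * R -> O) :=
  (forall p, A (pconj p) = A p) /\ (forall p, B (pconj p) = - B p).

Lemma odd0 (B : R * R -> O) x : (forall p, B (pconj p) = - B p) -> B (x, 0) = 0.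
Proof.
move=> /(_ (x, 0)); rewrite /pconj /= oppr0 => /eqP; rewrite -subr_eq0 opprK -mulr2n -scaler_nat.
by rewrite scaler_eq0 pnatr_eq0 /= => /eqP.
Qed.

Lemma axially_symmetric_pconj Omega I p : axially_symmetric Omega -> imag_units I ->
  Omega (slice I p) -> Omega (slice I (pconj p)).
Proof.
move=> sO II; rewrite -(sliceN I p); apply: sO => //; exact: imag_unitN.
Qed.

(** [slice_fun] normalizes to [y >= 0]. For [y < 0] both [J] and the second coordinate change sign,
    which parity compensates; for [y = 0] the arbitrary unit is harmless because an odd [B] vanishes
    there. *)
Lemma slice_funE A B J p : even_odd A B -> imag_units J ->
  slice_fun A B (slice J p) = A p + J ** B p.
Proof.
move=> [eA oB] JJ; have [J0 J1] := imag_unitP JJ; case: p => x y.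
have Re : oRe (slice J (x, y)) = x.
  by move: J0; rewrite /slice /oRe /= /GRing.scale /= => ->; rewrite mulr0 addr0.
have Im : oIm (slice J (x, y)) = y *: J.
  by rewrite /oIm Re /slice /= addrAC subrr add0r.
have J0' : J != 0.
  by apply: contra_eq_neq J1 => ->; rewrite onorm0 eq_sym oner_eq0.
rewrite /slice_fun /coords Re Im onormZ J1 mulr1 /iunit Im.
have [y0|yp|->] := ltgtP y 0.
- have -> : (x, `|y|) = pconj (x, y) by rewrite /pconj /= ltr0_norm.
  rewrite scaler_eq0 lt_eqF //= (negbTE J0') eA oB onormZ J1 mulr1 ltr0_norm //.
  by rewrite scalerA invrN mulNr mulVf ?lt_eqF // scaleN1r omulNl omulNr opprK.
- rewrite scaler_eq0 gt_eqF //= (negbTE J0') onormZ J1 mulr1 gtr0_norm //.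
  by rewrite scalerA mulVf ?gt_eqF // scale1r.
- by rewrite scale0r eqxx normr0 (odd0 x oB) !omul0r.
Qed.

Lemma stem_ofP Omega f (FF : (R * R -> O) * (R * R -> O)) : stem_of Omega f FF <->
  even_odd FF.1 FF.2 /\ forall I p, imag_units I -> Omega (slice I p) ->
     f (slice I p) = FF.1 p + I ** FF.2 p.
Proof.
split=> [[e o E]|[[e o] E]].
  by split=> //; split=> -[x y]; [exact: e | exact: o].
by split=> // x y; [exact: (e (x, y)) | exact: (o (x, y))].
Qed.

Lemma stem_unique I (A B A' B' : O) : imag_units I ->
  A + I ** B = A' + I ** B' -> A - I ** B = A' - I ** B' -> A = A' /\ B = B'.
Proof.
move=> II E1 E2.
have AA : A = A'.
  have : 2 *: A = 2 *: A'.
    have -> : 2 *: A = (A + I ** B) + (A - I ** B) by rewrite addrACA subrr addr0 scaler_nat.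
    by rewrite E1 E2 addrACA subrr addr0 scaler_nat.
  by apply: scalerI; rewrite pnatr_eq0.
split=> //; move: E1; rewrite AA => /addrI E.
by rewrite -[B]opprK -[B']opprK -!(imag_mulK _ II) E.
Qed.

Lemma stem_of_unique Omega f FF GG I p : axially_symmetric Omega -> imag_units I ->
  stem_of Omega f FF -> stem_of Omega f GG -> Omega (slice I p) ->
  FF.1 p = GG.1 p /\ FF.2 p = GG.2 p.
Proof.
move=> sO II /stem_ofP[_ E1] /stem_ofP[_ E2] Op; apply: (stem_unique II).
  by rewrite -E1 // -E2.
have IN := imag_unitN II; have ON := sO _ _ _ II IN Op.
by rewrite -!omulNl -(E1 _ _ IN ON) -(E2 _ _ IN ON).
Qed.

Lemma stemP Omega f FF : stem_of Omega f FF -> stem_of Omega f (stem Omega f).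
Proof. by move=> H; apply: (@xgetPex _ _ [set F | stem_of Omega f F]); exists FF. Qed.

Lemma regular_mulE Omega f g FF GG I p : axially_symmetric Omega -> imag_units I ->
  stem_of Omega f FF -> stem_of Omega g GG -> Omega (slice I p) ->
  regular_mul Omega f g (slice I p) =
    (FF.1 p ** GG.1 p - FF.2 p ** GG.2 p) + I ** (FF.1 p ** GG.2 p + FF.2 p ** GG.1 p).
Proof.
move=> sO II Hf Hg Op; have Sf := stemP Hf; have Sg := stemP Hg.
have [<- <-] := stem_of_unique sO II Sf Hf Op.
have [<- <-] := stem_of_unique sO II Sg Hg Op.
rewrite /regular_mul.
case: (stem Omega f) Sf => al be /stem_ofP[[/= eal obe] _].
case: (stem Omega g) Sg => ga de /stem_ofP[[/= ega ode] _].
rewrite slice_funE //; split=> q; rewrite eal obe ega ode.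
  by rewrite omulNl omulNr opprK.
by rewrite omulNr omulNl opprD.
Qed.

Lemma regular_conjE Omega f FF I p : axially_symmetric Omega -> imag_units I ->
  stem_of Omega f FF -> Omega (slice I p) ->
  regular_conj Omega f (slice I p) = oconj (FF.1 p) + I ** oconj (FF.2 p).
Proof.
move=> sO II Hf Op; have Sf := stemP Hf.
have [<- <-] := stem_of_unique sO II Sf Hf Op.
rewrite /regular_conj.
case: (stem Omega f) Sf => al be /stem_ofP[[/= eal obe] _].
by rewrite slice_funE //; split=> q; rewrite ?eal ?obe ?oconjN.
Qed.

Definition holomorphic_slice J F p :=
  forall v, sd (fun z => hprod J (F (rip z)) v) (cpx p).

Lemma slice_regular_of_holomorphic Omega f :
  (forall J, imag_units J -> open (slice J @^-1` Omega)) ->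
  (forall J p, imag_units J -> Omega (slice J p) -> holomorphic_slice J (f \o slice J) p) ->
  slice_regular Omega f.
Proof.
move=> oO hol J p JJ Op.
have /choice[D HD] : forall q, exists D, Omega (slice J q) -> vdiff J (f \o slice J) q D.
  move=> q; have [Oq|nOq] := pselect (Omega (slice J q)); last by exists 0.
  by have [D HD] := vdiff_exists JJ (hol _ _ JJ Oq); exists D.
have H q : Omega (slice J q) -> [/\ is_derive q ((1, 0) : R * R) (f \o slice J) (D q),
    is_derive q ((0, 1) : R * R) (f \o slice J) (J ** D q) & {for q, continuous D}].
  by move=> Oq; apply: (vdiff_regular JJ (oO _ JJ)).
have nO : nbhs p (slice J @^-1` Omega) by apply: open_nbhs_nbhs; split => //; exact: oO.
have [[dx ex] [dy ey] cD] := H _ Op.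
split; [exact: dx | exact: dy | | |].
- rewrite /prop_for /continuous_at /partial_x ex.
  apply: cvg_trans cD; apply: near_eq_cvg; move: nO; apply: filterS => q /H[[_ ->]] //.
- rewrite /prop_for /continuous_at /partial_y ey.
  apply: cvg_trans (_ : (fun q => J ** D q) @ p --> J ** D p).
    apply: near_eq_cvg; move: nO; apply: filterS => q /H[_ [_ ->]] //.
  apply: oct_cvg => v.
  have E u : oinner (J ** u) v = oinner u (- (J ** v)).
    by rewrite oinner_adjl oconj_imag ?omulNl //; have [] := imag_unitP JJ.
  rewrite E; under eq_fun do rewrite E.
  by apply: oinner_cvg; exact: cD.
- by rewrite /partial_x /partial_y ex ey imag_mulK // subrr scaler0.
Qed.

(** With [odd_part], the solution [(A, B)] of [A + I ** B = G p] and [A - I ** B = G (pconj p)]: the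
    stem that the values on [C_I] dictate. *)
Definition even_part G p : O := 2^-1 *: (G p + G (pconj p)).
Definition odd_part I G p : O := - (2^-1 *: (I ** (G p - G (pconj p)))).

Lemma parts_even_odd I G : even_odd (even_part G) (odd_part I G).
Proof.
split=> p; rewrite /even_part /odd_part pconjK; first by rewrite addrC.
by rewrite -opprB omulNr scalerN.
Qed.

Lemma scaler_half_double (x : O) : 2^-1 *: (x + x) = x.
Proof.
by rewrite -[x + x]/(x *+ 2) -(scaler_nat 2 x) scalerA mulVf ?pnatr_eq0 // scale1r.
Qed.

Lemma parts_slice I G p : imag_units I -> even_part G p + I ** odd_part I G p = G p.
Proof.
move=> II; rewrite /even_part /odd_part omulNr omulZr imag_mulK // scalerN opprK -scalerDr.
by rewrite addrACA subrr addr0 scaler_half_double.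
Qed.

(* The extension to [C_J] of a function [G] on [C_I] is [P (G z) + Q (G z^* )], with
   [P = (1 - J I) / 2] intertwining left multiplications by [I] and [J], and
   [Q = (1 + J I) / 2] those by [I] and [- J]. *)
Lemma hprod_parts I J G p v : imag_units I -> imag_units J ->
  hprod J (even_part G p + J ** odd_part I G p) v =
    hprod I (G p) (2^-1 *: (v - I ** (J ** v)))
    + (hprod I (G (pconj p)) (2^-1 *: (v + I ** (J ** v))))^*.
Proof.
move=> II JJ; have [I0 I1] := imag_unitP II; have [J0 J1] := imag_unitP JJ.
have aI x y : oinner (I ** x) y = - oinner x (I ** y).
  by rewrite oinner_adjl oconj_imag // omulNl oinnerNr.
have aJ x y : oinner (J ** x) y = - oinner x (J ** y).
  by rewrite oinner_adjl oconj_imag // omulNl oinnerNr.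
rewrite /even_part /odd_part /hprod.
rewrite !(omulNr, omulZr, omulBr, omulDr, oinnerDl, oinnerNl, oinnerZl, oinnerBl, oinnerDr,
  oinnerBr, oinnerNr, oinnerZr, imag_mulK _ II, imag_mulK _ JJ, aJ, aI).
apply/eqP; rewrite eq_complex /=; apply/andP; split; apply/eqP; ring.
Qed.

Lemma holomorphic_parts I J G p : imag_units I -> imag_units J ->
  holomorphic_slice I G p -> holomorphic_slice I G (pconj p) ->
  holomorphic_slice J (fun p => even_part G p + J ** odd_part I G p) p.
Proof.
move=> II JJ H1 H2 v.
have [L HL] := H2 (2^-1 *: (v + I ** (J ** v))); rewrite cpx_pconj in HL.
have K : sd (fun z => (hprod I (G (rip z^*)) (2^-1 *: (v + I ** (J ** v))))^*) (cpx p).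
  by eexists; exact: sdiff_conj HL.
apply: sd_near ltr01 _ (sdD (H1 (2^-1 *: (v - I ** (J ** v)))) K) => z _.
by rewrite hprod_parts; case: z.
Qed.

Lemma trace_open Omega I : symmetric_slice_domain Omega -> imag_units I ->
  open (slice I @^-1` Omega).
Proof. by move=> [_ _ H _] /H[_ oW _]. Qed.

Lemma regular_holomorphic Omega f J p : symmetric_slice_domain Omega -> imag_units J ->
  slice_regular Omega f -> Omega (slice J p) -> holomorphic_slice J (f \o slice J) p.
Proof.
move=> sO JJ rf Op v; have [H _] := regular_vdiff JJ (trace_open sO JJ) rf Op.
by eexists; exact: H.
Qed.

(** On [C_J] both [f] and the function built from the values of [f] on [C_I] are holomorphic, and
    they agree on the real axis; the trace of [Omega] is connected and meets it. *)
Lemma representation Omega f I : symmetric_slice_domain Omega -> imag_units I ->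
  slice_regular Omega f ->
  stem_of Omega f (even_part (f \o slice I), odd_part I (f \o slice I)).
Proof.
move=> sO II rf; apply/stem_ofP; split=> /=; first exact: parts_even_odd.
move=> J p JJ Op; have [_ [x Ox] dO symO] := sO.
set G := f \o slice I.
have W q : Omega (slice J q) <-> Omega (slice I q) by split; exact: symO.
have [_ oW cW] := dO _ JJ.
apply/eqP; rewrite -subr_eq0; apply/eqP; apply: (hprod_inj JJ) => v.
pose phi z := hprod J (f (slice J (rip z)) - (even_part G (rip z) + J ** odd_part I G (rip z))) v.
have := @vanish_connected R (slice J @^-1` Omega) phi x oW cW.
rewrite /phi; move=> /(_ _ _ _ p Op); rewrite cpxK; apply.
- by rewrite /= slice0.
- move=> q /= Oq; apply: sd_near ltr01 _ (sdB (regular_holomorphic sO JJ rf Oq v)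
    (@holomorphic_parts I J G q II JJ _ _ v)) => [z _||].
  + by rewrite /phi hprodBl.
  + by apply: (regular_holomorphic sO II rf); apply/W.
  + apply: (regular_holomorphic sO II rf).
    by apply: axially_symmetric_pconj => //; apply/W.
- move=> t /= Ot; rewrite /phi cpxK /G /even_part /odd_part /= /pconj /= oppr0 subrr.
  rewrite !slice0 omul0r scaler0 oppr0 omul0r addr0 scaler_half_double.
  by rewrite subrr hprod0l.
Qed.

Lemma stem_of_sub Omega xi :
  stem_of Omega (fun v => v - xi) (fun p => oreal p.1 - xi, fun p => oreal p.2).
Proof.
apply/stem_ofP; split=> /=.
  by split=> // p; rewrite /pconj /=; apply: oct_eq; rewrite /= ?oppr0.
by move=> I p II _; rewrite oreal_mulr /slice addrAC.
Qed.

Opaque omul oreal slice.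

(** The stem of [v - xi] takes values in [C_I], so on that slice alternativity makes the regular
    product pointwise. *)
Lemma regular_mul_sub Omega I q p g : symmetric_slice_domain Omega -> imag_units I ->
  slice_regular Omega g -> Omega (slice I p) ->
  regular_mul Omega (fun v => v - slice I q) g (slice I p) = slice I (p - q) ** g (slice I p).
Proof.
move=> sO II rg Op; have [_ _ _ symO] := sO.
have Sg := representation sO II rg.
rewrite (regular_mulE symO II (stem_of_sub Omega (slice I q)) Sg Op) /=.
have /stem_ofP[_ E] := Sg; rewrite E //=.
set A := even_part _ _; set B := odd_part _ _ _.
have -> : oreal p.1 - slice I q = slice I (p.1 - q.1, - q.2).
  by rewrite -(slice0 I p.1) slice_sub; congr slice; apply/pair_equal_spec; rewrite /= sub0r.
have -> : p - q = (p.1 - q.1, p.2 - q.2) by [].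
have mulE x y u : slice I (x, y) ** u = x *: u + y *: (I ** u) by exact: slice_mul.
clearbody A B.
apply: etrans (esym (mulE (p.1 - q.1) (p.2 - q.2) (A + I ** B))).
have := mulE (p.1 - q.1) (- q.2) B; have := mulE (p.1 - q.1) (- q.2) A.
move: (slice I (p.1 - q.1, - q.2) ** A) (slice I (p.1 - q.1, - q.2) ** B) => sA sB -> ->.
have := oreal_mull p.2 A; have := oreal_mull p.2 B.
move: (oreal p.2 ** A) (oreal p.2 ** B) => yA yB -> ->.
rewrite !omulDr !omulZr !(imag_mulK _ II).
move: (I ** A) (I ** B) p.1 p.2 q.1 q.2 => IA IB x y c d.
by apply: oct_eq; rewrite /= /GRing.scale /=; ring.
Qed.

End Stems.

(** * Regular division by [w - xi] *)

Section Quotients.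
Variable R : realType.
Local Notation C := R[i].
Local Notation O := (octonion R).
Implicit Types (u v w I J : O) (a b : R) (p q : R * R) (F G : R * R -> O) (Omega : set O).

Opaque omul.

Lemma stem_of_subc Omega f FF (c : O) : stem_of Omega f FF ->
  stem_of Omega (fun w => f w - c) (fun p => FF.1 p - c, FF.2).
Proof.
move=> /stem_ofP[[e o] E]; apply/stem_ofP; split=> /=.
  by split=> // p; rewrite e.
by move=> I p II Op; rewrite E // addrAC.
Qed.

Lemma regular_mul_stem Omega f g FF GG : axially_symmetric Omega ->
  stem_of Omega f FF -> stem_of Omega g GG ->
  stem_of Omega (regular_mul Omega f g)
    (fun p => FF.1 p ** GG.1 p - FF.2 p ** GG.2 p,
     fun p => FF.1 p ** GG.2 p + FF.2 p ** GG.1 p).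
Proof.
move=> sO Hf Hg; apply/stem_ofP; split=> /=; last first.
  by move=> I p II Op; rewrite (regular_mulE sO II Hf Hg Op).
have /stem_ofP[[ef of_] _] := Hf; have /stem_ofP[[eg og] _] := Hg.
split=> q; rewrite ef of_ eg og; first by rewrite omulNl omulNr opprK.
by rewrite omulNr omulNl opprD.
Qed.

Lemma stem_agree Omega f g FF GG I : axially_symmetric Omega -> imag_units I ->
  stem_of Omega f FF -> stem_of Omega g GG ->
  (forall p, Omega (slice I p) -> f (slice I p) = g (slice I p)) ->
  forall w, Omega w -> f w = g w.
Proof.
move=> sO II /stem_ofP[_ E1] /stem_ofP[_ E2] E w Ow.
rewrite -(slice_iunit w) in Ow *; set J := iunit w; set p := coords w.
have JJ : imag_units J := iunit_imag w.
have Op : Omega (slice I p) := sO _ _ _ JJ II Ow.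
have IN := imag_unitN II; have ON := sO _ _ _ II IN Op.
have [E3 E4] : FF.1 p = GG.1 p /\ FF.2 p = GG.2 p.
  apply: (stem_unique II); first by rewrite -E1 // -E2 // E.
  rewrite -!omulNl -(E1 _ _ IN ON) -(E2 _ _ IN ON) sliceN; apply: E.
  by rewrite -sliceN.
by rewrite E1 // E2 // E3 E4.
Qed.

Lemma slice_inv_mul I (z : C) u : imag_units I -> z != 0 ->
  slice I (rip z) ** (slice I (rip z^-1) ** u) = u.
Proof.
move=> II z0; apply/eqP; rewrite -subr_eq0; apply/eqP; apply: (hprod_inj II) => v.
by rewrite hprodBl !hprod_slice // !ripK mulrA mulfV // mul1r subrr.
Qed.

Lemma cpxB p q : cpx (p - q) = cpx p - cpx q. Proof. by []. Qed.

Definition slice_quot (I : O) F q (D : O) p : O :=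
  if p == q then D else slice I (rip (cpx p - cpx q)^-1) ** (F p - F q).

Lemma cpx_inj p q : cpx p = cpx q -> p = q.
Proof. by move=> E; rewrite -(cpxK p) E cpxK. Qed.

Lemma hprod_slice_quot I F q D v (z : C) : imag_units I ->
  hprod I (slice_quot I F q D (rip z)) v =
    diff_quot (fun z => hprod I (F (rip z)) v) (cpx q) (hprod I D v) z.
Proof.
move=> II; rewrite /slice_quot /diff_quot.
have -> : (rip z == q) = (z == cpx q).
  by apply/eqP/eqP => [<-|->]; rewrite ?ripK ?cpxK.
case: eqP => // _; rewrite hprod_slice // !ripK hprodBl cpxK mulrC //.
Qed.

Lemma open_disc (W : set (R * R)) p : open W -> W p ->
  exists2 r : R, 0 < r & forall z, normc (z - cpx p) < r -> W (rip z).
Proof.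
move=> oW Op; have : nbhs p W by exact: open_nbhs_nbhs.
move=> /nbhs_distP[r r0 Hr]; exists r => // z zr; apply: Hr.
by apply: le_lt_trans (dist_cpx _ _) _; rewrite ripK.
Qed.

Lemma open_trace_disc Omega I p : open (slice I @^-1` Omega) -> Omega (slice I p) ->
  exists2 r : R, 0 < r & forall z, normc (z - cpx p) < r -> Omega (slice I (rip z)).
Proof. by move=> oW Op; exact: (open_disc oW Op). Qed.

Lemma holomorphic_slice_quot Omega I F q D p : imag_units I ->
  open (slice I @^-1` Omega) ->
  (forall p, Omega (slice I p) -> holomorphic_slice I F p) -> Omega (slice I q) ->
  vdiff I F q D -> Omega (slice I p) -> holomorphic_slice I (slice_quot I F q D) p.
Proof.
move=> II oW hF Oq HD Op v.
suff : sd (diff_quot (fun z => hprod I (F (rip z)) v) (cpx q) (hprod I D v)) (cpx p).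
  by apply: sd_near ltr01 _ => z _; rewrite hprod_slice_quot.
have [->|pq] := eqVneq p q; last first.
  apply: sd_diff_quot; last exact: hF.
  by apply: contra_neq pq; exact: cpx_inj.
have [r r0 Hr] := open_trace_disc oW Oq.
apply: (@sd_diff_quot_all R _ _ _ _ r) => //; last by rewrite subrr normc0.
by move=> w /Hr/hF/(_ v); rewrite ripK.
Qed.

(** The division is done on the slice of [xi], with the derivative as the value at [q], and extended
    to the other slices by even and odd parts. The product formula then needs checking on [C_I]
    only, by [stem_agree]. *)
Lemma quotient_exists Omega f I q : symmetric_slice_domain Omega -> imag_units I ->
  slice_regular Omega f -> Omega (slice I q) ->
  exists g, quotient_of Omega (slice I q) f g.
Proof.
move=> sO II rf Oq; have [_ _ _ symO] := sO.
pose D := partial_x f I q; pose F := f \o slice I.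
have [HD _] := regular_vdiff II (trace_open sO II) rf Oq.
have hF p : Omega (slice I p) -> holomorphic_slice I F p.
  by move=> Op; exact: (regular_holomorphic sO II rf).
pose G := slice_quot I F q D.
have hG p : Omega (slice I p) -> holomorphic_slice I G p.
  by move=> Op; apply: (holomorphic_slice_quot II (trace_open sO II)).
pose g := slice_fun (even_part G) (odd_part I G).
have gE J p : imag_units J -> g (slice J p) = even_part G p + J ** odd_part I G p.
  by move=> JJ; exact: (slice_funE p (parts_even_odd I G) JJ).
have rg : slice_regular Omega g.
  apply: slice_regular_of_holomorphic => [J JJ|J p JJ Op]; first exact: trace_open.
  have -> : g \o slice J = fun p => even_part G p + J ** odd_part I G p.
    by apply/funext => r /=; exact: gE.
  have Op' : Omega (slice I p) := symO _ _ _ JJ II Op.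
  exact: (holomorphic_parts II JJ (hG _ Op') (hG _ (axially_symmetric_pconj symO II Op'))).
exists g; split => // w Ow.
have Sg : stem_of Omega g (even_part G, odd_part I G).
  by apply/stem_ofP; split=> [|J p JJ _] /=; [exact: parts_even_odd | exact: gE].
have S1 := stem_of_subc (f (slice I q)) (representation sO II rf).
have S2 := regular_mul_stem symO (stem_of_sub Omega (slice I q)) Sg.
apply: (stem_agree symO II S1 S2 _ Ow).
move=> p Op; rewrite (regular_mul_sub q sO II rg Op) gE // parts_slice //.
rewrite /G /slice_quot; case: eqVneq => [->|pq].
  by rewrite !subrr /F /= /slice /= oreal0 scale0r addr0 omul0l.
rewrite -[p - q](cpxK (p - q)) cpxB slice_inv_mul //.
by rewrite subr_eq0; apply: contra_neq pq; exact: cpx_inj.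
Qed.

Lemma quotient_atP Omega f I q : symmetric_slice_domain Omega -> imag_units I ->
  slice_regular Omega f -> Omega (slice I q) ->
  quotient_of Omega (slice I q) f (quotient_at Omega (slice I q) f).
Proof.
move=> sO II rf Oq; have [g Hg] := quotient_exists sO II rf Oq.
by apply: (@xgetPex _ _ [set g | quotient_of Omega (slice I q) f g]); exists g.
Qed.

Lemma quotient_slice Omega f g I q p : symmetric_slice_domain Omega -> imag_units I ->
  quotient_of Omega (slice I q) f g -> Omega (slice I p) ->
  f (slice I p) - f (slice I q) = slice I (p - q) ** g (slice I p).
Proof. by move=> sO II [rg E] Op; rewrite E // regular_mul_sub. Qed.

Lemma ccont_unique (phi psi : C -> C) (z : C) (r : R) : 0 < r -> ccont phi z -> ccont psi z ->
  (forall w : C, w != z -> normc (w - z) < r -> phi w = psi w) -> phi z = psi z.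
Proof.
move=> r0 cphi cpsi E; apply/eqP; rewrite -subr_eq0; apply: contraTT (lexx (0 : R)) => n0.
rewrite -ltNge; apply: lt_le_trans (_ : normc (phi z - psi z) <= _); first by rewrite normc_gt0.
by apply: ccont_le r0 (ccontB cphi cpsi) _ => w wz wr; rewrite E // subrr normc0.
Qed.

(** Both sides are the limit at [q] of the same difference quotients on [C_I]. *)
Lemma quotient_center Omega f g I q : symmetric_slice_domain Omega -> imag_units I ->
  slice_regular Omega f -> Omega (slice I q) -> quotient_of Omega (slice I q) f g ->
  g (slice I q) = partial_x f I q.
Proof.
move=> sO II rf Oq Hg; have [rg _] := Hg.
have [HD _] := regular_vdiff II (trace_open sO II) rf Oq.
apply/eqP; rewrite -subr_eq0; apply/eqP; apply: (hprod_inj II) => v; apply/eqP.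
rewrite hprodBl subr_eq0; apply/eqP.
have [r r0 Hr] := open_trace_disc (trace_open sO II) Oq.
have c1 := sd_cont (regular_holomorphic sO II rg Oq v).
have c2 := ccont_diff_quot (HD v).
have := ccont_unique r0 c1 c2 => /(_ _); rewrite /= cpxK /diff_quot eqxx; apply.
move=> z zq zr; rewrite (negbTE zq) cpxK -hprodBl.
have := quotient_slice sO II Hg (Hr _ zr); rewrite /comp => ->.
rewrite hprod_slice // cpxB ripK mulrAC divff ?mul1r //.
by rewrite subr_eq0.
Qed.

End Quotients.

(** * The derivative at a boundary point *)

Section BoundaryInequalities.
Variable R : realType.
Local Notation C := R[i].
Local Notation O := (octonion R).
Implicit Types (u v w I J : O) (a b : R) (p q : R * R) (F G : R * R -> O) (Omega : set O).

Opaque omul.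

(** Lagrange's identity: the defect in the squared inequality is [A * (x1 * y2 - y1 * x2) ^+ 2]. *)
Lemma weighted_CS (A x1 y1 x2 y2 K M : R) : 0 < A -> 0 <= x1 -> 0 <= y1 -> 0 <= x2 ->
  0 <= y2 -> 0 <= K -> 0 <= M -> A * x1 ^+ 2 + x2 ^+ 2 <= K ^+ 2 ->
  A * y1 ^+ 2 + y2 ^+ 2 <= M ^+ 2 -> A * (x1 * y1) + x2 * y2 <= K * M.
Proof.
move=> A0 x10 y10 x20 y20 K0 M0 kx ky.
rewrite -ler_sqr ?nnegrE ?mulr_ge0 //; last by rewrite addr_ge0 ?mulr_ge0 // ltW.
rewrite exprMn.
have s2 : 0 <= A * x1 ^+ 2 + x2 ^+ 2 by rewrite addr_ge0 ?mulr_ge0 ?sqr_ge0 // ltW.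
have s3 : 0 <= A * y1 ^+ 2 + y2 ^+ 2 by rewrite addr_ge0 ?mulr_ge0 ?sqr_ge0 // ltW.
apply: le_trans (ler_pM s2 s3 kx ky).
have : 0 <= A * (x1 * y2 - y1 * x2) ^+ 2 by rewrite mulr_ge0 ?sqr_ge0 // ltW.
lra.
Qed.

(* Schwarz-Pick for the unit ball: Cauchy-Schwarz applied to the positive form
   [(1 - |a| ^ 2) <X, Y> + <X, a> <a, Y>], at [X = w - a] and [Y = p - a]. *)
Lemma hprod_pick (w p a : O) I : imag_units I ->
  onorm w <= 1 -> onorm p <= 1 -> onorm a < 1 ->
  normc ((1 - hprod I w a) * (1 - hprod I a p) - (1 - onorm a ^+ 2)%:C * (1 - hprod I w p))
    <= normc ((1 - hprod I w a) * (1 - hprod I a p)).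
Proof.
move=> II w1 p1 a1; set A := 1 - onorm a ^+ 2.
have A0 : 0 < A by rewrite subr_gt0 expr_lt1 // onorm_ge0.
pose X := w - a; pose Y := p - a.
have aa : hprod I a a = 1 - A%:C by rewrite hprodxx // /A rmorphB rmorph1 subKr.
have wE v : hprod I w v = hprod I X v + hprod I a v by rewrite /X -hprodDl subrK.
have pE v : hprod I v p = hprod I v Y + hprod I v a by rewrite /Y -hprodDr subrK.
have -> : (1 - hprod I w a) * (1 - hprod I a p) - A%:C * (1 - hprod I w p) =
    A%:C * hprod I X Y + hprod I X a * hprod I a Y.
  by rewrite !wE !pE aa; ring.
(* This is the quadratic form at [v - a]; the two sides differ by [A * (1 - |v| ^ 2)]. *)
have key v : onorm v <= 1 -> A * onorm (v - a) ^+ 2 + normc (hprod I (v - a) a) ^+ 2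
    <= normc (1 - hprod I v a) ^+ 2.
  move=> v1; have -> : 1 - hprod I v a = A%:C - hprod I (v - a) a.
    by rewrite hprodBl aa; ring.
  have v2 : onorm v ^+ 2 <= 1 by rewrite expr_le1 // onorm_ge0.
  have E : onorm v ^+ 2 = onorm (v - a) ^+ 2 + 2 * complex.Re (hprod I (v - a) a) + onorm a ^+ 2.
    have gen x : onorm (x + a) ^+ 2 = onorm x ^+ 2 + 2 * oinner x a + onorm a ^+ 2.
      by rewrite -!oinner_sqr oinnerDl !oinnerDr (oinnerC a x); ring.
    by rewrite -gen subrK.
  have E2 : normc (A%:C - hprod I (v - a) a) ^+ 2 = A ^+ 2
      - 2 * A * complex.Re (hprod I (v - a) a) + normc (hprod I (v - a) a) ^+ 2.
    by rewrite !normc_sqr; case: (hprod I (v - a) a) => x y /=; ring.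
  rewrite E2 lerD2r.
  have : 0 <= A * (1 - onorm v ^+ 2) by apply: mulr_ge0; [exact: ltW | rewrite subr_ge0].
  have a2 : onorm a ^+ 2 = 1 - A by rewrite /A subKr.
  by rewrite E a2; lra.
have kw := key _ w1; have kp := key _ p1.
have nap : normc (1 - hprod I a p) = normc (1 - hprod I p a).
  by rewrite (hprod_conj p a II) -[RHS]normc_conj rmorphB rmorph1.
have nay : normc (hprod I a Y) = normc (hprod I Y a).
  by rewrite (hprod_conj Y a II) normc_conj.
rewrite normcM nap.
set K := normc (1 - hprod I w a) in kw *; set M := normc (1 - hprod I p a) in kp *.
apply: (@le_trans _ _ (A * (onorm X * onorm Y) + normc (hprod I X a) * normc (hprod I Y a))).
  apply: le_trans (le_normcD _ _) _; rewrite !normcM normc_real gtr0_norm // nay lerD2r.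
  by rewrite ler_wpM2l ?(ltW A0) // hprod_CS.
rewrite -/X -/Y in kw kp.
have X0 := onorm_ge0 X; have Y0 := onorm_ge0 Y.
have x0 := normc_ge0 (hprod I X a); have y0 := normc_ge0 (hprod I Y a).
have K0 : 0 <= K := normc_ge0 _; have M0 : 0 <= M := normc_ge0 _.
exact: (weighted_CS A0 X0 Y0 x0 y0 K0 M0 kw kp).
Qed.

(** [u] minus its orthogonal projection to [C_I] is orthogonal to 1 and [I], hence to [u] by
    hypothesis, and so to itself. *)
Lemma in_slice I u : imag_units I ->
  (forall w, oRe w = 0 -> oinner w I = 0 -> oinner w u = 0) ->
  u = slice I (oRe u, oinner u I).
Proof.
move=> II H; have [I0 I1] := imag_unitP II.
apply/eqP; rewrite -subr_eq0; apply/eqP; apply: onorm_eq0; apply/eqP.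
have ii : oinner I I = 1 by rewrite oinner_sqr I1 expr1n.
have r1 x : oinner x (oreal 1) = oRe x by rewrite oinner_realr mul1r.
set s := slice I _.
have sE : s = oRe u *: oreal 1 + oinner u I *: I by rewrite /s /slice /= (oreal_scale (oRe u)).
have re1 : oRe (oreal 1 : O) = 1 by [].
have d1 : oinner (u - s) (oreal 1) = 0.
  by rewrite oinnerBl sE oinnerDl !oinnerZl !r1 I0 re1; ring.
have d2 : oinner (u - s) I = 0.
  by rewrite oinnerBl sE oinnerDl !oinnerZl ii (oinnerC (oreal 1) I) r1 I0; ring.
have gen x : oinner x (u - s) = oinner x u - (oRe u * oinner x (oreal 1) + oinner u I * oinner x I).
  by rewrite oinnerBr sE oinnerDr !oinnerZr.
have d0 : oinner (u - s) u = 0 by apply: H => //; rewrite -r1.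
by rewrite -sqrf_eq0 -oinner_sqr gen d0 d1 d2 !mulr0 addr0 subr0.
Qed.

Lemma oinner_slice_mul I p u v : imag_units I ->
  oinner (slice I p ** u) v = complex.Re (cpx p * hprod I u v).
Proof. by move=> II; rewrite -hprod_slice. Qed.

(* The linear functional [J |-> <alpha, J beta>] is maximal at [I] on the sphere of
   imaginary units, hence vanishes on the imaginary octonions orthogonal to [I]. *)
Lemma max_imag_unit I (alpha beta J : O) : imag_units I ->
  (forall K, imag_units K -> oinner alpha (K ** beta) <= oinner alpha (I ** beta)) ->
  oRe J = 0 -> oinner J I = 0 -> oinner alpha (J ** beta) = 0.
Proof.
move=> II H J0 JI; have [I0 I1] := imag_unitP II.
have [nJ|nJ] := eqVneq (onorm J) 0.
  by rewrite (onorm_eq0 nJ) omul0l oinnerC oinner0l.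
set c := oinner alpha (I ** beta) in H; set m := oinner alpha (J ** beta).
have n2 : 0 < onorm J ^+ 2 by rewrite exprn_gt0 // lt_def nJ onorm_ge0.
have key s : 2 * s * m <= 2 * (s ^+ 2 * onorm J ^+ 2) * c.
  set t := s ^+ 2 * onorm J ^+ 2.
  have t0 : 0 <= t by rewrite mulr_ge0 ?sqr_ge0.
  have t1 : 0 < 1 + t by lra.
  (* The rational parametrization of the circle of units through [I] in the direction of [J]. *)
  pose K := (1 + t)^-1 *: ((1 - t) *: I + (2 * s) *: J).
  have KK : imag_units K.
    apply: imag_unitI.
      have r1 (x : O) : oRe x = oinner x (oreal 1) by rewrite oinner_realr mul1r.
      by rewrite r1 /K oinnerZl oinnerDl !oinnerZl -!r1 I0 J0; ring.
    apply/eqP; rewrite -(eqrXn2 (n := 2)) ?onorm_ge0 // expr1n -oinner_sqr; apply/eqP.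
    rewrite /K !(oinnerZl, oinnerZr, oinnerDl, oinnerDr) !oinner_sqr I1 (oinnerC I J) JI.
    rewrite expr1n !mulr0 addr0 add0r.
    have -> : (1 - t) * ((1 - t) * 1) + 2 * s * (2 * s * onorm J ^+ 2) = (1 + t) * (1 + t).
      by rewrite /t; ring.
    by rewrite mulKf ?gt_eqF // mulVf // gt_eqF.
  have := H _ KK; rewrite /K omulZl omulDl !omulZl oinnerZr oinnerDr !oinnerZr -/c -/m.
  by rewrite ler_pdivrMl //; lra.
apply/eqP; rewrite -sqrf_eq0 eq_le sqr_ge0 andbT.
have N0 : 0 < onorm J ^+ 2 * (`|c| + 1) by rewrite mulr_gt0 // ltr_wpDl.
have cn := ler_norm c.
(* For this [s], [s * m] equals [s ^+ 2 * onorm J ^+ 2 * (|c| + 1)], while [key] bounds it by the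
   same expression with [|c|]; hence [s] and [m] vanish. *)
have := key (m / (onorm J ^+ 2 * (`|c| + 1))).
set s := m / _.
have sE : s * (onorm J ^+ 2 * (`|c| + 1)) = m by rewrite /s mulfVK // gt_eqF.
have sm : s * m = s ^+ 2 * (onorm J ^+ 2 * (`|c| + 1)) by rewrite -{1}sE; ring.
have : s ^+ 2 * (onorm J ^+ 2) * c <= s ^+ 2 * (onorm J ^+ 2) * `|c|.
  by rewrite ler_wpM2l // mulr_ge0 ?sqr_ge0.
have m2 : m ^+ 2 = s ^+ 2 * (onorm J ^+ 2) * (onorm J ^+ 2 * (`|c| + 1) ^+ 2) by rewrite -{1}sE; ring.
move=> A B; have C0 : s ^+ 2 * onorm J ^+ 2 <= 0.
  by move: A B sm; lra.
by rewrite m2; apply: mulr_le0_ge0 => //; rewrite mulr_ge0 ?sqr_ge0.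
Qed.

End BoundaryInequalities.

(** * The modulus of [f] at a boundary point *)

Section BoundaryDerivative.
Variable R : realType.
Local Notation C := R[i].
Local Notation O := (octonion R).
Implicit Types (u v w I J : O) (a b : R) (p q : R * R) (F G : R * R -> O) (Omega : set O).

Opaque omul.

Lemma onorm_sup u : onorm u ^+ 2 <= 8 * `|u| ^+ 2.
Proof.
rewrite -oinner_sqr expr2 mulrA; apply: le_trans (ler_norm _) _.
exact: oinner_norm_le.
Qed.

(* [<g h, P> <= |g h| <= <g h, P> + |g h - P| ^ 2 / 2] when [|P| = 1]. *)
Lemma onorm_derivative (g : R -> O) P V : onorm P = 1 ->
  h^-1 *: (g h - P) @[h --> (0:R)^'] --> V ->
  h^-1 *: (onorm (g h) - 1) @[h --> (0:R)^'] --> oinner V P.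
Proof.
move=> P1 H.
have cP : oinner (h^-1 *: (g h - P)) P @[h --> (0:R)^'] --> oinner V P by exact: oinner_cvg.
apply/cvgrPdist_le => e e0.
have e2 : 0 < e / 2 by lra.
move/cvgrPdist_le: cP => /(_ _ e2) cP.
move/cvgrPdist_le: H => /(_ _ ltr01) cV.
(* The increment [X] has sup norm at most [|h| (|V| + 1)], so half of its squared modulus is at most
   [K |h| ^ 2], by the factor 8 of [onorm_sup]. *)
pose K := 4 * (`|V| + 1) ^+ 2.
have V1 : 0 < `|V| + 1 by rewrite ltr_wpDl.
have K0 : 0 < K by rewrite mulr_gt0 // exprn_gt0.
near=> h.
have h0 : h != 0 by near: h; exact: nbhs_dnbhs_neq.
have hK : `|h| < e / 2 / K by near: h; apply: dnbhs0_lt; rewrite divr_gt0.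
have A : `|oinner V P - oinner (h^-1 *: (g h - P)) P| <= e / 2 by near: h.
have B : `|V - h^-1 *: (g h - P)| <= 1 by near: h.
have PP : oinner P P = 1 by rewrite oinner_sqr P1 expr1n.
set X := g h - P in A B.
have nX : `|X| <= `|h| * (`|V| + 1).
  have -> : X = h *: (h^-1 *: X) by rewrite scalerA mulfV // scale1r.
  rewrite normrZ ler_wpM2l //.
  have := ler_normB V (V - h^-1 *: X); rewrite subKr; lra.
have nX2 : onorm X ^+ 2 <= 2 * K * `|h| ^+ 2.
  apply: le_trans (onorm_sup _) _.
  rewrite (_ : 2 * K * _ = 8 * (`|h| * (`|V| + 1)) ^+ 2); last by rewrite /K; ring.
  by rewrite ler_wpM2l // ler_sqr ?nnegrE // mulr_ge0 // ltW.
have gE : g h = X + P by rewrite /X subrK.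
have gP : oinner (g h) P = oinner X P + 1 by rewrite gE oinnerDl PP.
have low : oinner X P <= onorm (g h) - 1.
  have := le_trans (ler_norm _) (oinner_CS (g h) P); rewrite P1 mulr1 gP; lra.
have up : onorm (g h) - 1 <= oinner X P + onorm X ^+ 2 / 2.
  have : onorm (g h) ^+ 2 = onorm X ^+ 2 + 2 * oinner X P + 1.
    rewrite -!oinner_sqr gE oinnerDl !(oinnerDr X P) PP (oinnerC P X); ring.
  by have := sqr_ge0 (onorm (g h) - 1); rewrite sqrrB1; lra.
have D : `|oinner (h^-1 *: X) P - h^-1 * (onorm (g h) - 1)| <= e / 2.
  rewrite oinnerZl -mulrBr normrM normfV ler_pdivrMl ?normr_gt0 //.
  have -> : `|oinner X P - (onorm (g h) - 1)| = onorm (g h) - 1 - oinner X P.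
    by rewrite distrC ger0_norm // subr_ge0.
  apply: (@le_trans _ _ (K * `|h| ^+ 2)); first by lra.
  rewrite expr2 mulrCA ler_wpM2l // -ler_pdivlMl // mulrC ltW //.
have := ler_normD (oinner V P - oinner (h^-1 *: X) P) (oinner (h^-1 *: X) P - h^-1 * (onorm (g h) - 1)).
rewrite addrA subrK => T; apply: le_trans T _; lra.
Unshelve. all: by end_near. Qed.

Definition maps_ball Omega (f : O -> O) := forall J (z : C), imag_units J -> normc z < 1 ->
  Omega (slice J (rip z)) /\ onorm (f (slice J (rip z))) < 1.

(** Pairing [f] with its own boundary value [v] gives a function bounded by [|v|] in the disc with
    value [|v| ^ 2] at the boundary point. *)
Lemma onorm_boundary Omega f J q : symmetric_slice_domain Omega -> imag_units J ->
  slice_regular Omega f -> maps_ball Omega f -> normc (cpx q) = 1 ->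
  Omega (slice J q) -> onorm (f (slice J q)) <= 1.
Proof.
move=> sO JJ rf mB nq Oq.
have [v vE] : exists v, v = f (slice J q) by eexists.
pose phi z := hprod J (f (slice J (rip z))) v.
have c : ccont phi (cpx q) by apply: sd_cont; exact: (regular_holomorphic sO JJ rf Oq v).
have E : phi (cpx q) = (onorm v ^+ 2)%:C by rewrite /phi cpxK -vE; exact: hprodxx.
have : normc (phi (cpx q)) <= onorm v.
  apply: (ccont_bound nq c) => z z1; apply: le_trans (hprod_CS _ _ JJ) _.
  by have [_ f1] := mB J z JJ z1; rewrite ler_piMl ?onorm_ge0 // ltW.
rewrite E normc_real ger0_norm ?sqr_ge0 // -vE => H.
have := onorm_ge0 v; rewrite le_eqVlt => /predU1P[<-|v0]; first by [].
by move: H; rewrite expr2 ger_pMl.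
Qed.

Lemma boundary_hprod Omega f J q : symmetric_slice_domain Omega -> imag_units J ->
  slice_regular Omega f -> maps_ball Omega f -> normc (cpx q) = 1 ->
  Omega (slice J q) -> onorm (f (slice J q)) = 1 ->
  let lam := cpx q * hprod J (partial_x f J q) (f (slice J q)) in
  complex.Im lam = 0 /\ 0 <= complex.Re lam.
Proof.
move=> sO JJ rf mB nq Oq P1.
have [HD _] := regular_vdiff JJ (trace_open sO JJ) rf Oq.
move: P1 HD; have [P PE] : exists P, P = f (slice J q) by eexists.
rewrite -PE => P1 HD.
apply: (boundary_derivative nq (HD P)) => [z z1|].
  apply: le_trans (hprod_CS _ _ JJ) _; rewrite P1 mulr1.
  by have [_ f1] := mB J z JJ z1; exact: ltW.
have -> : (f \o slice J) (rip (cpx q)) = P by rewrite PE cpxK.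
by rewrite hprodxx // P1 expr1n.
Qed.

Lemma slice_deriveE Omega f w : symmetric_slice_domain Omega -> slice_regular Omega f ->
  Omega w -> slice_derive f w = partial_x f (iunit w) (coords w).
Proof.
move=> sO rf Ow; rewrite /slice_derive.
have JJ : imag_units (iunit w) := iunit_imag w.
have Oq : Omega (slice (iunit w) (coords w)) by rewrite slice_iunit.
have [_ ->] := regular_vdiff JJ (trace_open sO JJ) rf Oq.
by rewrite imag_mulK // opprK scaler_half_double.
Qed.

Lemma partial_x_real f I J x : partial_x f I (x, 0) = partial_x f J (x, 0).
Proof.
have E K : (fun h : R => h^-1 *: (((f \o slice K) \o shift (x, 0)) (h *: ((1, 0) : R * R))
    - (f \o slice K) (x, 0))) = (fun h => h^-1 *: (f (oreal (h + x)) - f (oreal x))).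
  apply/funext => h; rewrite /comp /shift.
  have -> : h *: ((1, 0) : R * R) + (x, 0) = (h + x, 0).
    by apply/pair_equal_spec; rewrite /= /GRing.scale /= mulr1 mulr0 addr0.
  by rewrite !slice0.
by rewrite /partial_x /derive !E.
Qed.

End BoundaryDerivative.

(** * The octonionic identity at the boundary point *)

Section BoundaryIdentity.
Variable R : realType.
Local Notation C := R[i].
Local Notation O := (octonion R).
Implicit Types (u v w I J : O) (a b : R) (p q : R * R) (F G : R * R -> O) (Omega : set O).

Opaque omul.

Lemma oRe_mul u v : oRe (u ** v) = oinner u (oconj v).
Proof. by rewrite /oinner oconjK. Qed.

Lemma oinner_conj u v : oinner (oconj u) (oconj v) = oinner u v.
Proof. by rewrite !oinnerE /=; ring. Qed.

Lemma oinner_mulr u v w : oinner (v ** u) (w ** u) = oinner u u * oinner v w.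
Proof. by rewrite -oinner_conj !oconjM oinner_mul !oinner_conj. Qed.

Lemma oinner_bracket_slice I p u w : imag_units I -> w ** slice I p = slice I p ** w ->
  oinner (obracket (oconj (slice I p)) u) w = 0.
Proof.
move=> II c; rewrite /obracket oinnerBl oinner_adjl oconjK oinner_adjr oconjK.
by rewrite -c subrr.
Qed.

Lemma oassoc_slice I p u v : oassoc (slice I p) u v = p.2 *: oassoc I u v.
Proof.
rewrite /oassoc !slice_mul omulDl !omulZl.
move: ((I ** u) ** v) (I ** (u ** v)) (u ** v) => x y z.
by rewrite scalerBr opprD addrACA subrr add0r.
Qed.

Lemma oinner_oassoc_1 I u v : imag_units I -> oRe (oassoc I u v) = 0.
Proof.
move=> II; have [I0 _] := imag_unitP II.
have r1 x : oRe x = oinner x (oreal 1) by rewrite oinner_realr mul1r.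
have E1 : oinner ((I ** u) ** v) (oreal 1) = oinner u (- (I ** oconj v)).
  by rewrite oinner_adjr oreal_mull scale1r oinner_adjl oconj_imag // omulNl.
have E2 : oinner (I ** (u ** v)) (oreal 1) = oinner u (- (I ** oconj v)).
  by rewrite oinner_adjl oreal_mulr scale1r oconj_imag // oinner_adjr omulNl.
by rewrite r1 /oassoc oinnerBl E1 E2 subrr.
Qed.

Lemma oinner_oassoc_I I u v : imag_units I -> oinner (oassoc I u v) I = 0.
Proof.
move=> II; have [I0 I1] := imag_unitP II.
have r1 x : oRe x = oinner x (oreal 1) by rewrite oinner_realr mul1r.
have E1 : oinner ((I ** u) ** v) I = oinner u (oconj v).
  by rewrite oinner_adjr oinner_mul oinner_sqr I1 expr1n mul1r.
have E2 : oinner (I ** (u ** v)) I = oinner u (oconj v).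
  rewrite oinner_adjl -{2}(oconjK I) omul_conj_norm onorm_conj I1 expr1n -r1.
  exact: oRe_mul.
by rewrite /oassoc oinnerBl E1 E2 subrr.
Qed.

(* [beta] is the [J]-coefficient of [f] on the sphere of [xi = a + b I]; the last
   hypothesis says that [P conj beta] lies in [C_I], hence so does the left-hand side,
   and its two coordinates are computed by pairing it with [1] and [I]. *)
Lemma boundary_algebra I a b (P D h beta : O) : imag_units I -> b != 0 ->
  b *: D - beta = (2 * b ^+ 2) *: (I ** h) ->
  (forall w, oRe w = 0 -> oinner w I = 0 -> oinner (w ** beta) P = 0) ->
  P ** oconj D + obracket (oconj (slice I (a, b))) (P ** oconj h)
    + 2 *: oassoc (slice I (a, b)) P h = slice I (oinner P D, oinner P (I ** D)).
Proof.
move=> II b0 Db perp; have [I0 I1] := imag_unitP II.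
set E := _ + _ + _.
pose u := P ** oconj h.
(* Scaling by [b] allows [D] to be eliminated in favour of [beta]. By [omul_anticomm],
   [I ** u + u ** I] lies in [C_I], so only [P ** oconj beta] is left to locate. *)
have bE : b *: E = P ** oconj beta - b ^+ 2 *: (I ** u + u ** I).
  have -> : oconj beta = b *: oconj D + (2 * b ^+ 2) *: (oconj h ** I).
    have -> : beta = b *: D - (2 * b ^+ 2) *: (I ** h) by rewrite -Db subKr.
    by rewrite oconjD oconjN !oconjZ oconjM (oconj_imag I0) omulNr scalerN opprK.
  rewrite /E oassoc_slice oassoc_conj /obracket oconj_slice // -/u.
  have -> : slice I ((a, b).1, - (a, b).2) ** u = a *: u - b *: (I ** u).
    by rewrite slice_mul /= scaleNr.
  have -> : u ** slice I ((a, b).1, - (a, b).2) = a *: u - b *: (u ** I).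
    by rewrite /slice omulDr oreal_mulr omulZr /= scaleNr.
  rewrite omulDr !omulZr /=.
  move: (I ** u) (u ** I) (P ** oconj D) (P ** (oconj h ** I)) => Iu uI PD PhI.
  by clear; oct_ring.
have inI : E = slice I (oRe E, oinner E I).
  apply: (in_slice II) => w w0 wI.
  have : oinner w (b *: E) = 0.
    rewrite bE oinnerBr -oinner_adjr perp // oinnerZr omul_anticomm I0 mulr0 scale0r !add0r.
    by rewrite oinnerBr oinnerZr wI oinner_realr w0; ring.
  move=> wbE; have : b * oinner w E = 0 by rewrite -[LHS](oinnerZr b E w).
  by move/eqP; rewrite mulf_eq0 (negbTE b0) => /eqP.
have ReD x y : oRe (x + y) = oRe x + oRe y by [].
have reE : oRe E = oinner P D.
  rewrite /E 2!ReD.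
  have r1 x : oRe x = oinner x (oreal 1) by rewrite oinner_realr mul1r.
  have -> : oRe (2 *: oassoc (slice I (a, b)) P h) = 0.
    by rewrite r1 oinnerZl oassoc_slice oinnerZl -r1 oinner_oassoc_1 // !mulr0.
  have -> : oRe (obracket (oconj (slice I (a, b))) (P ** oconj h)) = 0.
    rewrite r1; apply: (oinner_bracket_slice _ II).
    by rewrite oreal_mull oreal_mulr.
  by rewrite !addr0 oRe_mul oconjK.
have imE : oinner E I = oinner P (I ** D).
  rewrite /E 2!oinnerDl oinnerZl oassoc_slice oinnerZl oinner_oassoc_I // !mulr0 addr0.
  rewrite oinner_bracket_slice //; last by rewrite slice_mul /slice omulDr oreal_mulr omulZr.
  by rewrite addr0 oinner_adjr oconjK.
by clearbody E; move: inI; rewrite reE imE.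
Qed.

Lemma imag_odd_part I G p : imag_units I ->
  I ** odd_part I G p = 2^-1 *: (G p - G (pconj p)).
Proof.
move=> II; rewrite /odd_part; move: (G p - G (pconj p)) => x.
by rewrite omulNr omulZr imag_mulK // scalerN opprK.
Qed.

Lemma sub_oppr_scale (x y z : O) (c : R) : y - x = - c *: z -> x - y = c *: z.
Proof. by move=> /(congr1 -%R); rewrite opprB scaleNr opprK. Qed.

Lemma scale_half2 (x : O) (c : R) : c *: x = 2^-1 *: ((2 * c) *: x).
Proof. by rewrite scalerA mulKf ?pnatr_eq0. Qed.

Lemma omul_imag_inj I (x y : O) : imag_units I -> I ** x = I ** y -> x = y.
Proof.
move=> II E; apply: oppr_inj.
exact: etrans (esym (imag_mulK x II)) (etrans (congr1 (omul I) E) (imag_mulK y II)).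
Qed.

Lemma quotient_collect (D x h be : O) (c : R) : c *: x = be -> D - x = (2 * c) *: h ->
  c *: D - be = (2 * c ^+ 2) *: h.
Proof. by move=> <- E; rewrite -scalerBr E scalerA; congr (_ *: _); ring. Qed.

Opaque slice oreal.

(** With [g] the first quotient and [q = (x, y)], [f xi - f (oconj xi) = 2 y I g (oconj xi)]
    identifies the odd part as [y g (oconj xi)]. Dividing [g] at [oconj xi], with [g xi] the
    derivative, introduces the second quotient. *)
Lemma second_quotient Omega f I q : symmetric_slice_domain Omega -> imag_units I ->
  slice_regular Omega f -> Omega (slice I q) ->
  q.2 *: partial_x f I q - odd_part I (f \o slice I) q =
    (2 * q.2 ^+ 2) *: (I ** quotient_at Omega (oconj (slice I q))
                              (quotient_at Omega (slice I q) f) (slice I q)).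
Proof.
move=> sO II rf Oq; have [_ _ _ symO] := sO.
have Hg := quotient_atP sO II rf Oq.
have gD := quotient_center sO II rf Oq Hg.
set g := quotient_at Omega (slice I q) f in Hg gD *.
have [rg _] := Hg.
have Oq' : Omega (slice I (pconj q)) := axially_symmetric_pconj symO II Oq.
rewrite oconj_slice // -/(pconj q).
have Hh := quotient_atP sO II rg Oq'.
set h := quotient_at Omega (slice I (pconj q)) g in Hh *.
have d1 : pconj q - q = (0, - (2 * q.2)).
  by case: (q) => x y; apply/pair_equal_spec; rewrite /=; split; ring.
have d2 : q - pconj q = (0, 2 * q.2).
  by case: (q) => x y; apply/pair_equal_spec; rewrite /=; split; ring.
have mulE (y : R) v : slice I (0, y) ** v = y *: (I ** v).
  by rewrite slice_mul scale0r add0r.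
have E1 : f (slice I (pconj q)) - f (slice I q) = - (2 * q.2) *: (I ** g (slice I (pconj q))).
  by rewrite -mulE -d1; exact: (quotient_slice sO II Hg Oq').
have E2 : partial_x f I q - g (slice I (pconj q)) = (2 * q.2) *: (I ** h (slice I q)).
  by rewrite -mulE -d2 -gD; exact: (quotient_slice sO II Hh Oq).
have E3 : q.2 *: g (slice I (pconj q)) = odd_part I (f \o slice I) q.
  have : I ** (q.2 *: g (slice I (pconj q))) = I ** odd_part I (f \o slice I) q.
    have H : f (slice I q) - f (slice I (pconj q)) = (2 * q.2) *: (I ** g (slice I (pconj q))).
      exact: sub_oppr_scale E1.
    apply: etrans (omulZr _ _ _) _.
    apply: etrans _ (esym (imag_odd_part (f \o slice I) q II)).
    apply: etrans _ (congr1 (fun x => 2^-1 *: x) (esym H)).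
    exact: scale_half2.
  exact: omul_imag_inj.
exact: (quotient_collect E3 E2).
Qed.

Lemma boundary_perp Omega f I q w : symmetric_slice_domain Omega -> imag_units I ->
  slice_regular Omega f -> maps_ball Omega f -> normc (cpx q) = 1 ->
  Omega (slice I q) -> onorm (f (slice I q)) = 1 -> oRe w = 0 -> oinner w I = 0 ->
  oinner (w ** odd_part I (f \o slice I) q) (f (slice I q)) = 0.
Proof.
move=> sO II rf mB nq Oq P1 w0 wI; have [_ _ _ symO] := sO.
have [I0 I1] := imag_unitP II.
have /stem_ofP[_ E] := representation sO II rf.
set al := even_part (f \o slice I) q; set be := odd_part I (f \o slice I) q.
have fE J : imag_units J -> f (slice J q) = al + J ** be.
  by move=> JJ; rewrite (E _ _ JJ (symO _ _ _ II JJ Oq)).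
clearbody al be.
have sq J : imag_units J -> onorm (al + J ** be) ^+ 2 =
    onorm al ^+ 2 + onorm be ^+ 2 + 2 * oinner al (J ** be).
  move=> JJ; have [_ J1] := imag_unitP JJ.
  rewrite -[LHS]oinner_sqr oinnerDl !oinnerDr (oinnerC (J ** be) al).
  by rewrite (oinner_sqr (J ** be)) onormM J1 mul1r oinner_sqr; ring.
have key J : imag_units J -> oinner al (J ** be) <= oinner al (I ** be).
  move=> JJ; have := onorm_boundary sO JJ rf mB nq (symO _ _ _ II JJ Oq).
  move=> n1; have : onorm (f (slice J q)) ^+ 2 <= 1 by rewrite expr_le1 // onorm_ge0.
  have : onorm (f (slice I q)) ^+ 2 = 1 by rewrite P1 expr1n.
  by rewrite (fE J JJ) (fE I II) (sq J JJ) (sq I II); lra.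
have m0 := max_imag_unit II key w0 wI.
(* The term that remains, [<w be, I be>], is [|be| ^ 2 <w, I>]. *)
rewrite fE // oinnerDr (oinnerC _ al) m0 add0r.
by rewrite oinner_mulr wI mulr0.
Qed.

End BoundaryIdentity.

Section BoundaryTheorem.
Variable R : realType.
Local Notation C := R[i].
Local Notation O := (octonion R).
Implicit Types (u v w I J : O) (a b : R) (p q : R * R) (F G : R * R -> O) (Omega : set O).

Opaque omul slice oreal.

Lemma obracket_real a u : obracket (oreal a) u = 0.
Proof. by rewrite /obracket oreal_mull oreal_mulr subrr. Qed.

Lemma real_octonion I u : imag_units I -> (forall J, imag_units J -> oinner u J = 0) ->
  u = slice I (oRe u, 0).
Proof.
move=> II H; rewrite -[X in (_, X)](H I II); apply: (in_slice II) => w w0 wI.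
have [n0|n0] := eqVneq (onorm w) 0; first by rewrite (onorm_eq0 n0) oinner0l.
have K : imag_units ((onorm w)^-1 *: w).
  apply: imag_unitI.
    have r1 (x : O) : oRe x = oinner x (oreal 1) by rewrite oinner_realr mul1r.
    by rewrite r1 oinnerZl -r1 w0 mulr0.
  by rewrite onormZ normfV ger0_norm ?onorm_ge0 // mulVf.
have := H _ K; rewrite oinnerZr oinnerC => /eqP.
by rewrite mulf_eq0 invr_eq0 (negbTE n0) /= => /eqP.
Qed.

(** Off the real axis this is [boundary_algebra]. For real [xi] the bracket and the associator
    vanish, and [boundary_hprod] for every unit [J] gives [<D, J P> = 0], so that [P ** oconj D] is
    real. *)
Lemma boundary_octonion Omega f I q (P D h : O) : symmetric_slice_domain Omega ->
  imag_units I -> slice_regular Omega f -> maps_ball Omega f -> normc (cpx q) = 1 ->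
  Omega (slice I q) -> onorm P = 1 -> P = f (slice I q) -> D = partial_x f I q ->
  h = quotient_at Omega (oconj (slice I q)) (quotient_at Omega (slice I q) f) (slice I q) ->
  P ** oconj D + obracket (oconj (slice I q)) (P ** oconj h)
    + 2 *: oassoc (slice I q) P h = slice I (oinner P D, oinner P (I ** D)).
Proof.
move=> sO II rf mB nq Oq P1 PE DE hE.
have [q0|q0] := eqVneq q.2 0; last first.
  have Db := second_quotient sO II rf Oq; rewrite -DE -hE in Db.
  have P1' : onorm (f (slice I q)) = 1 by rewrite -PE.
  have perp w : oRe w = 0 -> oinner w I = 0 -> oinner (w ** odd_part I (f \o slice I) q) P = 0.
    by rewrite PE; exact: (boundary_perp sO II rf mB nq Oq P1').
  have := @boundary_algebra R I q.1 q.2 P D h _ II q0 Db perp.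
  by rewrite -surjective_pairing.
have qE : q = (q.1, 0) by rewrite -q0; case: (q).
have sE : slice I q = oreal q.1 by rewrite qE slice0.
rewrite oassoc_slice q0 scale0r scaler0 addr0 {1}sE oconj_real obracket_real addr0.
have q10 : q.1 != 0.
  apply/eqP => q10; have := nq; rewrite qE q10 normc0 => /eqP.
  by rewrite eq_sym oner_eq0.
have key J : imag_units J -> oinner D (J ** P) = 0.
  move=> JJ; have [_ _ _ symO] := sO; have OJ : Omega (slice J q) := symO _ _ _ II JJ Oq.
  have EJ : slice J q = slice I q by rewrite sE qE slice0.
  have P1J : onorm (f (slice J q)) = 1 by rewrite EJ -PE.
  have [+ _] := boundary_hprod sO JJ rf mB nq OJ P1J.
  rewrite EJ -PE; have -> : partial_x f J q = D by rewrite DE qE; exact: partial_x_real.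
  rewrite /hprod; have -> : cpx q = q.1%:C by rewrite qE.
  move: (oinner D P) (oinner D (J ** P)) => x y /=; rewrite mul0r addr0 => /eqP.
  by rewrite mulf_eq0 (negbTE q10) => /eqP.
have aJ J : imag_units J -> oinner P (J ** D) = 0.
  move=> JJ; have [J0 _] := imag_unitP JJ.
  by rewrite oinnerC oinner_adjl oconj_imag // omulNl oinnerNr key ?oppr0.
rewrite aJ //.
have := @real_octonion I (P ** oconj D) II; rewrite oRe_mul oconjK; apply => J JJ.
by rewrite oinner_adjr oconjK aJ.
Qed.

(** As [cpx q] has modulus 1 and [cpx q * L = d] is real, [L] is [d] times the conjugate of
    [cpx q]. *)
Lemma hprod_boundary q (L : C) (d : R) : normc (cpx q) = 1 ->
  complex.Im (cpx q * L) = 0 -> d = complex.Re (cpx q * L) ->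
  complex.Re L = d * q.1 /\ complex.Im L = - (d * q.2).
Proof.
move=> nq; have := normc_sqr (cpx q); rewrite nq expr1n.
case: q {nq} => a b; case: L => x y /= ab im ->.
split; last first.
  have : y * 1 = y * (a ^+ 2 + b ^+ 2) by rewrite -ab.
  have : a * (a * y + b * x) = 0 by rewrite im mulr0.
  lra.
have : x * 1 = x * (a ^+ 2 + b ^+ 2) by rewrite -ab.
have : b * (a * y + b * x) = 0 by rewrite im mulr0.
lra.
Qed.

(** The element of [C_I] given by [boundary_octonion] is [d * xi]; multiplying by [oconj xi] leaves
    [d]. *)
Lemma boundary_formula Omega f I q (P D h : O) (d : R) : symmetric_slice_domain Omega ->
  imag_units I -> slice_regular Omega f -> maps_ball Omega f -> normc (cpx q) = 1 ->
  Omega (slice I q) -> onorm P = 1 -> P = f (slice I q) -> D = partial_x f I q ->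
  h = quotient_at Omega (oconj (slice I q)) (quotient_at Omega (slice I q) f) (slice I q) ->
  d = complex.Re (cpx q * hprod I D P) ->
  oreal d = oconj (slice I q) ** (P ** oconj D
    + obracket (oconj (slice I q)) (P ** oconj h) + 2 *: oassoc (slice I q) P h).
Proof.
move=> sO II rf mB nq Oq P1 PE DE hE dE; have [I0 I1] := imag_unitP II.
rewrite (boundary_octonion sO II rf mB nq Oq P1 PE DE hE).
have P1' : onorm (f (slice I q)) = 1 by rewrite -PE.
have [im _] := boundary_hprod sO II rf mB nq Oq P1'; rewrite -PE -DE in im.
have [reL imL] := hprod_boundary nq im dE.
have -> : oinner P D = d * q.1 by rewrite oinnerC -reL.
have -> : oinner P (I ** D) = d * q.2.
  rewrite oinnerC oinner_adjl (oconj_imag I0) omulNl oinnerNr.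
  by apply: oppr_inj; rewrite opprK -imL.
have -> : slice I (d * q.1, d * q.2) = d *: slice I q by rewrite slice_scale.
rewrite omulZr -{2}(oconjK (slice I q)) omul_conj_norm onorm_conj onorm_slice // nq expr1n.
by rewrite [LHS]oreal_scale.
Qed.

Lemma boundary_julia Omega f I q (P D A : O) (d : R) : symmetric_slice_domain Omega ->
  imag_units I -> slice_regular Omega f -> maps_ball Omega f -> normc (cpx q) = 1 ->
  Omega (slice I q) -> onorm P = 1 -> P = f (slice I q) -> D = partial_x f I q ->
  A = f 0 -> d = complex.Re (cpx q * hprod I D P) ->
  `|1 - oinner A P| ^+ 2 / (1 - onorm A ^+ 2) <= d.
Proof.
move=> sO II rf mB nq Oq P1 PE DE AE dE.
have [HD _] := regular_vdiff II (trace_open sO II) rf Oq.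
pose F z := f (slice I (rip z)).
have F1 z : normc z < 1 -> onorm (F z) < 1 by move=> z1; have [] := mB I z II z1.
have sF v z : normc z < 1 -> sd (fun z => hprod I (F z) v) z.
  move=> z1; have [Oz _] := mB I z II z1.
  by have := regular_holomorphic sO II rf Oz v; rewrite ripK.
have F0 : F 0 = A by rewrite /F AE; congr f; rewrite -(oreal0 R) -(slice0 I 0).
have A1 : onorm A < 1 by rewrite -F0; apply: F1; rewrite normc0.
have FP : F (cpx q) = P by rewrite /F cpxK -PE.
have A2 : 0 < 1 - onorm A ^+ 2 by rewrite subr_gt0 expr_lt1 // onorm_ge0.
have P1' : onorm (f (slice I q)) = 1 by rewrite -PE.
have [im re] := boundary_hprod sO II rf mB nq Oq P1'; rewrite -PE -DE in im re.
have hlt u v : onorm u <= 1 -> onorm v < 1 -> hprod I u v != 1.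
  move=> u1 v1; apply: contraTneq (lexx (1 : R)) => E; rewrite -ltNge -[ltLHS](normc1 R) -E.
  apply: le_lt_trans (hprod_CS _ _ II) _; apply: le_lt_trans v1.
  by rewrite ler_piMl ?onorm_ge0.
have HP : sdiff (fun z => hprod I (F z) P) (cpx q) (hprod I D P) by rewrite DE; exact: HD.
have cA : ccont (fun z => hprod I (F z) A) (cpx q) := sdiff_cont (HD A).
have := @julia R (fun z => hprod I (F z) P) (fun z => hprod I (F z) A) (cpx q) (hprod I D P)
  (1 - onorm A ^+ 2) nq A2 (sF P) (sF A) HP cA.
rewrite FP F0 !hprodxx // P1 expr1n.
have nAP : hprod I A P != 1.
  by rewrite (hprod_conj P A II); apply: contra_neq (hlt P A _ A1) => [/(congr1 conjc)|]; rewrite ?conjcK ?rmorph1 ?P1.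
move=> /(_ erefl nAP) H.
have {H} H : normc (1 - hprod I P A) * normc (1 - hprod I A P)
    <= (1 - onorm A ^+ 2) * normc (hprod I D P).
  apply: H.
  - by rewrite rmorphB rmorph1 subKr.
  - by move=> z z1; apply: hlt => //; apply: ltW; exact: F1.
  - move=> z z1; apply: hprod_pick => //; first by apply: ltW; exact: F1.
    by rewrite P1.
have nL : normc (hprod I D P) = d.
  have : normc (cpx q * hprod I D P) = normc (hprod I D P) by rewrite normcM nq mul1r.
  move=> <-; rewrite dE; move: im re; case: (cpx q * hprod I D P) => x y /= -> x0.
  by rewrite expr0n /= addr0 sqrtr_sqr ger0_norm.
have nPA : normc (1 - hprod I P A) = normc (1 - hprod I A P).
  by rewrite (hprod_conj A P II) -[RHS]normc_conj rmorphB rmorph1.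
rewrite nPA nL in H.
rewrite ler_pdivrMr // mulrC; apply: le_trans H; rewrite -expr2.
rewrite ler_sqr ?nnegrE ?normc_ge0 //.
(* The real inner product is the real part of the Hermitian one, so the complex Julia bound is the
   stronger of the two. *)
by apply: le_trans (normc_Re (1 - hprod I A P)); rewrite /hprod.
Qed.

End BoundaryTheorem.

(** * The extremal functions *)

Section Extremal.
Variable R : realType.
Local Notation C := R[i].
Local Notation O := (octonion R).
Implicit Types (u v w I J : O) (a b : R) (p q : R * R) (f g : O -> O) (Omega : set O).
Implicit Types (z : C) (A B : R * R -> C).

Opaque omul slice oreal.

(** The embedding of the field [C] onto [C_I]; it lets computations with stems in [C_I] be carried
    out by field arithmetic. *)
Definition plane I z : O := slice I (rip z).

Lemma scale_pair a (x y : R) : a *: ((x, y) : R * R) = (a * x, a * y).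
Proof. by []. Qed.

Lemma planeD I z1 z2 : plane I (z1 + z2) = plane I z1 + plane I z2.
Proof. by rewrite /plane slice_add; case: z1; case: z2. Qed.

Lemma planeN I z : plane I (- z) = - plane I z.
Proof.
rewrite /plane -[RHS]scaleN1r slice_scale; congr slice.
by case: z => x y; rewrite /rip /= scale_pair !mulN1r.
Qed.

Lemma planeB I z1 z2 : plane I (z1 - z2) = plane I z1 - plane I z2.
Proof. by rewrite planeD planeN. Qed.

Lemma plane_real I a : plane I a%:C = oreal a.
Proof. exact: slice0. Qed.

Lemma planeZ I a z : plane I (a%:C * z) = a *: plane I z.
Proof.
rewrite /plane slice_scale; congr slice.
by case: z => x y; rewrite /rip /= scale_pair !mul0r subr0 addr0.
Qed.

Lemma plane_i I : plane I (0 +i* 1) = I.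
Proof. by rewrite /plane sliceE /= oreal0 scale1r add0r. Qed.

Lemma planeM I z1 z2 : imag_units I -> plane I (z1 * z2) = plane I z1 ** plane I z2.
Proof.
move=> II; have Ii := plane_i I.
have E z : z = (complex.Re z)%:C + (complex.Im z)%:C * (0 +i* 1).
  by case: z => x y; apply/eqP; rewrite eq_complex /=; apply/andP; split; apply/eqP; ring.
have IE z : I ** plane I z = plane I ((0 +i* 1) * z).
  rewrite {1}(E z) planeD plane_real planeZ Ii omulDr oreal_mulr omulZr II.
  rewrite -oreal_mulr -{1}Ii oreal_mulr -planeZ -(plane_real I) -planeZ -planeD; congr plane.
  case: z => x y; apply/eqP; rewrite eq_complex /=; apply/andP; split; apply/eqP; ring.
rewrite {2}/plane slice_mul IE -!planeZ -planeD; congr plane.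
by rewrite {1}(E z1) mulrDl -mulrA.
Qed.

Lemma plane_conj I z : imag_units I -> plane I z^* = oconj (plane I z).
Proof. by move=> II; rewrite /plane (oconj_slice _ II); congr slice; case: z. Qed.

Lemma planeK I p : plane I (cpx p) = slice I p.
Proof. by rewrite /plane; congr slice; case: p. Qed.

Lemma planeE I z : slice I (rip z) = plane I z.
Proof. by []. Qed.

Lemma plane_mul_sum I J p z1 z2 : imag_units J ->
  slice J p ** (plane I z1 + J ** plane I z2) =
    plane I (p.1%:C * z1 - p.2%:C * z2) + J ** plane I (p.1%:C * z2 + p.2%:C * z1).
Proof.
move=> JJ; rewrite slice_mul planeB planeD !planeZ.
move: (plane I z1) (plane I z2) => u v; rewrite !omulDr imag_mulK // !omulZr.
have H (s t x y : O) : s + t + (x - y) = s - y + (t + x) by rewrite (addrC x) addrACA.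
by rewrite !scalerDr scalerN; exact: H.
Qed.

Lemma onorm_plane I z : imag_units I -> onorm (plane I z) = normc z.
Proof. by move=> II; rewrite /plane (onorm_slice _ II); congr normc; case: z. Qed.

Lemma plane_eq0 I z : imag_units I -> plane I z = 0 <-> z = 0.
Proof.
move=> II; split=> [E|->]; last by rewrite (plane_real I 0) oreal0.
by case: (eqVneq z 0) => //; rewrite -normc_gt0 -(onorm_plane z II) E onorm0 ltxx.
Qed.

Lemma oinv_plane I z : imag_units I -> z != 0 -> Defs.oinv (plane I z) = plane I z^-1.
Proof.
move=> II z0; rewrite /Defs.oinv -(plane_conj z II) -planeZ (onorm_plane z II); congr plane.
apply: (mulfI z0); rewrite mulfV // mulrCA.
have -> : z * z^* = (normc z ^+ 2)%:C.
  rewrite normc_sqr; case: (z) => x y /=.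
  by apply/eqP; rewrite eq_complex /=; apply/andP; split; apply/eqP; ring.
by rewrite -rmorphM mulVf // expf_neq0 // gt_eqF // normc_gt0.
Qed.

Opaque plane.

Definition even_oddC A B := (forall p, A (pconj p) = A p) /\ (forall p, B (pconj p) = - B p).

(** A stem with values in [C_I]. Such functions are closed under the regular operations, which
    become operations on pairs of complex functions, even though [f] is evaluated on every slice
    [C_J]. *)
Definition plane_stem I Omega f A B := even_oddC A B /\
  stem_of Omega f (fun p => plane I (A p), fun p => plane I (B p)).

Lemma plane_stemP I Omega f A B : even_oddC A B ->
  (forall J p, imag_units J -> Omega (slice J p) ->
     f (slice J p) = plane I (A p) + J ** plane I (B p)) -> plane_stem I Omega f A B.
Proof.
move=> eo H; split; first exact: eo.
apply/stem_ofP; split; last exact: H.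
case: eo => eA oB; split=> p; first exact: (congr1 (plane I) (eA p)).
exact: etrans (congr1 (plane I) (oB p)) (planeN I (B p)).
Qed.

Lemma plane_stem_mul I Omega f g A B A' B' : imag_units I -> axially_symmetric Omega ->
  plane_stem I Omega f A B -> plane_stem I Omega g A' B' ->
  plane_stem I Omega (regular_mul Omega f g)
    (fun p => A p * A' p - B p * B' p) (fun p => A p * B' p + B p * A' p).
Proof.
move=> II sO [[eA oB] sf] [[eA' oB'] sg]; apply: plane_stemP.
  by split=> p; rewrite eA oB eA' oB' ?mulrNN // mulrN mulNr opprD.
move=> J p JJ Op; rewrite (regular_mulE sO JJ sf sg Op) /=.
by rewrite planeB planeD !planeM.
Qed.

Lemma plane_stem_conj I Omega f A B : imag_units I -> axially_symmetric Omega ->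
  plane_stem I Omega f A B ->
  plane_stem I Omega (regular_conj Omega f) (fun p => (A p)^*) (fun p => (B p)^*).
Proof.
move=> II sO [[eA oB] sf]; apply: plane_stemP.
  by split=> p; rewrite ?eA // oB rmorphN.
by move=> J p JJ Op; rewrite (regular_conjE sO JJ sf Op) /= !plane_conj.
Qed.

Lemma plane_stem_idmul I Omega f A B : plane_stem I Omega f A B ->
  plane_stem I Omega (fun w => w ** f w)
    (fun p => p.1%:C * A p - p.2%:C * B p) (fun p => p.1%:C * B p + p.2%:C * A p).
Proof.
move=> [[eA oB] /stem_ofP[_ E]]; apply: plane_stemP.
  split=> p; rewrite eA oB /= rmorphN; first by rewrite mulrNN.
  by rewrite mulrN mulNr opprD.
by move=> J p JJ Op; rewrite (E J p JJ Op) plane_mul_sum.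
Qed.

Lemma plane_stem_slice I Omega f A B p : imag_units I -> plane_stem I Omega f A B ->
  Omega (slice I p) -> f (slice I p) = plane I (A p + (0 +i* 1) * B p).
Proof.
move=> II [_ /stem_ofP[_ E]] Op.
by rewrite (E I p II Op) /= planeD planeM // plane_i.
Qed.

Variables (xi : O) (a : R) (I : O) (q : R * R).
Hypotheses (II : imag_units I) (xiE : xi = slice I q).
Local Notation zeta := (cpx q).

Let al p : C := 1 - a%:C * p.1%:C * zeta^*.
Let be p : C := - (a%:C * p.2%:C * zeta^*).

(* The symmetrization of [1 - w a conj xi] at [slice J p], read in [C] for any [J]. *)
Definition denom_norm p : C := (1 - a%:C * zeta^* * cpx p) * (1 - a%:C * zeta * cpx p).

Let xi_conj : oconj xi = plane I zeta^*.
Proof. by rewrite xiE plane_conj // planeK. Qed.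

Let denom_stem Omega : plane_stem I Omega (extremal_denom xi a) al be.
Proof.
apply: plane_stemP.
  by split=> p; rewrite /al /be /= // rmorphN mulrN mulNr.
move=> J p JJ _; rewrite /extremal_denom /al /be.
rewrite oreal_mulr omulZl slice_mul xi_conj planeB planeN -!mulrA !planeZ plane_real.
rewrite omulNr !omulZr scalerDr opprD addrA.
by congr (_ + _ - _ *: _); congr (- (_ *: _)).
Qed.

Let denom_normE p : denom_norm p = al p * (al p)^* - be p * (be p)^*
    + (0 +i* 1) * (al p * (be p)^* + be p * (al p)^*).
Proof.
rewrite /denom_norm /al /be; case: p => x y; case: (q) => u v.
by apply/eqP; rewrite eq_complex /=; apply/andP; split; apply/eqP; ring.
Qed.

Let D := extremal_dom xi a.
Let d := extremal_denom xi a.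

(** The symmetrization has a real stem, so it preserves every slice and its value is the same
    complex number read in each [C_J]. *)
Lemma symmetrization_denom Omega J p : axially_symmetric Omega -> imag_units J ->
  Omega (slice J p) -> symmetrization Omega d (slice J p) = plane J (denom_norm p).
Proof.
move=> sO JJ Op; have ds := denom_stem Omega.
have [_ /stem_ofP[_ E]] := plane_stem_mul II sO ds (plane_stem_conj II sO ds).
rewrite /symmetrization (E J p JJ Op) /= denom_normE [RHS]planeD (planeM 'i _ JJ) plane_i.
have re z : z * z^* = (complex.Re (z * z^*))%:C.
  by case: z => x y; apply/eqP; rewrite eq_complex /=; apply/andP; split; apply/eqP; ring.
have re2 z (z' : C) : z * z'^* + z' * z^* = (complex.Re (z * z'^* + z' * z^*))%:C.
  by case: z z' => x y [x' y']; apply/eqP; rewrite eq_complex /=; apply/andP; split; apply/eqP; ring.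
rewrite re2 (re (al p)) (re (be p)).
move: (complex.Re _) (complex.Re _) (complex.Re _) => x y z.
by rewrite -(rmorphB (real_complex R)) !plane_real.
Qed.

Lemma extremal_domE J p : imag_units J -> D (slice J p) <-> denom_norm p != 0.
Proof.
move=> JJ; rewrite /D /extremal_dom /= (@symmetrization_denom setT J p) //.
by rewrite (plane_eq0 _ JJ); split=> /eqP.
Qed.

Lemma extremal_dom_symmetric : axially_symmetric D.
Proof. by move=> J K p JJ KK /(extremal_domE _ JJ) H; apply/(extremal_domE _ KK). Qed.

Lemma denom_norm_pconj p : denom_norm (pconj p) = (denom_norm p)^*.
Proof.
rewrite /denom_norm; case: p => x y; case: (q) => u v.
by apply/eqP; rewrite eq_complex /=; apply/andP; split; apply/eqP; ring.
Qed.

Let T p : C := (denom_norm p)^-1.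
Let Tpconj p : T (pconj p) = (T p)^*.
Proof. by rewrite /T denom_norm_pconj fmorphV. Qed.

Let ReT p : C := (complex.Re (T p))%:C.
Let ImT p : C := (complex.Im (T p))%:C.

Let ReT_pconj p : ReT (pconj p) = ReT p.
Proof. by rewrite /ReT Tpconj; case: (T p). Qed.

Let ImT_pconj p : ImT (pconj p) = - ImT p.
Proof. by rewrite /ImT Tpconj -rmorphN; case: (T p). Qed.

Let al_pconj p : al (pconj p) = al p. Proof. by []. Qed.

Let be_pconj p : be (pconj p) = - be p.
Proof. by rewrite /be /= rmorphN mulrN mulNr. Qed.

Let recip_stem : plane_stem I D (regular_recip D d)
  (fun p => ReT p * (al p)^* - ImT p * (be p)^*) (fun p => ReT p * (be p)^* + ImT p * (al p)^*).
Proof.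
apply: plane_stemP.
  split=> p; rewrite ReT_pconj ImT_pconj al_pconj be_pconj rmorphN.
    by rewrite mulrNN.
  by rewrite mulrN mulNr opprD.
move=> J p JJ Dp; have n0 := (extremal_domE p JJ).1 Dp.
have [_ /stem_ofP[_ E]] := plane_stem_conj II extremal_dom_symmetric (denom_stem D).
rewrite /regular_recip (symmetrization_denom extremal_dom_symmetric JJ Dp) oinv_plane //.
by rewrite (E J p JJ Dp) -[plane J _]planeE plane_mul_sum.
Qed.

Let num_stem : plane_stem I D (fun v => v ** oconj xi - oreal a)
  (fun p => p.1%:C * zeta^* - a%:C) (fun p => p.2%:C * zeta^*).
Proof.
apply: plane_stemP.
  by split=> p //=; rewrite rmorphN mulNr.
move=> J p JJ _; rewrite slice_mul xi_conj planeB !planeZ plane_real.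
by rewrite omulZr addrAC.
Qed.

(** On [C_I] the reciprocal of the symmetrization cancels against the conjugate factor and leaves
    [z] times a Moebius map. *)
Lemma extremal_stem : exists A B, plane_stem I D (extremal xi a) A B /\
  forall p, D (slice I p) -> A p + (0 +i* 1) * B p =
     cpx p * (cpx p * zeta^* - a%:C) / (1 - a%:C * zeta^* * cpx p).
Proof.
have sm := plane_stem_idmul (plane_stem_mul II extremal_dom_symmetric recip_stem num_stem).
eexists; eexists; split; first exact: sm.
move=> p Dp; have := (extremal_domE p II).1 Dp; rewrite {1}/denom_norm mulf_eq0 negb_or.
move=> /andP[n1 n2].
have TE : T p * (1 - a%:C * zeta * cpx p) = (1 - a%:C * zeta^* * cpx p)^-1.
  by rewrite /T /denom_norm invfM mulfVK.
rewrite -TE /ReT /ImT /al /be; move: (T p); case: (p) => x y; case: (q) => u v [t s].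
by apply/eqP; rewrite eq_complex /=; apply/andP; split; apply/eqP; ring.
Qed.

End Extremal.

(** * Equality in Julia's inequality *)

Section JuliaExtremal.
Variable R : realType.
Local Notation C := R[i].
Local Notation O := (octonion R).
Implicit Types (u v w I J : O) (q : R * R).
Implicit Types (phi psi : C -> C) (zeta : C).

Opaque omul slice oreal plane.

Lemma invc_unit zeta : normc zeta = 1 -> zeta^-1 = zeta^*.
Proof.
move=> n1; have z0 : zeta != 0 by rewrite -normc_gt0 n1.
apply: (mulfI z0); rewrite mulfV //.
have := normc_sqr zeta; rewrite n1 expr1n; case: zeta {n1 z0} => x y /= E.
by apply/eqP; rewrite eq_complex /=; apply/andP; split; apply/eqP; lra.
Qed.

Lemma sdiff_boundary_unique phi psi zeta L M : normc zeta = 1 ->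
  sdiff phi zeta L -> sdiff psi zeta M ->
  (forall z : C, normc z < 1 -> phi z = psi z) -> L = M.
Proof.
move=> n1 sL sM E.
have E1 := boundary_agree n1 (sdiff_cont sL) (sdiff_cont sM) E.
have := boundary_agree n1 (ccont_diff_quot sL) (ccont_diff_quot sM).
rewrite /diff_quot eqxx; apply=> z z1; case: eqVneq z1 => [->|_ z1]; first by rewrite n1 ltxx.
by rewrite E1 E.
Qed.

(** Either [|phi 0| = 1], so that [phi] is constant 1 and [t = 1], or [julia_scalar] applies with
    [phi 0 = x + i y] and [t = x]. *)
Lemma julia_extremal phi zeta L (t : R) : normc zeta = 1 ->
  (forall z, normc z < 1 -> sd phi z) -> sdiff phi zeta L ->
  (forall z, normc z < 1 -> normc (phi z) <= 1) -> phi zeta = 1 -> t = complex.Re (phi 0) ->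
  [/\ -1 < t, t <= 1, (1 - t) / (1 + t) <= complex.Re (zeta * L) &
      complex.Re (zeta * L) = (1 - t) / (1 + t) -> forall z : C, normc z < 1 ->
        phi z = (zeta^-1 * z + t%:C) / (1 + t%:C * (zeta^-1 * z))].
Proof.
move=> n1 hphi sL b1 p1 tE.
have n0 : normc (0 : C) < 1 by rewrite normc0.
have [c1|c1] := eqVneq (normc (phi 0)) 1.
  have cst := constant_of_max hphi b1 c1.
  have p0 : phi 0 = 1.
    by rewrite -p1; apply/esym/(boundary_agree n1 (sdiff_cont sL) (ccont_cst _ _) cst).
  have t1 : t = 1 by rewrite tE p0.
  have L0 : L = 0 by apply: (sdiff_boundary_unique n1 sL (sdiff_cst (phi 0) zeta) cst).
  rewrite L0 t1 mulr0 subrr mul0r; split=> // _ z z1.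
  rewrite cst // p0 mul1r addrC divff // -normc_gt0.
  apply: lt_le_trans (normc_ler_add _ _); rewrite normc1 subr_gt0.
  by rewrite normcM invc_unit // normc_conj n1 mul1r.
have c2 : normc (phi 0) < 1 by rewrite lt_neqAle c1 b1.
have [im re] := boundary_derivative n1 sL b1 p1.
have J := julia_scalar n1 hphi sL b1 p1 c2.
have nL : normc L = complex.Re (zeta * L).
  have : normc (zeta * L) = normc L by rewrite normcM n1 mul1r.
  move=> <-; move: im re; case: (zeta * L) => x y /= -> x0.
  by rewrite expr0n /= addr0 sqrtr_sqr ger0_norm.
have zL : zeta * L = (complex.Re (zeta * L))%:C by move: im; case: (zeta * L) => x y /= ->.
rewrite nL in J; move: (complex.Re (zeta * L)) re zL J => lam lam0 zL.
have q2 := normc_sqr (phi 0); have d2 := normc_sqr (1 - phi 0).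
have l2 : normc (phi 0) ^+ 2 < 1 by rewrite expr_lt1 // normc_ge0.
rewrite d2 q2; rewrite q2 in l2.
move: tE l2; case E0 : (phi 0) => [x y] /= -> l2 J.
have y2 := sqr_ge0 y; have t1 : -1 < x by nra.
have t2 : x < 1 by nra.
have p : 0 < 1 + x by lra.
split=> //; first exact: ltW.
  rewrite ler_pdivrMr //; have : (1 - x) * (1 - x) <= (1 - x) * (lam * (1 + x)) by nra.
  by rewrite ler_pM2l // subr_gt0.
(* After multiplication by [1 + x], equality reduces Julia's inequality to [2 y ^ 2 <= 0]; so
   [phi 0] is real, as [julia_rigidity] requires. *)
move=> lE; have y0 : y = 0.
  have : lam * (1 + x) = 1 - x by rewrite lE divfK // gt_eqF.
  move=> {}lE; have : (1 + x) * ((1 - x) ^+ 2 + y ^+ 2) <= (1 - x ^+ 2 - y ^+ 2) * (lam * (1 + x)).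
    nra.
  rewrite lE => H; apply/eqP; rewrite -sqrf_eq0 eq_le sqr_ge0 andbT; nra.
apply: (julia_rigidity n1 hphi sL b1 p1 _ _ _).
- by rewrite E0 y0.
- by rewrite ltr_norml t1 t2.
- by rewrite zL lE.
Qed.

Lemma le0_of_radial (c M r0 : R) : r0 < 1 -> 0 <= M ->
  (forall r, r0 <= r -> r < 1 -> c <= M * (1 - r)) -> c <= 0.
Proof.
move=> r01 M0 H; rewrite leNgt; apply/negP => c0.
have M1 : 0 < M + 1 by lra.
have k0 : 0 < c / (M + 1) / 2 by rewrite !divr_gt0.
have := H (Num.max r0 (1 - c / (M + 1) / 2)); rewrite le_max lexx /= gt_max r01 => /(_ erefl).
have -> /= : 1 - c / (M + 1) / 2 < 1 by lra.
move=> /(_ erefl) H1.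
have H2 : 1 - Num.max r0 (1 - c / (M + 1) / 2) <= c / (M + 1) / 2.
  by rewrite lerBlDr addrC -lerBlDr le_max lexx orbT.
have : c <= M * (c / (M + 1) / 2) by apply: le_trans H1 _; apply: ler_wpM2l.
have cE : c = (c / (M + 1)) * (M + 1) by rewrite divfK // gt_eqF.
have := k0; rewrite {3}cE; move: (c / (M + 1)) => k; nra.
Qed.

End JuliaExtremal.

Section BoundaryMoebius.
Variable R : realType.
Local Notation C := R[i].
Local Notation O := (octonion R).
Implicit Types (u v w I J : O) (q : R * R) (t : R).
Implicit Types (phi psi : C -> C) (zeta : C).

Opaque omul slice oreal plane.

Lemma plane_mul1 I z : plane I z ** oreal 1 = plane I z.
Proof. by rewrite oreal_mulr scale1r. Qed.

Lemma hprod_planel I z u v : imag_units I -> hprod I (plane I z ** u) v = z * hprod I u v.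
Proof. by move=> II; rewrite -planeE hprod_slice // ripK. Qed.

Lemma hprod_plane I z v : imag_units I -> hprod I (plane I z) v = z * hprod I (oreal 1) v.
Proof. by move=> II; rewrite -{1}plane_mul1 hprod_planel. Qed.

Lemma oinner_plane I z v : imag_units I ->
  oinner (plane I z) v = complex.Re (z * hprod I (oreal 1) v).
Proof. by move=> II; rewrite -hprod_plane. Qed.

Lemma onorm_sub_plane I z u : imag_units I -> hprod I u (oreal 1) = z ->
  onorm (u - plane I z) ^+ 2 = onorm u ^+ 2 - normc z ^+ 2.
Proof.
move=> II uE; rewrite -!oinner_sqr oinnerBl !oinnerBr (oinnerC u).
rewrite (oinner_sqr (plane I z)) onorm_plane // oinner_plane // hprod_conj // uE.
have -> : complex.Re (z * z^*) = normc z ^+ 2.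
  by rewrite normc_sqr; case: (z) => x y /=; ring.
by ring.
Qed.

(** For [|zeta| = 1] and [|t| < 1], an automorphism of the disc with values [t] at 0 and 1 at
    [zeta]; for [t = 1] it is constant 1 on the disc. *)
Definition boundary_moebius zeta t z : C := (zeta^-1 * z + t%:C) / (1 + t%:C * (zeta^-1 * z)).

Lemma moebius_denom zeta t z : normc zeta = 1 -> `|t| <= 1 -> normc z < 1 ->
  0 < 1 - `|t| * normc z /\ 1 - `|t| * normc z <= normc (1 + t%:C * (zeta^-1 * z)).
Proof.
move=> n1 t1 z1; split.
  by rewrite subr_gt0; apply: le_lt_trans z1; rewrite ler_piMl ?normc_ge0.
have <- : normc (t%:C * (zeta^-1 * z)) = `|t| * normc z.
  by rewrite !normcM normc_real invc_unit // normc_conj n1 mul1r.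
by rewrite -[X in X - _](normc1 R) normc_ler_add.
Qed.

Lemma sd_boundary_moebius zeta t z : normc zeta = 1 -> `|t| <= 1 -> normc z < 1 ->
  sd (boundary_moebius zeta t) z.
Proof.
move=> n1 t1 z1; have [c0 c1] := moebius_denom n1 t1 z1.
apply: sdM; first by apply: sdD; [apply: sdM; [exact: sd_cst|exact: sd_id]|exact: sd_cst].
apply: sdV; first by rewrite -normc_gt0 (lt_le_trans c0).
apply: sdD; first exact: sd_cst.
by apply: sdM; [exact: sd_cst|apply: sdM; [exact: sd_cst|exact: sd_id]].
Qed.

(** The defect is [(1 - t ^ 2) (1 - |z| ^ 2)] over the squared modulus of the denominator, which is
    at least [1 - |t|]. For [t = 1] both sides are 0. *)
Lemma boundary_moebius_defect zeta t z : normc zeta = 1 -> -1 < t -> t <= 1 -> normc z < 1 ->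
  1 - normc (boundary_moebius zeta t z) ^+ 2 <=
    (1 - t ^+ 2) / (1 - `|t|) ^+ 2 * (1 - normc z ^+ 2).
Proof.
move=> n1 t0 t1 z1; have t2 : `|t| <= 1 by rewrite ler_norml t1 ltW.
have [c0 c1] := moebius_denom n1 t2 z1.
rewrite /boundary_moebius; set w := zeta^-1 * z.
have wz : normc z = normc w by rewrite normcM invc_unit // normc_conj n1 mul1r.
have d0 : 0 < normc (1 + t%:C * w) by exact: lt_le_trans c1.
have id : normc (1 + t%:C * w) ^+ 2 - normc (w + t%:C) ^+ 2 = (1 - t ^+ 2) * (1 - normc w ^+ 2).
  by rewrite !normc_sqr; case: (w) => x y /=; ring.
have -> : 1 - normc ((w + t%:C) / (1 + t%:C * w)) ^+ 2 =
    (1 - t ^+ 2) * (1 - normc w ^+ 2) / normc (1 + t%:C * w) ^+ 2.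
  have -> : normc ((w + t%:C) / (1 + t%:C * w)) = normc (w + t%:C) / normc (1 + t%:C * w).
    rewrite normcM; congr (_ * _); apply: (mulfI (lt0r_neq0 d0)).
    rewrite mulfV ?lt0r_neq0 // -normcM mulfV ?normc1 //.
    by rewrite -normc_gt0.
  by rewrite -id; field; rewrite lt0r_neq0.
rewrite -wz; have [->|t3] := eqVneq t 1; first by rewrite expr1n subrr !mul0r.
have t4 : `|t| < 1 by rewrite ltr_norml t0 lt_neqAle t3 t1.
have zz : 0 <= 1 - normc z ^+ 2 by rewrite subr_ge0 expr_le1 ?normc_ge0 // ltW.
have tt : 0 <= 1 - t ^+ 2 by rewrite subr_ge0 -real_normK ?num_real // expr_le1.
rewrite mulrAC; apply: ler_wpM2r => //; apply: ler_wpM2l => //.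
have k0 : 0 < 1 - `|t| by rewrite subr_gt0.
rewrite lef_pV2 ?posrE ?exprn_gt0 // ler_sqr ?nnegrE ?normc_ge0 ?(ltW k0) //.
by apply: le_trans c1; rewrite lerD2l lerN2 ler_piMr // ltW.
Qed.

(* The component of [G] orthogonal to [C_I] is bounded by [1 - |hprod I (G z) 1| ^ 2],
   which tends to [0] at the circle, so the maximum principle kills it. *)
Lemma plane_of_extremal I (G : C -> O) zeta t : imag_units I -> normc zeta = 1 ->
  -1 < t -> t <= 1 ->
  (forall v (z : C), normc z < 1 -> sd (fun z => hprod I (G z) v) z) ->
  (forall z : C, normc z < 1 -> onorm (G z) <= 1) ->
  (forall z : C, normc z < 1 -> hprod I (G z) (oreal 1) = boundary_moebius zeta t z) ->
  forall z : C, normc z < 1 -> G z = plane I (boundary_moebius zeta t z).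
Proof.
move=> II n1 t0 t1 sG bG GE z z1; have t2 : `|t| <= 1 by rewrite ler_norml t1 ltW.
pose om := boundary_moebius zeta t; pose K := (1 - t ^+ 2) / (1 - `|t|) ^+ 2.
have K0 : 0 <= K.
  by rewrite divr_ge0 ?sqr_ge0 // subr_ge0 -real_normK ?num_real // expr_le1.
apply/eqP; rewrite -subr_eq0; apply/eqP; apply: (hprod_inj II) => v.
pose N (z : C) := hprod I (G z - plane I (om z)) v.
have sN (w : C) : normc w < 1 -> sd N w.
  move=> w1; have E x : hprod I (G x) v - om x * hprod I (oreal 1) v = N x.
    by rewrite /N hprodBl hprod_plane.
  apply: (@sd_near R 1 _ _ _ ltr01 (fun x _ => E x)); apply: sdB; first exact: sG.
  by apply: sdM; [exact: sd_boundary_moebius|exact: sd_cst].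
pose M := onorm v ^+ 2 * K.
have M0 : 0 <= M by rewrite mulr_ge0 ?sqr_ge0.
(* The defect controls the square of the orthogonal component, and [N ^+ 2] is as holomorphic as
   [N]. *)
have bN (w : C) : normc w < 1 -> normc (N w ^+ 2) <= M * (1 - normc w ^+ 2).
  move=> w1; rewrite normcX.
  apply: le_trans (_ : (onorm (G w - plane I (om w)) * onorm v) ^+ 2 <= _).
    by rewrite ler_sqr ?nnegrE ?normc_ge0 ?mulr_ge0 ?onorm_ge0 ?hprod_CS.
  rewrite exprMn (onorm_sub_plane II (GE w w1)) mulrC /M -mulrA ler_wpM2l ?sqr_ge0 //.
  apply: le_trans (boundary_moebius_defect n1 t0 t1 w1).
  by rewrite lerB // expr_le1 ?onorm_ge0 ?bG.
have : normc (N z ^+ 2) <= 0.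
  apply: (@le0_of_radial R _ (2 * M) (Num.max (normc z) (2^-1))).
  - by rewrite gt_max z1; lra.
  - by rewrite mulr_ge0.
  move=> r; rewrite ge_max => /andP[zr r2] r1; have r0 : 0 < r by lra.
  have B : normc (N z ^+ 2) <= M * (1 - r ^+ 2).
    apply: (@max_modulus R [::] (fun z => N z ^+ 2) 0 r) => //.
    - by rewrite mulr_ge0 // subr_ge0 expr_le1 // ltW.
    - by move=> w; rewrite subr0 => wr; apply/ccontX/sd_cont/sN; apply: le_lt_trans r1.
    - by move=> w; rewrite subr0 => wr _; apply/sdX/sN; apply: lt_trans r1.
    - by move=> w; rewrite subr0 => wr; rewrite -wr bN // wr.
    - by rewrite subr0.
  apply: le_trans B _; have -> : 2 * M * (1 - r) = M * (2 * (1 - r)) by ring.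
  by apply: ler_wpM2l => //; nra.
rewrite normcX => H; have : normc (N z) ^+ 2 == 0 by rewrite eq_le H sqr_ge0.
rewrite expf_eq0 => /andP[_ /eqP H0]; apply/eqP; apply: contraT => n0.
by have := normc_gt0 (N z); rewrite H0 ltxx n0.
Qed.

End BoundaryMoebius.

Section SliceExtremal.
Variable R : realType.
Local Notation C := R[i].
Local Notation O := (octonion R).
Implicit Types (u v w I J : O) (q : R * R) (t : R).
Implicit Types (phi psi : C -> C) (zeta : C).

Opaque omul slice oreal plane.

Lemma hprod_slicer I q u : imag_units I ->
  hprod I u (slice I q) = conjc (cpx q) * hprod I u (oreal 1).
Proof.
move=> II; rewrite (hprod_conj (slice I q) u II) -(planeK I q) hprod_plane //.
by rewrite (hprod_conj (oreal 1) u II) rmorphM.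
Qed.

Lemma hprod_oreal1 I : imag_units I -> hprod I (oreal 1) (oreal 1) = 1.
Proof. by move=> II; rewrite hprodxx // onorm_real normr1 expr1n. Qed.

(** The scalar Schwarz lemma bounds every component of the quotient [u] by [|v|]; taking [v = u]
    gives [|u| ^ 2 <= |u|]. *)
Lemma slice_quot_bound I (F : R * R -> O) (D0 : O) : imag_units I ->
  (forall v (z : C), normc z < 1 -> sd (fun z => hprod I (F (rip z)) v) z) ->
  (forall z : C, normc z < 1 -> onorm (F (rip z)) <= 1) -> F (0, 0) = 0 ->
  vdiff I F (0, 0) D0 ->
  forall z : C, normc z < 1 -> onorm (slice_quot I F (0, 0) D0 (rip z)) <= 1.
Proof.
move=> II sF bF F0 vF z z1; set u := slice_quot _ _ _ _ _.
suff H v : normc (hprod I u v) <= onorm v.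
  have := H u; rewrite hprodxx // normc_real ger0_norm ?sqr_ge0 //.
  have [->|u0] := eqVneq (onorm u) 0; first by rewrite ler01.
  by rewrite expr2 ger_pMl // lt_neqAle eq_sym u0 onorm_ge0.
pose phi (z : C) := hprod I (F (rip z)) v.
have p0 : phi 0 = 0 by rewrite /phi (_ : rip 0 = (0, 0)) // F0 hprod0l.
have bp (w : C) : normc w < 1 -> normc (phi w) <= onorm v * normc w.
  apply: schwarz; [exact: onorm_ge0|exact: sF|exact: p0|].
  move=> x x1; apply: le_trans (hprod_CS _ _ II) _.
  by rewrite ler_piMl ?onorm_ge0 ?bF.
have off (w : C) : w != 0 -> normc w < 1 ->
    normc (diff_quot phi 0 (hprod I D0 v) w) <= onorm v.
  move=> w0 w1; rewrite diff_quotE // p0 !subr0.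
  have nw : 0 < normc w by rewrite normc_gt0.
  rewrite -(ler_pM2r nw) -normcM divfK //; exact: bp.
rewrite /u hprod_slice_quot // -/phi -[cpx (0, 0)]/(0 : C).
have [->|z0] := eqVneq z 0; last exact: off.
apply: (ccont_le ltr01 (ccont_diff_quot (vF v))) => w w0; rewrite subr0; exact: off.
Qed.

(** [om = <F / z, 1>_I] has value 1 at [cpx q] and real part [t] at 0; its derivative times [cpx q]
    has real part [d - 1], so [julia_extremal] for [om] is the claim for [d]. *)
Lemma slice_extremal I (F : R * R -> O) q (D0 D : O) (t d : R) : imag_units I ->
  normc (cpx q) = 1 ->
  (forall v (z : C), normc z < 1 -> sd (fun z => hprod I (F (rip z)) v) z) ->
  (forall z : C, normc z < 1 -> onorm (F (rip z)) <= 1) -> F (0, 0) = 0 ->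
  F q = slice I q -> vdiff I F (0, 0) D0 -> vdiff I F q D ->
  t = oRe D0 -> d = complex.Re (cpx q * hprod I D (slice I q)) ->
  [/\ -1 < t, t <= 1, 2 / (1 + t) <= d & d = 2 / (1 + t) -> forall z : C, normc z < 1 ->
        F (rip z) = plane I (z * boundary_moebius (cpx q) t z)].
Proof.
move=> II n1 sF bF F0 Fq v0 vq tE dE.
pose G z := slice_quot I F (0, 0) D0 (rip z).
have bG : forall z : C, normc z < 1 -> onorm (G z) <= 1 := slice_quot_bound II sF bF F0 v0.
have GE v z : hprod I (G z) v =
    diff_quot (fun z => hprod I (F (rip z)) v) 0 (hprod I D0 v) z := hprod_slice_quot F (0, 0) D0 v z II.
have sG v (z : C) : normc z < 1 -> sd (fun z => hprod I (G z) v) z.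
  move=> z1; apply: (@sd_near R 1 _ _ _ ltr01 (fun x _ => esym (GE v x))).
  apply: (sd_diff_quot_all ltr01 (v0 v)); last by rewrite subr0.
  by move=> w; rewrite subr0; exact: sF.
pose om z := hprod I (G z) (oreal 1).
pose phi z := hprod I (F (rip z)) (oreal 1).
have zeta0 : cpx q != 0 by rewrite -normc_gt0 n1.
have phi0 : phi 0 = 0 by rewrite /phi (_ : rip 0 = (0, 0)) // F0 hprod0l.
have omE (z : C) : z != 0 -> om z = phi z * z^-1.
  by move=> z0; rewrite /om GE diff_quotE // -/(phi z) -/(phi 0) phi0 !subr0.
have phiq : phi (cpx q) = cpx q.
  by rewrite /phi cpxK Fq -planeK hprod_plane // hprod_oreal1 // mulr1.
have omq : om (cpx q) = 1 by rewrite omE // phiq mulfV.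
have bom (z : C) : normc z < 1 -> normc (om z) <= 1.
  move=> z1; apply: le_trans (hprod_CS _ _ II) _.
  by rewrite onorm_real normr1 mulr1 bG.
set h := hprod I D (oreal 1).
have som : sdiff om (cpx q) (h * (cpx q)^-1 + phi (cpx q) * - (cpx q ^- 2)).
  apply: (@sdiff_near R 1 (fun z => phi z * z^-1)); first exact: ltr01.
    move=> w w1; rewrite -omE //; apply: contraTneq w1 => ->.
    by rewrite sub0r normcN n1 ltxx.
  by apply: sdiffM; [exact: vq|exact: sdiff_inv].
have om0 : om 0 = hprod I D0 (oreal 1) by rewrite /om GE /diff_quot eqxx.
have tE' : t = complex.Re (om 0) by rewrite om0 /hprod /= oinner_realr mul1r.
have [t0 t1 le eq] := julia_extremal n1 (sG (oreal 1)) som bom omq tE'.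
have lamE : complex.Re (cpx q * (h * (cpx q)^-1 + phi (cpx q) * - (cpx q ^- 2))) = d - 1.
  have -> : cpx q * (h * (cpx q)^-1 + phi (cpx q) * - (cpx q ^- 2)) = h - 1.
    by rewrite phiq; field.
  rewrite dE hprod_slicer // -/h -(invc_unit n1) mulrA mulfV // mul1r.
  by case: (h).
rewrite lamE in le eq.
have p0 : 0 < 1 + t by lra.
have E2 : 2 / (1 + t) = (1 - t) / (1 + t) + 1 by field; rewrite lt0r_neq0.
split; [exact: t0|exact: t1|by rewrite E2 -lerBrDr|].
move=> dE2 z z1.
have {}eq := eq _; have {}eq : forall z : C, normc z < 1 -> om z = boundary_moebius (cpx q) t z.
  by apply: eq; rewrite dE2 E2 addrK.
have := plane_of_extremal II n1 t0 t1 sG bG eq z1.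
rewrite planeM // => <-; rewrite /G /slice_quot.
case: eqVneq => [zE|z0].
  by rewrite zE F0 -(ripK z) zE (plane_real I 0) oreal0 omul0l.
have z0' : z != 0 by apply: contra_neq z0 => ->.
rewrite -planeE F0 !subr0 ripK slice_inv_mul //.
Qed.

End SliceExtremal.

Section FixedBoundaryPoint.
Variable R : realType.
Local Notation C := R[i].
Local Notation O := (octonion R).
Implicit Types (u v w I J : O) (p q : R * R) (t : R) (Omega : set O) (f : O -> O).
Implicit Types (phi psi : C -> C) (zeta : C).

Opaque omul slice oreal plane.

Lemma sdiff_blaschke zeta t (c : C) : 1 + t%:C * (zeta^-1 * c) != 0 ->
  sdiff (fun z => z * boundary_moebius zeta t z) c
    (boundary_moebius zeta t c
     + c * (zeta^-1 / (1 + t%:C * (zeta^-1 * c))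
            - (zeta^-1 * c + t%:C) * (t%:C * zeta^-1) / (1 + t%:C * (zeta^-1 * c)) ^+ 2)).
Proof.
move=> n0; have E x : 1 + t%:C * (zeta^-1 * x) = t%:C * zeta^-1 * x + 1.
  by rewrite addrC mulrA.
have s1 := sdiff_lin zeta^-1 t%:C c.
have s2 : sdiff (fun z => (t%:C * zeta^-1 * z + 1)^-1) c
    (- ((t%:C * zeta^-1 * c + 1) ^- 2) * (t%:C * zeta^-1)).
  apply: (sdiff_comp (sdiff_lin (t%:C * zeta^-1) 1 c)); apply: sdiff_inv; by rewrite -E.
have s3 := sdiffM (sdiff_id c) (sdiffM s1 s2).
have -> : (fun z => z * boundary_moebius zeta t z) =
    (fun z => z * ((zeta^-1 * z + t%:C) * (t%:C * zeta^-1 * z + 1)^-1)).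
  by apply/funext => z; rewrite /boundary_moebius E.
move: s3; congr sdiff; rewrite /boundary_moebius !E mul1r /=.
by move: ((t%:C * zeta^-1 * c + 1)^-1) (zeta^-1) => x y; ring.
Qed.

(** The formula is known only inside the disc; strict differentiability at the boundary point makes
    the radial approach determine the derivative there. *)
Lemma blaschke_derivative I (F : R * R -> O) q (D0 D : O) (t d : R) : imag_units I ->
  normc (cpx q) = 1 -> -1 < t -> t <= 1 -> vdiff I F (0, 0) D0 -> vdiff I F q D ->
  (forall z : C, normc z < 1 -> F (rip z) = plane I (z * boundary_moebius (cpx q) t z)) ->
  d = complex.Re (cpx q * hprod I D (slice I q)) ->
  oRe D0 = t /\ d = 2 / (1 + t).
Proof.
move=> II n1 t0 t1 v0 vq FE dE.
have E (z : C) : normc z < 1 ->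
    hprod I (F (rip z)) (oreal 1) = z * boundary_moebius (cpx q) t z.
  by move=> z1; rewrite FE // hprod_plane // hprod_oreal1 // mulr1.
have zeta0 : cpx q != 0 by rewrite -normc_gt0 n1.
have p0 : 0 < 1 + t by lra.
have p0' : (1 + t)%:C != 0 :> C.
  by apply/eqP => /(congr1 (@complex.Re R)) /= E0; rewrite E0 ltxx in p0.
split.
  have n0 : 1 + t%:C * ((cpx q)^-1 * 0) != 0 by rewrite !mulr0 addr0 oner_neq0.
  have := sdiff_unique (v0 (oreal 1)) (sdiff_near ltr01 _ (sdiff_blaschke n0)).
  rewrite /boundary_moebius !mulr0 mul0r add0r !addr0 divr1 => H.
  have {}H : hprod I D0 (oreal 1) = t%:C.
    by apply: H => w; rewrite subr0 => w1; rewrite E.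
  by have := congr1 (@complex.Re R) H; rewrite /hprod /= oinner_realr mul1r.
have Eq : 1 + t%:C * ((cpx q)^-1 * cpx q) = (1 + t)%:C by rewrite mulVf // mulr1 rmorphD.
have nq : 1 + t%:C * ((cpx q)^-1 * cpx q) != 0 by rewrite Eq.
have := sdiff_boundary_unique n1 (vq (oreal 1)) (sdiff_blaschke nq) E.
rewrite /boundary_moebius Eq => H.
rewrite dE hprod_slicer // -(invc_unit n1) mulrA mulfV // mul1r H.
have -> : (cpx q)^-1 * cpx q + t%:C = (1 + t)%:C by rewrite mulVf // rmorphD.
have -> : (1 + t)%:C / (1 + t)%:C +
    cpx q * ((cpx q)^-1 / (1 + t)%:C - (1 + t)%:C * (t%:C * (cpx q)^-1) / (1 + t)%:C ^+ 2)
    = (2 / (1 + t))%:C.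
  have -> : (2 / (1 + t))%:C = (2 : R)%:C / (1 + t)%:C :> C by rewrite rmorphM fmorphV.
  have -> : t%:C = (1 + t)%:C - 1 :> C by rewrite rmorphD /= addrC addKr.
  rewrite (_ : (2 : R)%:C = 2 :> C); last by rewrite rmorph_nat.
  by move: ((1 + t)%:C) p0' => s s0; field; rewrite zeta0 s0.
by [].
Qed.

Lemma boundary_plane I (F : R * R -> O) p (m : C -> C) : imag_units I ->
  normc (cpx p) = 1 -> ccont m (cpx p) -> holomorphic_slice I F p ->
  (forall z : C, normc z < 1 -> F (rip z) = plane I (m z)) -> F p = plane I (m (cpx p)).
Proof.
move=> II n1 cm hF E; apply/eqP; rewrite -subr_eq0; apply/eqP; apply: (hprod_inj II) => v.
rewrite hprodBl hprod_plane //; apply/eqP; rewrite subr_eq0; apply/eqP.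
have := @boundary_agree R (fun z => hprod I (F (rip z)) v)
  (fun z => m z * hprod I (oreal 1) v) (cpx p) n1 (sd_cont (hF v)).
rewrite cpxK; apply.
  by apply: ccontM => //; exact: ccont_cst.
by move=> z z1; rewrite E // hprod_plane.
Qed.

Lemma stem_of_subset Omega Omega' f FF : Omega' `<=` Omega -> stem_of Omega f FF ->
  stem_of Omega' f FF.
Proof. by move=> sub [h1 h2 h3]; split=> // J p JJ /sub; exact: h3. Qed.

Lemma blaschkeE zeta a z : normc zeta = 1 ->
  z * (z * conjc zeta - a%:C) / (1 - a%:C * conjc zeta * z) = z * boundary_moebius zeta (- a) z.
Proof.
move=> n1; rewrite /boundary_moebius -(invc_unit n1) rmorphN /= mulNr.
by rewrite -mulrA (mulrC z zeta^-1) (mulrA a%:C).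
Qed.

Lemma extremal_slice xi a I q p : imag_units I -> xi = slice I q -> normc (cpx q) = 1 ->
  extremal_dom xi a (slice I p) ->
  extremal xi a (slice I p) = plane I (cpx p * boundary_moebius (cpx q) (- a) (cpx p)).
Proof.
move=> II xiE n1 Dp; have [A [B [sE E]]] := extremal_stem a II xiE.
have E' := etrans (E p Dp) (blaschkeE a (cpx p) n1).
have E1 := plane_stem_slice II sE Dp.
have E2 := congr1 (plane I) E'.
apply: etrans E1 _.
exact: E2.
Qed.

Lemma extremal_dom_disc xi a I q p : imag_units I -> xi = slice I q -> normc (cpx q) = 1 ->
  `|a| <= 1 -> normc (cpx p) < 1 -> extremal_dom xi a (slice I p).
Proof.
move=> II xiE n1 a1 p1; apply/(extremal_domE _ II xiE _ II).
have H (c : C) : normc c = 1 -> 1 - a%:C * c * cpx p != 0.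
  move=> c1; have : normc (a%:C * c * cpx p) < 1.
    rewrite !normcM c1 mulr1 normc_real; apply: le_lt_trans p1.
    by rewrite ler_piMl ?normc_ge0.
  by apply: contraTneq => /eqP; rewrite subr_eq0 => /eqP <-; rewrite normc1 ltxx.
by rewrite /denom_norm mulf_neq0 // H // normc_conj.
Qed.

Lemma extremal_dom_boundary xi a I q p : imag_units I -> xi = slice I q ->
  normc (cpx q) = 1 -> extremal_dom xi a (slice I p) ->
  1 + (- a)%:C * ((cpx q)^-1 * cpx p) != 0.
Proof.
move=> II xiE n1 /(extremal_domE _ II xiE _ II).
rewrite /denom_norm mulf_eq0 negb_or => /andP[+ _].
have -> : Num.conj (cpx q) = (cpx q)^-1 by rewrite invc_unit.
by rewrite rmorphN /= mulNr mulrA.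
Qed.

(** Stems over [Om'] reduce the claim to [C_I], where it is the hypothesis inside the disc and
    follows by continuity on the circle. For [a = -1] the denominator vanishes at [- xi], which
    belongs to the sphere of [xi] when [xi] is imaginary; hence the restriction to
    [extremal_dom]. *)
Lemma eq_extremal Omega f I q xi a : symmetric_slice_domain Omega -> imag_units I ->
  slice_regular Omega f -> xi = slice I q -> normc (cpx q) = 1 -> `|a| <= 1 ->
  (forall z : C, normc z < 1 ->
     f (slice I (rip z)) = plane I (z * boundary_moebius (cpx q) (- a) z)) ->
  forall w, Omega w -> onorm w <= 1 -> extremal_dom xi a w -> f w = extremal xi a w.
Proof.
move=> sO II rf xiE n1 a1 fE w Ow w1 Dw; have [_ _ _ symO] := sO.
pose Om' : set O := [set w | [/\ Omega w, onorm w <= 1 & extremal_dom xi a w]].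
have symO' : axially_symmetric Om'.
  move=> J K p JJ KK [h1 h2 h3]; split; first exact: symO h1.
    by rewrite onorm_slice //; rewrite onorm_slice in h2.
  exact: (extremal_dom_symmetric II xiE JJ KK h3).
have [A [B [[_ sE] _]]] := extremal_stem a II xiE.
have s1 : stem_of Om' f _ := stem_of_subset (fun x '(And3 h _ _) => h) (representation sO II rf).
have s2 : stem_of Om' (extremal xi a) _ := stem_of_subset (fun x '(And3 _ _ h) => h) sE.
apply: (stem_agree symO' II s1 s2 _ (And3 Ow w1 Dw)).
move=> p [Op p1 Dp]; apply: etrans (esym (extremal_slice II xiE n1 Dp)).
have {}p1 : normc (cpx p) <= 1 by rewrite -(onorm_slice p II).
have [c1|c1] := eqVneq (normc (cpx p)) 1; last first.
  have := fE (cpx p); rewrite cpxK; apply; by rewrite lt_neqAle c1 p1.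
have n0 := extremal_dom_boundary II xiE n1 Dp.
apply: (@boundary_plane I (f \o slice I) p
  (fun z => z * boundary_moebius (cpx q) (- a) z) II c1 _ _ fE).
  exact: sdiff_cont (sdiff_blaschke n0).
exact: (regular_holomorphic sO II rf Op).
Qed.

Lemma fixed_boundary_point Omega f I q xi (D : O) (t d : R) : symmetric_slice_domain Omega ->
  imag_units I -> slice_regular Omega f -> maps_ball Omega f -> normc (cpx q) = 1 ->
  oball `|` xi_sphere xi `<=` Omega -> xi = slice I q -> f 0 = 0 -> f xi = xi ->
  D = partial_x f I q -> t = oRe (partial_x f I (0, 0)) ->
  d = complex.Re (cpx q * hprod I D xi) ->
  2 / (1 + t) <= d /\
  (d = 2 / (1 + t) <-> exists a : R, -1 <= a < 1 /\
     forall w, (oball `|` xi_sphere xi) w -> extremal_dom xi a w -> f w = extremal xi a w).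
Proof.
move=> sO II rf mB n1 sub xiE f0 fxi DE tE dE.
have s0 : slice I (0, 0) = 0 by rewrite slice0 oreal0.
have O0 : Omega (slice I (0, 0)).
  by apply: sub; left; rewrite /oball /= s0 onorm0.
have Oxi : xi_sphere xi xi by exists q, I, I.
have Oq : Omega (slice I q) by apply: sub; right; rewrite -xiE.
have sphere1 w : xi_sphere xi w -> onorm w = 1.
  move=> [p [J [K [JJ KK E ->]]]]; rewrite onorm_slice // -(onorm_slice p JJ) -E xiE.
  by rewrite onorm_slice.
have [v0 _] := regular_vdiff II (trace_open sO II) rf O0.
have [vq _] := regular_vdiff II (trace_open sO II) rf Oq; rewrite -DE in vq.
have sF v (z : C) : normc z < 1 -> sd (fun z => hprod I ((f \o slice I) (rip z)) v) z.
  move=> z1; have [Oz _] := mB I z II z1.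
  by have := regular_holomorphic sO II rf Oz v; rewrite ripK.
have bF (z : C) : normc z < 1 -> onorm ((f \o slice I) (rip z)) <= 1.
  by move=> z1; have [_ /ltW] := mB I z II z1.
have F0 : (f \o slice I) (0, 0) = 0 by rewrite /= s0.
have Fq : (f \o slice I) q = slice I q by rewrite /= -xiE.
rewrite xiE in dE.
have [t0 t1 le eq] := slice_extremal II n1 sF bF F0 Fq v0 vq tE dE.
split=> //; split.
  (* The Moebius factor takes the value [- a] at 0, which has to be [t]; and [-1 < t <= 1]. *)
  move=> /eq fE; exists (- t); split; first by lra.
  move=> w Uw Dw; apply: (eq_extremal sO II rf xiE n1 _ _ (sub _ Uw) _ Dw).
  - by rewrite normrN ler_norml t1 ltW.
  - by move=> z z1; rewrite opprK; exact: fE.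
  - by case: Uw => [|/sphere1 ->//]; exact: ltW.
move=> [a [/andP[a0 a1] fE]].
have fE' (z : C) : normc z < 1 ->
    (f \o slice I) (rip z) = plane I (z * boundary_moebius (cpx q) (- a) z).
  move=> z1; have Dz : extremal_dom xi a (slice I (rip z)).
    by apply: (extremal_dom_disc II xiE n1); rewrite ?ripK // ler_norml a0 ltW.
  have Bz : (oball `|` xi_sphere xi) (slice I (rip z)).
    by left; rewrite /oball /= onorm_slice // ripK.
  have E1 := extremal_slice II xiE n1 Dz; rewrite ripK in E1.
  have E2 := fE _ Bz Dz.
  exact: etrans E2 E1.
have a2 : -1 < - a by lra.
have a3 : - a <= 1 by lra.
have [t' ->] := blaschke_derivative II n1 a2 a3 v0 vq fE' dE.
by rewrite tE t'.
Qed.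

End FixedBoundaryPoint.

(** * The theorem *)

Section DirectionalDerivative.
Variable R : realType.
Local Notation C := R[i].
Local Notation O := (octonion R).
Implicit Types (u v w I J xi : O) (p q : R * R) (Omega : set O) (f : O -> O).

Opaque omul slice oreal plane.

Lemma maps_ball_of Omega f : oball `<=` Omega -> f @` oball `<=` oball -> maps_ball Omega f.
Proof.
move=> sub fB J z JJ z1.
have Bz : oball (slice J (rip z)) by rewrite /oball /= onorm_slice // ripK.
by split; [exact: sub|apply: fB; exists (slice J (rip z))].
Qed.

(** The points [xi + h xi] stay in [C_I], so the directional derivative of [f] is [xi ** D] with [D]
    the slice derivative; its product with [f xi] is the derivative of the modulus. *)
Lemma is_derive_onorm Omega f I q xi : symmetric_slice_domain Omega -> imag_units I ->
  slice_regular Omega f -> xi = slice I q -> Omega xi -> onorm (f xi) = 1 ->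
  is_derive xi xi (onorm \o f) (complex.Re (cpx q * hprod I (partial_x f I q) (f xi))).
Proof.
move=> sO II rf xiE Oxi P1.
have Oq : Omega (slice I q) by rewrite -xiE.
have [vq _] := regular_vdiff II (trace_open sO II) rf Oq.
have := cvg_is_derive (vdiff_is_derive (cpx q) II vq); rewrite cpxK.
set D := partial_x f I q => c.
have {}c : h^-1 *: (f (h *: xi + xi) - f xi) @[h --> (0:R)^'] --> slice I q ** D.
  move: c; apply: cvg_trans; apply: near_eq_cvg; near=> h.
  by rewrite /= xiE slice_scale slice_add.
rewrite -oinner_slice_mul //; apply: is_derive_cvg.
by have := onorm_derivative P1 c; rewrite /= P1.
Unshelve. all: by end_near.
Qed.

Lemma coords0 : coords (0 : O) = (0, 0).
Proof. by rewrite /coords /oIm (_ : oRe 0 = 0) // oreal0 subrr onorm0. Qed.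

Lemma oassoc_conj_self u v : (u ** v) ** oconj u = u ** (v ** oconj u).
Proof.
rewrite oconjE !omulBr !omulZr !oreal_mulr omul_flex.
by rewrite !scale1r.
Qed.

(** With [f xi = xi] the associator vanishes and [oconj xi] cancels [xi] on the left; as [d] is
    real, conjugating the result gives the stated form. *)
Lemma fixed_boundary_formula xi (D h : O) (d : R) : onorm xi = 1 ->
  oreal d = oconj xi ** (xi ** oconj D + obracket (oconj xi) (xi ** oconj h)
    + 2 *: oassoc xi xi h) -> oreal d = D - obracket xi h.
Proof.
move=> n1; have K u : oconj xi ** (xi ** u) = u by rewrite oconj_mul_norm n1 expr1n scale1r.
have -> : oassoc xi xi h = 0 by rewrite /oassoc omul_altl subrr.
rewrite scaler0 addr0 omulDr K /obracket K oassoc_conj_self omulBr K => /(congr1 (@oconj R)).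
by rewrite oconj_real oconjD oconjD oconjN !oconjM !oconjK opprB.
Qed.

End DirectionalDerivative.

Theorem theorem1p1 (R : realType) (xi : octonion R) (Omega : set (octonion R))
    (f : octonion R -> octonion R) :
  osphere xi ->
  symmetric_slice_domain Omega ->
  oball `|` xi_sphere xi `<=` Omega ->
  slice_regular Omega f ->
  f @` oball `<=` oball ->
  osphere (f xi) ->
  let RRf := quotient_at Omega (oconj xi) (quotient_at Omega xi f) in
  let deriv := 'D_xi (onorm \o f) xi in
  [/\ derivable (onorm \o f) xi xi,
      oreal deriv = oconj xi **
        (f xi ** oconj (slice_derive f xi)
         + obracket (oconj xi) (f xi ** oconj (RRf xi))
         + 2 *: oassoc xi (f xi) (RRf xi)),
      deriv >= `|1 - oinner (f 0) (f xi)| ^+ 2 / (1 - onorm (f 0) ^+ 2) &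
      f 0 = 0 -> f xi = xi ->
      [/\ oreal deriv = slice_derive f xi - obracket xi (RRf xi),
          deriv >= 2 / (1 + oRe (slice_derive f 0)) &
          deriv = 2 / (1 + oRe (slice_derive f 0)) <->
          exists a : R, -1 <= a < 1 /\
            forall w, (oball `|` xi_sphere xi) w -> extremal_dom xi a w ->
              f w = extremal xi a w]].
Proof.
move=> n1 sO sub rf fB P1 RRf deriv.
(* The slice derivative is defined with a chosen representation of [xi]; that representation is
   fixed here and then kept abstract, also when [xi] is real and the unit is arbitrary. *)
have [I [q [II xiE pxE]]] : exists I q, [/\ imag_units I, xi = slice I q &
    forall g, symmetric_slice_domain Omega -> slice_regular Omega g -> Omega xi ->
      slice_derive g xi = partial_x g I q].
  exists (iunit xi), (coords xi); split; [exact: iunit_imag|by rewrite slice_iunit|].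
  by move=> g; exact: slice_deriveE.
have mB : maps_ball Omega f by apply: maps_ball_of => // w Bw; apply: sub; left.
have Oxi : Omega xi by apply: sub; right; exists q, I, I.
have Oq : Omega (slice I q) by rewrite -xiE.
have nq : normc (cpx q) = 1 by rewrite -(onorm_slice q II) -xiE.
have DE := pxE f sO rf Oxi.
have PE : f xi = f (slice I q) by rewrite -xiE.
have der := is_derive_onorm sO II rf xiE Oxi P1.
have dE : deriv = complex.Re (cpx q * hprod I (slice_derive f xi) (f xi)).
  by rewrite /deriv derive_val DE.
have hE : RRf xi = quotient_at Omega (oconj (slice I q)) (quotient_at Omega (slice I q) f) (slice I q).
  by rewrite /RRf xiE.
have formula := boundary_formula sO II rf mB nq Oq P1 PE DE hE dE.
rewrite -xiE in formula.
split; [exact: ex_derive|exact: formula| |].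
  exact: (boundary_julia sO II rf mB nq Oq P1 PE DE erefl dE).
move=> f0 fxi; rewrite fxi in formula dE.
have tE : oRe (slice_derive f 0) = oRe (partial_x f I (0, 0)).
  have O0 : Omega 0 by apply: sub; left; rewrite /oball /= onorm0.
  have E := slice_deriveE sO rf O0; rewrite coords0 in E.
  by rewrite E (partial_x_real f _ I 0).
have [le eq] := fixed_boundary_point sO II rf mB nq sub xiE f0 fxi DE tE dE.
split; [exact: (fixed_boundary_formula n1 formula)|exact: le|exact: eq].
Qed.
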